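(* Let $\mathcal{F}=\mathcal{F}_{\sigma_0}\in\mathbf{Fl}^\omega_A(V)$ (with $\sigma_0\in\mathfrak{S}^\omega(E,A)$) be an $\omega$-isotropic generalized flag compatible with $E$, and let $\mathbf{P}=\mathbf{P}^\omega_{\mathcal{F}}$ be the corresponding splitting parabolic subgroup of $\mathbf{G}^\omega(E)$ containing $\mathbf{H}^\omega(E)$. Let $\mathbf{B}$ be any splitting Borel subgroup of $\mathbf{G}^\omega(E)$ containing $\mathbf{H}^\omega(E)$. (a) We have the decomposition $$\mathbf{G}^\omega(E)/\mathbf{P}^\omega_{\mathcal{F}}=\mathbf{Fl}(\mathcal{F},\omega,E)=\bigsqcup_{\sigma\in\mathbf{W}^\omega(E)\cdot\sigma_0}\mathbf{B}\mathcal{F}_\sigma=\bigsqcup_{w\in\mathbf{W}^\omega(E)/\mathbf{W}^\omega_{\mathbf{P}}(E)}\mathbf{B}\mathcal{F}_{\sigma_0\circ w^{-1}}.$$ (b) For $\mathcal{G}\in\mathbf{Fl}(\mathcal{F},\omega,E)$ the map $\sigma_{\mathcal{G}}:E\to A$ belongs to $\mathbf{W}^\omega(E)\cdot\sigma_0$. Moreover, $\mathcal{G}$ belongs to $\mathbf{B}\mathcal{F}_\sigma$ ($\sigma\in\mathbf{W}^\omega(E)\cdot\sigma_0$) if and only if $\sigma_{\mathcal{G}}=\sigma$. (c) The orbit $\mathbf{B}\mathcal{F}_\sigma$ ($\sigma\in\mathbf{W}^\omega(E)\cdot\sigma_0$) is a locally closed ind-subvariety of $\mathbf{Fl}(\mathcal{F},\omega,E)$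 isomorphic to the affine space $\mathbb{A}^{n^\omega_{\mathrm{inv}}(\sigma)}$ (possibly infinite-dimensional). (d) For $\sigma,\tau\in\mathbf{W}^\omega(E)\cdot\sigma_0$, the inclusion $\mathbf{B}\mathcal{F}_\sigma\subset\overline{\mathbf{B}\mathcal{F}_\tau}$ holds if and only if $\sigma\leq_\omega\tau$.
   Context: $\mathbb{K}$ is an algebraically closed field of characteristic zero; $V$ is a $\mathbb{K}$-vector space of countably infinite dimension endowed with a nondegenerate symmetric or skew-symmetric bilinear form $\omega$. $E$ is an $\omega$-isotropic basis of $V$: it has an involution $i_E:E\to E$ with at most one fixed point such that $\omega(e,e')=0$ unless $e'=i_E(e)$. $E=\bigcup_{n\ge1}E_n$ is a filtration by $i_E$-stable finite subsets $E_n\subset E_{n+1}$. Standing convention: if $\omega$ is symmetric, $i_E$ has exactly one fixed point and every $i_E$-stable finite subset of $E$ considered (in particular each $E_n$) contains it (if $\omega$ is skew-symmetric, $i_E$ has no fixed point). $\langle\cdot\rangle$ denotes linear span, $U^\perp$ the $\omega$-orthogonal of $U$. Ind-varieties: an ind-variety is a union $\mathbf{X}=\bigcup_{n\ge1}X_n$ of a chain of inclusions of algebraic varieties; a subset is open (closed) if its intersection with every $X_n$ is open (closed); a morphism is a map that restricts, for each $n$, to a morphism of varieties from $X_n$ into some member of the exhaustion of the target. Locally closed subsets inherit an ind-variety structure (ind-subvarieties). $\mathbb{A}^\infty=\bigcup_n\mathbb{A}^n$ (affine subspaces). Groups: $\mathbf{G}^\omega(E)$ is the group of linear automorphisms $g$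 of $V$ preserving $\omega$ with $g(e)=e$ for all but finitely many $e\in E$; it is the ind-group $\bigcup_nG^\omega(E_n)$, where $G^\omega(E_n)$ is the subgroup of $GL(\langle E_n\rangle)$ preserving the restriction of $\omega$ (acting trivially on $E\setminus E_n$). $\mathbf{H}^\omega(E)$ is the subgroup of elements diagonal in $E$. A splitting Borel subgroup containing $\mathbf{H}^\omega(E)$ is a closed ind-subgroup containing $\mathbf{H}^\omega(E)$ which is locally solvable (all its algebraic subgroups are solvable) and maximal with this property. A splitting parabolic subgroup is a closed ind-subgroup containing such a splitting Borel subgroup. Generalized flags: a generalized flag is a set $\mathcal{F}$ of subspaces of $V$, totally ordered by inclusion, such that (i) every $F\in\mathcal{F}$ has an immediate predecessor or an immediate successor in $\mathcal{F}$; (ii) for every nonzero $v\in V$ there is a pair $(F',F'')$ of consecutive elements of $\mathcal{F}$ with $v\in F''\setminus F'$. For a totally ordered set $(A,\preceq_A)$, $\mathbf{Fl}_A(V)$ is the set of generalized flags whose set of pairs of consecutive elements (ordered by inclusion) is isomorphic to $A$; such $\mathcal{F}$ is written $\{F'_\alpha,F''_\alpha:\alpha\in A\}$ with $(F'_\alpha,F''_\alpha)$ the consecutive pairs. $\mathcal{F}$ is $\omega$-isotropic if $F^\perp\in\mathcal{F}$ for all $F\in\mathcal{F}$ and $F\mapsto F^\perp$ is an involution of $\mathcal{F}$. If $A$ carries an involutive anti-automorphism $i_A$ (order reversing), $\mathbf{Fl}_A^\omega(V)$ is the set of $\omega$-isotropic $\mathcal{F}\in\mathbf{Fl}_A(V)$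 with $((F''_\alpha)^\perp,(F'_\alpha)^\perp)=(F'_{i_A(\alpha)},F''_{i_A(\alpha)})$ for all $\alpha\in A$. $\mathfrak{S}^\omega(E,A)$ is the set of surjective maps $\sigma:E\to A$ with $\sigma\circ i_E=i_A\circ\sigma$. For a surjection $\sigma:E\to A$, $\mathcal{F}_\sigma=\{F'_{\sigma,\alpha},F''_{\sigma,\alpha}:\alpha\in A\}$ with $F'_{\sigma,\alpha}=\langle e\in E:\sigma(e)\prec_A\alpha\rangle$, $F''_{\sigma,\alpha}=\langle e\in E:\sigma(e)\preceq_A\alpha\rangle$. The elements of $\mathbf{Fl}^\omega_A(V)$ compatible with $E$ are exactly the $\mathcal{F}_\sigma$, $\sigma\in\mathfrak{S}^\omega(E,A)$ (compatibility with a basis $L$ is defined likewise by a surjection $L\to A$). The map sending an $E$-compatible $\omega$-isotropic generalized flag $\mathcal{F}$ to its stabilizer $\mathbf{P}^\omega_{\mathcal{F}}$ in $\mathbf{G}^\omega(E)$ is a known bijection onto the splitting parabolic subgroups containing $\mathbf{H}^\omega(E)$; $\mathbf{P}^\omega_{\mathcal{F}}$ is a splitting Borel subgroup iff $\mathcal{F}$ is maximal ($\dim F''/F'=1$ for all consecutive $F'\subset F''$). $\mathbf{Fl}(\mathcal{F},\omega,E)$: a generalized flag is weakly compatible with $E$ if it is compatible with a basis $L$ such that $E\setminus(E\cap L)$ is finite. $\mathcal{F},\mathcal{G}$ are $E$-commensurable if both are weakly compatible with $E$ and there are an isomorphism of ordered sets $\phi:\mathcal{F}\to\mathcal{G}$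 and a finite-dimensional subspace $U\subset V$ with $\phi(F)+U=F+U$ and $\dim\phi(F)\cap U=\dim F\cap U$ for all $F\in\mathcal{F}$. $\mathbf{Fl}(\mathcal{F},\omega,E)$ is the set of $\omega$-isotropic generalized flags $E$-commensurable with $\mathcal{F}$. For $i_E$-stable finite $I\subset E$, $\mathrm{Fl}(\mathcal{F},\omega,I)$ is the projective variety of flags $\{M'_\alpha\subset M''_\alpha:\alpha\in A\}$ in $\langle I\rangle$ with $M''_\alpha\subset M'_\beta$ for $\alpha\prec_A\beta$, $\dim M'_\alpha=\dim F'_\alpha\cap\langle I\rangle$, $\dim M''_\alpha=\dim F''_\alpha\cap\langle I\rangle$, and $((M''_\alpha)^{\perp_I},(M'_\alpha)^{\perp_I})=(M'_{i_A(\alpha)},M''_{i_A(\alpha)})$ (orthogonals in $\langle I\rangle$); it is embedded in $\mathbf{Fl}(\mathcal{F},\omega,E)$ by adding $\langle e\in E\setminus I:\sigma_0(e)\prec_A\alpha\rangle$ to $M'_\alpha$ and $\langle e\in E\setminus I:\sigma_0(e)\preceq_A\alpha\rangle$ to $M''_\alpha$. Then $\mathbf{Fl}(\mathcal{F},\omega,E)=\bigcup_n\mathrm{Fl}(\mathcal{F},\omega,E_n)$, which defines its ind-variety structure, and $g\mapsto g\mathcal{F}$ induces an isomorphism $\mathbf{G}^\omega(E)/\mathbf{P}^\omega_{\mathcal{F}}\cong\mathbf{Fl}(\mathcal{F},\omega,E)$. Weyl group: $\mathbf{W}^\omega(E)$ is the group of permutations $w$ of $E$ fixing all but finitely many elements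 and commuting with $i_E$; $\mathbf{W}^\omega(E)\cdot\sigma_0=\{\sigma_0\circ w^{-1}:w\in\mathbf{W}^\omega(E)\}$; $\mathbf{W}^\omega_{\mathbf{P}}(E)=\{w\in\mathbf{W}^\omega(E):\sigma_0\circ w^{-1}=\sigma_0\}$. Borel data: $\mathbf{B}=\mathbf{P}^\omega_{\mathcal{F}_0}$ for a unique maximal $\omega$-isotropic $E$-compatible $\mathcal{F}_0=\{F'_{0,e},F''_{0,e}:e\in E\}$, $F'_{0,e}=\langle e'\in E:e'\prec_{\mathbf{B}}e\rangle$, $F''_{0,e}=\langle e'\in E:e'\preceq_{\mathbf{B}}e\rangle$, where $\preceq_{\mathbf{B}}$ is a total order on $E$ for which $i_E$ is an anti-automorphism. Inversions: for $\sigma\in\mathfrak{S}^\omega(E,A)$, an $\omega$-isotropic inversion of $\sigma$ is a pair $(e,e')\in E\times E$ with $e\prec_{\mathbf{B}}e'$, $e\prec_{\mathbf{B}}i_E(e)$, $e'\neq i_E(e')$ and $\sigma(e)\succ_A\sigma(e')$; $n^\omega_{\mathrm{inv}}(\sigma)$ is the number (possibly infinite) of $\omega$-isotropic inversions of $\sigma$. Order on $\mathfrak{S}^\omega(E,A)$: $t_{e,e'}$ is the transposition of $e$ and $e'$; for $e\neq e'$, $i_E(e)\neq e$, $i_E(e')\neq e'$, put $t^\omega_{e,e'}=t_{e,e'}\circ t_{i_E(e),i_E(e')}$ if $e'\neq i_E(e)$ and $t^\omega_{e,e'}=t_{e,e'}$ if $e'=i_E(e)$. Write $\sigma\,\hat{<}_\omega\tau$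 if $\tau=\sigma\circ t^\omega_{e,e'}$ for some such $(e,e')$ with $e\prec_{\mathbf{B}}e'$ and $\sigma(e)\prec_A\sigma(e')$; write $\sigma<_\omega\tau$ if there is a chain $\sigma=\tau_0\,\hat{<}_\omega\tau_1\,\hat{<}_\omega\cdots\hat{<}_\omega\tau_k=\tau$ with $k\ge1$; $\sigma\leq_\omega\tau$ means $\sigma<_\omega\tau$ or $\sigma=\tau$. Relative position: for $\mathcal{G}=\{G'_\alpha,G''_\alpha:\alpha\in A\}$ weakly compatible with $E$, $\sigma_{\mathcal{G}}(e)=\min\{\alpha\in A:G''_\alpha\cap F''_{0,e}\neq G''_\alpha\cap F'_{0,e}\}$ for $e\in E$.
   Formalization: In (c), inversions (e,e') must also satisfy e ⪯_B i_E(e'), counting dual pairs (e,e'), (i_E(e'),i_E(e)) once; as printed (c) fails: for E=Z\{0}, i_E(e)=-e, skew form, σ_0=id, w=-1 on {±1,±2}, the count is 5 but the cell is A^4. *)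

(* Defs.v *)
(* Mathematical Components, with classical_sets and multinomials. *)
From HB Require Import structures.
From mathcomp Require Export all_boot all_order all_algebra finmap.
From mathcomp Require Export mathcomp_extra boolp classical_sets functions.
From mathcomp Require Export cardinality mpoly.
From Stdlib Require Export Relation_Operators.

Set Implicit Arguments.
Unset Strict Implicit.
Unset Printing Implicit Defensive.

Export Order.TTheory GRing.Theory.
#[export] Set Implicit Arguments.
#[export] Unset Strict Implicit.

Local Open Scope classical_set_scope.
Local Open Scope ring_scope.

Section IndVarieties.
Variable K : fieldType.

(* The variables range over an arbitrary type, but each polynomial function
   involves only finitely many of them. *)
Definition polyfun (X : Type) : set ((X -> K) -> K) :=
  [set f | exists n (p : {mpoly K[n]}) (x : 'I_n -> X),
    f = fun v => p.@[v \o x]].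

(* An ind-variety given by coordinates on each member of its exhaustion:
   [coords n t] is the set of all coordinate systems of the point t as a point
   of the n-th variety X_n; it is empty when t is not in X_n.  Coordinates
   need not be unique (compare homogeneous coordinates on a projective space):
   the variety X_n carries the quotient of the structure of the (quasi-affine)
   set of all coordinate systems of its points. *)
Record indvar (T : Type) := IndVar {
  indet : Type;
  coords : nat -> T -> set (indet -> K) }.

Arguments coords {T} _ _ _ _.

Section Theory.
Variables (T : Type) (X : indvar T).

Definition piece (n : nat) : set T := [set t | coords X n t !=set0].

Definition support : set T := \bigcup_n piece n.

(* C meets X_n in a Zariski closed subset of X_n *)
Definition pclosed (n : nat) (C : set T) : Prop :=
  exists2 S : set ((indet X -> K) -> K), S `<=` @polyfun (indet X) &
    forall t x, coords X n t x -> (C t <-> forall p, S p -> p x = 0).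

(* f is a regular function on the subset U of X_n: locally, it is a quotient
   of two polynomials in the coordinates. *)
Definition pregular (n : nat) (U : set T) (f : T -> K) : Prop :=
  forall t x, U t -> coords X n t x ->
    exists p q, [/\ @polyfun (indet X) p, @polyfun (indet X) q, q x != 0 &
      forall u y, U u -> coords X n u y -> q y != 0 -> f u = p y / q y].

Definition ind_closed (C : set T) : Prop := forall n, pclosed n C.

Definition ind_open (U : set T) : Prop := ind_closed (~` U).

Definition ind_locally_closed (Z : set T) : Prop :=
  exists U C, [/\ ind_open U, ind_closed C & Z = U `&` C].

Definition ind_closure (Z : set T) : set T := smallest ind_closed Z.

(* the ind-variety structure induced on a (locally closed) subset *)
Definition ind_sub (Z : set T) : indvar T :=
  @IndVar T (indet X) (fun n t => [set x | Z t /\ coords X n t x]).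

End Theory.

Definition ind_morphism (T1 T2 : Type) (X : indvar T1) (Y : indvar T2)
    (phi : T1 -> T2) : Prop :=
  forall n, exists m,
    [/\ forall t, piece X n t -> piece Y m (phi t),
        forall C, pclosed Y m C -> pclosed X n (phi @^-1` C) &
        forall U f, pclosed Y m (~` U) -> pregular Y m U f ->
          pregular X n (phi @^-1` U) (f \o phi)].

Definition ind_isomorphic (T1 T2 : Type) (X : indvar T1) (Y : indvar T2) :
    Prop :=
  exists phi psi, [/\ ind_morphism X Y phi, ind_morphism Y X psi,
    forall t, support X t -> psi (phi t) = t &
    forall t, support Y t -> phi (psi t) = t].

(* The affine space of dimension N, where None stands for infinity; the n-th
   member of the exhaustion is the affine space of dimension min(n, N). *)
Definition affine_space (N : option nat) : indvar (nat -> K) :=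
  @IndVar (nat -> K) nat (fun n v => [set x | x = v /\ forall i,
    ~~ ((i < n)%N && (if N is Some m then (i < m)%N else true)) -> v i = 0]).

End IndVarieties.

Section Subspaces.
Variables (K : fieldType) (V : lmodType K).
Implicit Types U W : set V.

Definition subspace U : Prop :=
  U 0 /\ forall (a : K) u v, U u -> U v -> U (a *: u + v).

Definition span (S : set V) : set V := smallest subspace S.

Definition addsp U W : set V := [set u + w | u in U & w in W].

Definition basis_of (J : choiceType) (U : set V) (l : J -> V) : Prop :=
  span (range l) = U /\
  forall (s : {fset J}) (c : J -> K),
    \sum_(j <- s) c j *: l j = 0 -> forall j, j \in s -> c j = 0.

Definition has_dim U (k : nat) : Prop := exists l : 'I_k -> V, basis_of U l.

(* U and W are finite dimensional, of the same dimension. *)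
Definition same_dim U W : Prop := exists2 k, has_dim U k & has_dim W k.

Definition perp (omega : V -> V -> K) U : set V :=
  [set v | forall u, U u -> omega u v = 0].

End Subspaces.

Section Flags.
Variables (K : fieldType) (V : lmodType K).
Implicit Types FF GG : set (set V).

Definition consecutive FF (F1 F2 : set V) : Prop :=
  [/\ FF F1, FF F2, F1 `<` F2 &
      forall G, FF G -> F1 `<=` G -> G `<=` F2 -> G = F1 \/ G = F2].

Definition generalized_flag FF : Prop :=
  [/\ forall F, FF F -> subspace F,
      forall F G, FF F -> FF G -> F `<=` G \/ G `<=` F,
      forall F, FF F -> exists G, consecutive FF F G \/ consecutive FF G F &
      forall v, v != 0 ->
        exists F1 F2, consecutive FF F1 F2 /\ (F2 `\` F1) v].

Definition isotropic_flag (omega : V -> V -> K) FF : Prop :=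
  forall F, FF F -> FF (perp omega F) /\ perp omega (perp omega F) = F.

Definition flag_of (A : Type) (lo hi : A -> set V) : set (set V) :=
  range lo `|` range hi.

Definition coord_space (J : Type) (l : J -> V) (P : set J) : set V :=
  span (l @` P).

Section CoordinateFlag.
Variables (J : Type) (l : J -> V) (d : Order.disp_t) (A : orderType d).
Variable sigma : J -> A.

Definition flag_lo (a : A) : set V :=
  coord_space l [set j | (sigma j < a)%O].

Definition flag_hi (a : A) : set V :=
  coord_space l [set j | (sigma j <= a)%O].

Definition coord_flag : set (set V) := flag_of flag_lo flag_hi.
End CoordinateFlag.

Definition compatible (J : Type) (l : J -> V) FF : Prop :=
  exists (d : Order.disp_t) (A : orderType d) (sigma : J -> A),
    (forall a, exists j, sigma j = a) /\ FF = coord_flag l sigma.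

Section Commensurability.
Variables (E : choiceType) (b : E -> V).

Definition weakly_compatible FF : Prop :=
  exists (J : choiceType) (l : J -> V),
    [/\ basis_of setT l, finite_set [set e | ~ range l (b e)] &
        compatible l FF].

Definition commensurable_via (phi : set V -> set V) FF GG : Prop :=
  [/\ set_bij FF GG phi,
      forall F G, FF F -> FF G -> (F `<=` G <-> phi F `<=` phi G) &
      exists U, (exists k, has_dim U k) /\
        forall F, FF F -> addsp (phi F) U = addsp F U /\
                          same_dim (phi F `&` U) (F `&` U)].

Definition commensurable FF GG : Prop :=
  [/\ weakly_compatible FF, weakly_compatible GG &
      exists phi, commensurable_via phi FF GG].

Definition Fl (omega : V -> V -> K) FF : set (set (set V)) :=
  [set GG | [/\ generalized_flag GG, isotropic_flag omega GG &
                commensurable FF GG]].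
End Commensurability.

End Flags.

Section FlagIndVariety.
Variables (K : fieldType) (V : lmodType K) (omega : V -> V -> K).
Variables (E : choiceType) (b : E -> V).
Variables (d : Order.disp_t) (A : orderType d) (iA : A -> A) (sigma0 : E -> A).

Definition fspan (I : {fset E}) : set V := coord_space b [set` I].

(* The pair (lo, hi) is the family of pairs of subspaces of <I> denoted by
   (M'_a, M''_a), a \in A, in the definition of Fl(F, omega, I). *)
Definition Flfin (I : {fset E}) (lo hi : A -> set V) : Prop :=
  [/\ forall a, [/\ subspace (lo a), subspace (hi a),
                    lo a `<=` hi a & hi a `<=` fspan I],
      forall a c, (a < c)%O -> hi a `<=` lo c,
      forall a, same_dim (lo a) (flag_lo b sigma0 a `&` fspan I) /\
                same_dim (hi a) (flag_hi b sigma0 a `&` fspan I) &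
      forall a, perp omega (hi a) `&` fspan I = lo (iA a) /\
                perp omega (lo a) `&` fspan I = hi (iA a)].

Definition Flfin_embed (I : {fset E}) (lo hi : A -> set V) : set (set V) :=
  flag_of
    (fun a => addsp (lo a)
       (coord_space b [set e | e \notin I /\ (sigma0 e < a)%O]))
    (fun a => addsp (hi a)
       (coord_space b [set e | e \notin I /\ (sigma0 e <= a)%O])).

(* The coefficients of the first k vectors with coordinates x form a k x #|I|
   matrix whose rows are a basis of U; k is then the dimension of U. *)
Definition frame (I : {fset E}) (x : nat * E -> K) (U : set V) : Prop :=
  exists k : nat,
    basis_of U (fun j : 'I_k => \sum_(e <- I) x (val j, e) *: b e).

(* Fl(F, omega, I) is seen as a closed subvariety of a product of
   Grassmannians of <I>, the coordinates of a k-dimensional subspace being the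
   entries of any k x #|I| matrix whose rows are a basis of it.  Since the
   Grassmannian is the geometric quotient, locally trivial, of the full-rank
   matrices by GL_k, this gives the same closed sets and regular functions as
   the Pluecker coordinates (the maximal minors).  The boolean distinguishes
   M'_a (false) from M''_a (true). *)
Definition Fl_ind (En : nat -> {fset E}) : indvar K (set (set V)) :=
  @IndVar K (set (set V)) (A * bool * (nat * E))%type (fun n GG =>
    [set x | exists lo hi, [/\ Flfin (En n) lo hi,
       GG = Flfin_embed (En n) lo hi &
       forall a, frame (En n) (fun je => x (a, false, je)) (lo a) /\
                 frame (En n) (fun je => x (a, true, je)) (hi a)]]).

End FlagIndVariety.

Definition lcoset (T : Type) (H : set (T -> T)) (g : T -> T) : set (T -> T) :=
  [set g \o h | h in H].

Section Groups.
Variables (K : fieldType) (V : lmodType K) (omega : V -> V -> K).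
Variables (E : choiceType) (b : E -> V) (En : nat -> {fset E}).

Definition is_group (H : set (V -> V)) : Prop :=
  [/\ H id, forall g h, H g -> H h -> H (g \o h) &
      forall g, H g -> exists h, [/\ H h, cancel g h & cancel h g]].

Definition Gom : set (V -> V) :=
  [set g | [/\ linear g, bijective g,
               forall u v, omega (g u) (g v) = omega u v &
               finite_set [set e | g (b e) <> b e]]].

Definition Gfin (I : {fset E}) : set (V -> V) :=
  [set g | [/\ Gom g, forall e, e \notin I -> g (b e) = b e &
               g @` fspan b I = fspan b I]].

(* The coordinates of an element of the n-th group are its matrix entries. *)
Definition G_ind : indvar K (V -> V) :=
  @IndVar K (V -> V) (E * E)%type (fun n g => [set x | Gfin (En n) g /\
    forall e, e \in En n -> g (b e) = \sum_(f <- En n) x (e, f) *: b f]).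

Definition Hom : set (V -> V) :=
  [set g | Gom g /\ forall e, exists c, g (b e) = c *: b e].

Definition commutators (H : set (V -> V)) : set (V -> V) :=
  [set c | exists g g' h h', [/\ H g, H h, cancel g g' /\ cancel g' g,
     cancel h h' /\ cancel h' h & c = g \o h \o g' \o h']].

Definition derived (H : set (V -> V)) : set (V -> V) :=
  smallest is_group (commutators H).

Definition solvable_group (H : set (V -> V)) : Prop :=
  exists k, iter k derived H = [set id].

Definition algebraic_subgroup (S : set (V -> V)) : Prop :=
  is_group S /\ exists n, S `<=` Gfin (En n) /\ pclosed G_ind n S.

Definition locally_solvable (H : set (V -> V)) : Prop :=
  forall S, algebraic_subgroup S -> S `<=` H -> solvable_group S.

Definition closed_subgroup (H : set (V -> V)) : Prop :=
  [/\ is_group H, H `<=` Gom & ind_closed G_ind H].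

Definition splitting_borel (B : set (V -> V)) : Prop :=
  [/\ closed_subgroup B, Hom `<=` B, locally_solvable B &
      forall B', closed_subgroup B' -> Hom `<=` B' -> locally_solvable B' ->
        B `<=` B' -> B' = B].

Definition act (g : V -> V) (FF : set (set V)) : set (set V) :=
  [set g @` F | F in FF].

Definition orbit (B : set (V -> V)) (FF : set (set V)) : set (set (set V)) :=
  [set act g FF | g in B].

Definition stab (FF : set (set V)) : set (V -> V) :=
  [set g | Gom g /\ forall F, FF F -> g @` F = F].

End Groups.

Section Combinatorics.
Variables (E : choiceType) (iE : E -> E).

Definition weyl : set (E -> E) :=
  [set w | [/\ bijective w, finite_set [set e | w e <> e] &
               forall e, w (iE e) = iE (w e)]].

(* the inverse of a bijection w *)
Definition winv (w : E -> E) (e : E) : E := xget e [set f | w f = e].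

Variable leB : rel E.

Definition ltB : rel E := fun e f => (e != f) && leB e f.

Variables (d : Order.disp_t) (A : orderType d).
Implicit Types sigma tau : E -> A.

Definition weyl_orbit sigma : set (E -> A) :=
  [set sigma \o winv w | w in weyl].

Definition weyl_stab sigma : set (E -> E) :=
  [set w | weyl w /\ sigma \o winv w = sigma].

(* The pairs (e, f) and (iE f, iE e) are inverted simultaneously and correspond
   to the same root of the group, so they form one and the same isotropic
   inversion; the condition e <= iE f, i.e. f <= iE e, selects exactly one of
   them.  Under the sole conditions e < f, e < iE e and f <> iE f, if e and f
   are distinct and precede their images by iE, then both (e, iE f) and
   (f, iE e) would be counted: on the 3-dimensional projective space, the open
   orbit of a Borel subgroup of Sp_4 would be assigned 4 inversions. *)
Definition isotropic_inversions sigma : set (E * E) :=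
  [set p | [/\ ltB p.1 p.2, ltB p.1 (iE p.1), p.2 <> iE p.2,
               (sigma p.2 < sigma p.1)%O & leB p.1 (iE p.2)]].

(* None stands for infinity. *)
Definition ninv sigma : option nat :=
  if `[< finite_set (isotropic_inversions sigma) >]
  then Some #|` fset_set (isotropic_inversions sigma)| else None.

Definition transp (e f : E) : E -> E :=
  fun x => if x == e then f else if x == f then e else x.

Definition transp_om (e f : E) : E -> E :=
  if f == iE e then transp e f else transp e f \o transp (iE e) (iE f).

Definition lt_om_step sigma tau : Prop :=
  exists e f, [/\ e <> f, iE e <> e /\ iE f <> f, ltB e f,
    (sigma e < sigma f)%O & tau = sigma \o transp_om e f].

Definition lt_om : (E -> A) -> (E -> A) -> Prop := clos_trans _ lt_om_step.

Definition le_om sigma tau : Prop := lt_om sigma tau \/ sigma = tau.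

Variables (K : fieldType) (V : lmodType K) (b : E -> V).

Definition borel_lo (e : E) : set V := coord_space b [set f | ltB f e].

Definition borel_hi (e : E) : set V := coord_space b [set f | leB f e].

Definition borel_flag : set (set V) := flag_of borel_lo borel_hi.

(* s is the map sigma_G attached to the generalized flag whose pairs of
   consecutive elements are (G'_a, G''_a), a \in A, with G''_a = hi a. *)
Definition relative_position (hi : A -> set V) (s : E -> A) : Prop :=
  forall e,
    hi (s e) `&` borel_hi e <> hi (s e) `&` borel_lo e /\
    forall a, hi a `&` borel_hi e <> hi a `&` borel_lo e -> (s e <= a)%O.

End Combinatorics.

(* Main.v *)
(* Inside some <E_n>, an isotropic flag G has an adapted basis (l e) in which
   l e is b e plus a combination of the b j, j < e, with s j > s e, s being the
   relative position of G and the Borel flag.  This reduced family is unique,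
   and automatically an isometry, so G lies in the B-orbit of F_s; conversely B
   preserves relative positions.  This gives (a) and (b), the Weyl group acting
   transitively on the maps of the type of sigma0.
   The orbit of s is cut out of its closure by the nonvanishing of the minors of
   the spaces G''_a on the columns {s <= a}, and the Cayley transform
   (1 + x) / (1 - x) identifies the reduced isometries with the nilpotent
   antisymmetric matrices supported by the inversions of s, which form an affine
   space.  It is polynomial in x, as x is strictly triangular.
   For (d), the closure of the orbit of t is contained in the set of flags
   satisfying rank conditions, which bound #{t <= a} in every lower set D of E by
   #{s <= a} in D.  This dominance order is generated by the reflections
   t_{e,f}, and for each of these a one-parameter group of transvections
   degenerates to the flag of s. *)
From HB Require Import structures.
Require Import Defs.
From mathcomp Require Import zify.

Local Open Scope classical_set_scope.
Local Open Scope ring_scope.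

(** * Polynomial and regular functions *)

(** Members of the flags are usually infinite dimensional, and so are their complements, so
    dimensions cannot be compared directly. The predicate [std] splits such a space into a
    coordinate part outside some E_n and a trace on <E_n> of known dimension; an inclusion between
    two spaces of the same type is then an equality. The orders on E and A may be dense: minima and
    inductions are available only inside the finite sets E_n. A point has many coordinate systems. A
    function on an orbit is shown to be regular by Cramer's rule applied to an arbitrary frame, the
    reduced basis being independent of the frame. Being an isometry is a quadratic condition on this
    basis; the Cayley transform makes it linear, and triangularity turns both directions into finite
    recursions. For (d) the closure is not computed: rank conditions bound it from above,
    degenerations from below, and the two bounds agree by combinatorics. The delicate case is a
    symmetric form, where the antisymmetric entry linking e and iE e vanishes: their exchange has to
    pass through the vector b o of the fixed point o of iE, in the degenerations as in the count of
    inversions. *)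

Section PolynomialFunctions.
Variables (K : fieldType) (X : Type).
Implicit Types f g : (X -> K) -> K.

Lemma polyfun_cst (c : K) : @polyfun K X (fun=> c).
Proof.
exists 0%N, c%:MP, (fun i : 'I_0 => match notF (ltn_ord i) with end).
by apply/funext => v; rewrite mevalC.
Qed.

Lemma polyfun_var (x : X) : polyfun (fun v : X -> K => v x).
Proof.
exists 1%N, 'X_ord0, (fun=> x).
by apply/funext => v; rewrite mevalXU.
Qed.

(** The two polynomials may involve different variables, so both are first moved into a ring in n +
    m variables. *)
Lemma polyfun_op (op : forall n, {mpoly K[n]} -> {mpoly K[n]} -> {mpoly K[n]})
    (opK : K -> K -> K) f g :
  (forall n (p q : {mpoly K[n]}) v, (op n p q).@[v] = opK p.@[v] q.@[v]) ->
  polyfun f -> polyfun g -> polyfun (fun v => opK (f v) (g v)).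
Proof.
move=> opE [n [p [x ->]]] [m [q [y ->]]].
pose z (i : 'I_(n + m)) := match fintype.split i with inl j => x j | inr j => y j end.
pose P := p \mPo [tuple 'X_(lshift m i) | i < n].
pose Q := q \mPo [tuple 'X_(rshift n i) | i < m].
exists (n + m)%N, (op _ P Q), z.
apply/funext => v; rewrite opE !comp_mpoly_meval.
congr (opK _ _); apply: meval_eq => i; rewrite tnth_mktuple mevalXU /= /z.
  by rewrite (unsplitK (inl i)).
by rewrite (unsplitK (inr i)).
Qed.

Lemma polyfunD f g : polyfun f -> polyfun g -> polyfun (fun v => f v + g v).
Proof. by apply: (@polyfun_op (fun n p q => p + q)) => *; rewrite mevalD. Qed.

Lemma polyfunM f g : polyfun f -> polyfun g -> polyfun (fun v => f v * g v).
Proof. by apply: (@polyfun_op (fun n p q => p * q)) => *; rewrite mevalM. Qed.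

Lemma polyfun_sum (I : Type) (r : seq I) (P : pred I)
    (F : I -> (X -> K) -> K) :
  (forall i, polyfun (F i)) -> polyfun (fun v => \sum_(i <- r | P i) F i v).
Proof.
move=> pF; elim: r => [|i r IHr].
  by under eq_fun do rewrite big_nil; exact: polyfun_cst.
under eq_fun do rewrite big_cons; case: (P i) => //.
exact: polyfunD.
Qed.

Lemma polyfun_prod (I : Type) (r : seq I) (P : pred I)
    (F : I -> (X -> K) -> K) :
  (forall i, polyfun (F i)) -> polyfun (fun v => \prod_(i <- r | P i) F i v).
Proof.
move=> pF; elim: r => [|i r IHr].
  by under eq_fun do rewrite big_nil; exact: polyfun_cst.
under eq_fun do rewrite big_cons; case: (P i) => //.
exact: polyfunM.
Qed.

Lemma polyfun_det n (F : 'I_n -> 'I_n -> (X -> K) -> K) :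
  (forall i j, polyfun (F i j)) ->
  polyfun (fun v => \det (\matrix_(i, j) F i j v)).
Proof.
move=> pF; apply: polyfun_sum => s; apply: polyfunM; first exact: polyfun_cst.
apply: polyfun_prod => i; under eq_fun do rewrite mxE; exact: pF.
Qed.

Variable Z : set (X -> K).

(** Unlike the local quotients in [pregular], a single fraction has to serve on all of [Z]. All the
    maps built below have such a global expression, and it makes composition a mere substitution. *)
Definition ratfun f := exists p q, [/\ polyfun p, polyfun q &
  forall v, Z v -> q v != 0 /\ f v = p v / q v].

Lemma ratfun_poly f : polyfun f -> ratfun f.
Proof.
move=> pf; exists f, (fun=> 1); split=> // [|v _]; first exact: polyfun_cst.
by rewrite oner_neq0 divr1.
Qed.

Lemma ratfun_cst (c : K) : ratfun (fun=> c).
Proof. exact/ratfun_poly/polyfun_cst. Qed.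

Lemma ratfun_var (x : X) : ratfun (fun v => v x).
Proof. exact/ratfun_poly/polyfun_var. Qed.

Lemma eq_ratfun f g : (forall v, Z v -> f v = g v) -> ratfun f -> ratfun g.
Proof.
move=> fg [p [q [pp pq fE]]]; exists p, q; split=> // v Zv.
by have [? fvE] := fE v Zv; rewrite -fg.
Qed.

Lemma ratfunD f g : ratfun f -> ratfun g -> ratfun (fun v => f v + g v).
Proof.
move=> [p [q [pp pq fE]]] [p' [q' [pp' pq' gE]]].
exists (fun v => p v * q' v + p' v * q v), (fun v => q v * q' v).
split=> [||v Zv]; [by apply: polyfunD; exact: polyfunM|exact: polyfunM|].
have [[q0 ->] [q'0 ->]] := (fE v Zv, gE v Zv).
by rewrite mulf_neq0 // addf_div.
Qed.

Lemma ratfunM f g : ratfun f -> ratfun g -> ratfun (fun v => f v * g v).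
Proof.
move=> [p [q [pp pq fE]]] [p' [q' [pp' pq' gE]]].
exists (fun v => p v * p' v), (fun v => q v * q' v).
split=> [||v Zv]; [exact: polyfunM|exact: polyfunM|].
have [[q0 ->] [q'0 ->]] := (fE v Zv, gE v Zv).
by rewrite mulf_neq0 // mulf_div.
Qed.

Lemma ratfun_sum (I : Type) (r : seq I) (P : pred I)
    (F : I -> (X -> K) -> K) :
  (forall i, ratfun (F i)) -> ratfun (fun v => \sum_(i <- r | P i) F i v).
Proof.
move=> pF; elim: r => [|i r IHr].
  by under eq_fun do rewrite big_nil; exact: ratfun_cst.
under eq_fun do rewrite big_cons; case: (P i) => //.
exact: ratfunD.
Qed.

Lemma ratfun_prod (I : Type) (r : seq I) (P : pred I)
    (F : I -> (X -> K) -> K) :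
  (forall i, ratfun (F i)) -> ratfun (fun v => \prod_(i <- r | P i) F i v).
Proof.
move=> pF; elim: r => [|i r IHr].
  by under eq_fun do rewrite big_nil; exact: ratfun_cst.
under eq_fun do rewrite big_cons; case: (P i) => //.
exact: ratfunM.
Qed.

Lemma ratfun_exp f n : ratfun f -> ratfun (fun v => f v ^+ n).
Proof.
move=> rf; elim: n => [|n IHn].
  by under eq_fun do rewrite expr0; exact: ratfun_cst.
by under eq_fun do rewrite exprS; exact: ratfunM.
Qed.

Lemma ratfun_det n (F : 'I_n -> 'I_n -> (X -> K) -> K) :
  (forall i j, ratfun (F i j)) ->
  ratfun (fun v => \det (\matrix_(i, j) F i j v)).
Proof.
move=> pF; apply: ratfun_sum => s; apply: ratfunM; first exact: ratfun_cst.
apply: ratfun_prod => i; under eq_fun do rewrite mxE; exact: pF.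
Qed.

Lemma ratfunV f : (forall v, Z v -> f v != 0) -> ratfun f ->
  ratfun (fun v => (f v)^-1).
Proof.
move=> f0 [p [q [pp pq fE]]].
exists q, p; split=> // v Zv; have [q0 fvE] := fE v Zv.
have := f0 v Zv; rewrite fvE invf_div mulf_eq0 => /norP[-> _].
by [].
Qed.

Lemma ratfun_invmx n (F : 'I_n -> 'I_n -> (X -> K) -> K) i j :
  (forall i j, ratfun (F i j)) ->
  (forall v, Z v -> \matrix_(i, j) F i j v \in unitmx) ->
  ratfun (fun v => invmx (\matrix_(i, j) F i j v) i j).
Proof.
case: n i j F => [[]//|n] i j F rF unitF.
pose M v := \matrix_(i, j) F i j v.
have E v : Z v -> (\det (M v))^-1 * ((-1) ^+ (j + i) *
   \det (\matrix_(k, l) F (lift j k) (lift i l) v)) = invmx (M v) i j.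
  move=> /unitF uF; rewrite /invmx uF !mxE /cofactor; congr (_ * (_ * \det _)).
  by apply/matrixP => k l; rewrite !mxE.
apply: eq_ratfun E _; apply: ratfunM.
  apply: ratfunV; last exact: ratfun_det.
  by move=> v /unitF; rewrite unitmxE unitfE.
by apply: ratfunM; [exact: ratfun_cst|exact: ratfun_det].
Qed.

Lemma ratfun_comp (Y : Type) (p : (Y -> K) -> K) (g : (X -> K) -> Y -> K) :
  (forall y, ratfun (fun v => g v y)) -> polyfun p -> ratfun (fun v => p (g v)).
Proof.
move=> rg [n [q [y ->]]]; under eq_fun do rewrite mevalE.
apply: ratfun_sum => m; apply: ratfunM; first exact: ratfun_cst.
by apply: ratfun_prod => i; apply: ratfun_exp; exact: rg.
Qed.

End PolynomialFunctions.

(** * Criteria for morphisms of ind-varieties *)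

Section Morphisms.
Variables (K : fieldType) (T1 T2 : Type) (X : indvar K T1) (Y : indvar K T2).

(** The map [phi] is lifted to coordinate systems by global fractions; substituting them in
    equations and in local quotients gives fractions again. *)
Lemma ratfun_ind_morphism (phi : T1 -> T2) :
  (forall n, exists m (g : (indet X -> K) -> indet Y -> K),
     (forall t x, @coords _ _ X n t x -> @coords _ _ Y m (phi t) (g x)) /\
     (forall y, ratfun (\bigcup_t @coords _ _ X n t) (fun x => g x y))) ->
  ind_morphism X Y phi.
Proof.
move=> H n; have [m [g [gP rg]]] := H n; exists m; split.
- by move=> t [x tx]; exists (g x); exact: gP.
- move=> C [S Spoly SC].
  (* The equations of the preimage are the numerators of the pulled back equations. *)
  pose S' := [set p | polyfun p /\ exists q p', [/\ S p', polyfun q &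
     forall x, (\bigcup_t @coords _ _ X n t) x -> q x != 0 /\ p' (g x) = p x / q x]].
  exists S' => [p []//|t x tx].
  rewrite /= (SC _ _ (gP _ _ tx)); split.
    move=> Sg p [_ [q [p' [Sp' _ pE]]]].
    have [|q0 E] := pE x; first by exists t.
    move: (Sg _ Sp'); rewrite E => /eqP; rewrite mulf_eq0 invr_eq0 (negPf q0).
    by rewrite orbF => /eqP.
  move=> Sx p Sp; have [p1 [q1 [pp1 pq1 E]]] := ratfun_comp rg (Spoly _ Sp).
  have [|_ ->] := E x; first by exists t.
  by rewrite Sx ?mul0r //; split=> //; exists q1, p.
- move=> U f _ regf t x Ut tx.
  have [p [q [pp pq qx fE]]] := regf _ _ Ut (gP _ _ tx).
  have [p1 [q1 [pp1 pq1 pE]]] := ratfun_comp rg pp.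
  have [p2 [q2 [pp2 pq2 qE]]] := ratfun_comp rg pq.
  exists (fun v => p1 v * q2 v), (fun v => q1 v * p2 v); split.
  + exact: polyfunM.
  + exact: polyfunM.
  + have [|q10 _] := pE x; first by exists t.
    have [|q20 qxE] := qE x; first by exists t.
    rewrite mulf_neq0 //; apply: contraNneq qx => p20.
    by rewrite qxE p20 mul0r.
  + move=> u y Uu uy; rewrite mulf_eq0 => /norP[_ p20].
    have [|q10 pyE] := pE y; first by exists u.
    have [|q20 qyE] := qE y; first by exists u.
    rewrite /= (fE _ _ Uu (gP _ _ uy)).
      by rewrite pyE qyE invf_div mulf_div.
    by rewrite qyE mulf_neq0 // invr_neq0.
Qed.

(** Since [F] depends on the point only, the invariance of [g] under a change of coordinate system
    is built in. *)
Definition regfun n (F : T1 -> K) := exists2 g, ratfun (\bigcup_t @coords _ _ X n t) g &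
  forall t x, @coords _ _ X n t x -> F t = g x.

(** The ambiguity of coordinates in the target is removed by a section [c], which picks one
    coordinate system of the image of each point. *)
Lemma regular_ind_morphism (phi : T1 -> T2) :
  (forall n, exists m (c : T1 -> indet Y -> K),
     (forall t, piece X n t -> @coords _ _ Y m (phi t) (c t)) /\
     (forall y, regfun n (fun t => c t y))) ->
  ind_morphism X Y phi.
Proof.
move=> H; apply: ratfun_ind_morphism => n; have [m [c [cP rc]]] := H n.
have [g gP] : exists g : indet Y -> (indet X -> K) -> K, forall y,
    ratfun (\bigcup_t @coords _ _ X n t) (g y) /\
    forall t x, @coords _ _ X n t x -> c t y = g y x.
  suff ex y : exists gy, ratfun (\bigcup_t @coords _ _ X n t) gy /\
      forall t x, @coords _ _ X n t x -> c t y = gy x.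
    by have [g gP] := choice ex; exists g.
  by have [gy ? ?] := rc y; exists gy.
exists m, (fun x y => g y x); split=> [t x tx|y]; last by case: (gP y).
have -> : (fun y => g y x) = c t.
  by apply/funext => y; have [_ gE] := gP y; rewrite (gE t x tx).
by apply: cP; exists x.
Qed.

Lemma eq_regfun n F G : (forall t, piece X n t -> F t = G t) ->
  regfun n F -> regfun n G.
Proof.
move=> FG [g rg gE]; exists g => // t x tx; rewrite -FG; last by exists x.
exact: gE.
Qed.

Lemma regfun_cst n (a : K) : regfun n (fun=> a).
Proof. by exists (fun=> a); [exact: ratfun_cst|]. Qed.

Lemma regfun_op n (op : K -> K -> K) F G :
  (forall f g, ratfun (\bigcup_t @coords _ _ X n t) f ->
    ratfun (\bigcup_t @coords _ _ X n t) g ->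
    ratfun (\bigcup_t @coords _ _ X n t) (fun x => op (f x) (g x))) ->
  regfun n F -> regfun n G -> regfun n (fun t => op (F t) (G t)).
Proof.
move=> opr [f rf fE] [g rg gE]; exists (fun x => op (f x) (g x)); first exact: opr.
by move=> t x tx; rewrite (fE t x tx) (gE t x tx).
Qed.

Lemma regfunD n F G : regfun n F -> regfun n G -> regfun n (fun t => F t + G t).
Proof. by apply: regfun_op; exact: ratfunD. Qed.

Lemma regfunM n F G : regfun n F -> regfun n G -> regfun n (fun t => F t * G t).
Proof. by apply: regfun_op; exact: ratfunM. Qed.

Lemma regfun_sum n (I : Type) (r : seq I) (P : pred I) (F : I -> T1 -> K) :
  (forall i, P i -> regfun n (F i)) ->
  regfun n (fun t => \sum_(i <- r | P i) F i t).
Proof.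
move=> rF; elim: r => [|i r IHr].
  by under eq_fun do rewrite big_nil; exact: regfun_cst.
under eq_fun do rewrite big_cons; move: (rF i); case: (P i) => // /(_ isT) rFi.
exact: regfunD.
Qed.

End Morphisms.

(** * Spans, counting and enumerations *)

Section SpanLemmas.
Variables (K : fieldType) (V W : lmodType K).
Implicit Types (U : set V) (S : set V).

Lemma subspace_sum U (I : Type) (r : seq I) (P : pred I) (F : I -> V) :
  subspace U -> (forall i, P i -> U (F i)) -> U (\sum_(i <- r | P i) F i).
Proof.
move=> [U0 Ulin] UF; elim/big_ind: _ => // u v Uu Uv.
by rewrite -[u]scale1r; exact: Ulin.
Qed.

Lemma subspaceZ U (a : K) u : subspace U -> U u -> U (a *: u).
Proof. by move=> [U0 Ulin] Uu; rewrite -[_ *: _]addr0; exact: Ulin. Qed.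

Lemma subspaceD U u v : subspace U -> U u -> U v -> U (u + v).
Proof. by move=> [U0 Ulin] Uu Uv; rewrite -[u]scale1r; exact: Ulin. Qed.

Lemma subspaceB U u v : subspace U -> U u -> U v -> U (u - v).
Proof.
by move=> sU Uu Uv; apply: subspaceD => //; rewrite -scaleN1r; exact: subspaceZ.
Qed.

Lemma subspaceI U1 U2 : subspace U1 -> subspace U2 -> subspace (U1 `&` U2).
Proof.
move=> [? l1] [? l2]; split=> // a u v [? ?] [? ?]; split; [exact: l1|exact: l2].
Qed.

Lemma span_subspace S : subspace (span S).
Proof.
split=> [X [[X0 _] _] //|a u v Su Sv X XS].
by case: (XS) => [[_ Xlin] _]; apply: Xlin; [exact: Su|exact: Sv].
Qed.

Lemma mem_span S v : S v -> span S v.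
Proof. by move=> Sv X [_]; exact. Qed.

Lemma span_min S U : subspace U -> S `<=` U -> span S `<=` U.
Proof. by move=> sU SU v; apply. Qed.

Lemma span_ind S U v : subspace U -> S `<=` U -> span S v -> U v.
Proof. by move=> sU SU; exact: span_min. Qed.

Lemma linear_apply0 (g : V -> W) : linear g -> g 0 = 0.
Proof.
by move=> lg; have := lg (-1) 0 0; rewrite scaler0 addr0 scaleN1r addNr.
Qed.

Lemma linear_applyD (g : V -> W) u v : linear g -> g (u + v) = g u + g v.
Proof. by move=> lg; rewrite -[u in LHS]scale1r lg scale1r. Qed.

Lemma linear_applyZ (g : V -> W) a u : linear g -> g (a *: u) = a *: g u.
Proof.
by move=> lg; rewrite -[_ *: u]addr0 lg linear_apply0 // addr0.
Qed.

Lemma linear_applyN (g : V -> W) u : linear g -> g (- u) = - g u.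
Proof. by move=> lg; rewrite -scaleN1r linear_applyZ // scaleN1r. Qed.

Lemma linear_applyB (g : V -> W) u v : linear g -> g (u - v) = g u - g v.
Proof. by move=> lg; rewrite linear_applyD // linear_applyN. Qed.

Lemma linear_apply_sum (g : V -> W) (I : Type) (r : seq I) (P : pred I)
    (F : I -> V) :
  linear g -> g (\sum_(i <- r | P i) F i) = \sum_(i <- r | P i) g (F i).
Proof.
move=> lg; apply: (big_morph g) => [u v|]; [exact: linear_applyD|].
exact: linear_apply0.
Qed.

End SpanLemmas.

(* A subspace of maximal dimension contained in [S] exhausts [S]. *)
Lemma vspace_of_set (K : fieldType) (vT : vectType K) (S : set vT) :
  subspace S -> exists U : {vspace vT}, forall r, r \in U <-> S r.
Proof.
move=> sS.
pose P k := `[< exists U : {vspace vT}, \dim U = k /\ forall r, r \in U -> S r >].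
have exP : exists k, P k.
  exists 0%N; apply/asboolP; exists 0%VS; rewrite dimv0; split=> // r.
  by rewrite memv0 => /eqP->; case: sS.
have bP k : P k -> (k <= \dim {: vT})%N.
  by move=> /asboolP[U [<- _]]; exact/dimvS/subvf.
case: (ex_maxnP exP bP) => k /asboolP[U [dU US]] kmax; exists U => r.
split; first exact: US.
move=> Sr; apply: contrapT => /negP rU.
suff /kmax : P (\dim (U + <[r]>)).
  rewrite leqNgt dimv_disjoint_sum ?dU ?dim_vline; last first.
    apply/eqP; rewrite -subv0; apply/subvP => x; rewrite memv_cap => /andP[xU].
    move=> /vlineP[a xE]; move: xU; rewrite xE; have [->|a0] := eqVneq a 0.
      by rewrite scale0r !mem0v.
    by rewrite rpredZeq (negPf a0) (negPf rU).
  case: eqVneq rU => [->|_ _]; first by rewrite mem0v.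
  by rewrite addn1 ltnS leqnn.
apply/asboolP; exists (U + <[r]>)%VS; split=> // x /memv_addP[u uU [w]].
move=> /vlineP[a ->] ->; apply: subspaceD => //; first exact: US.
exact: subspaceZ.
Qed.

Section Counting.
Variables (T : eqType) (s : seq T).
Implicit Types P Q : pred T.

Lemma leq_count_in P Q : {in s, forall x, P x -> Q x} -> (count P s <= count Q s)%N.
Proof.
move=> PQ; rewrite (@eq_in_count _ P (predI P Q)).
  by apply: sub_count => x /andP[].
by move=> x xs /=; case: (boolP (P x)) => //= /(PQ _ xs)->.
Qed.

Lemma ltn_count_in P Q x : {in s, forall x, P x -> Q x} ->
  x \in s -> Q x -> ~~ P x -> (count P s < count Q s)%N.
Proof.
move=> PQ xs Qx Px; have : (0 < count (predD Q P) s)%N.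
  by rewrite -has_count; apply/hasP; exists x; rewrite //= Px.
rewrite -(@ltn_add2l (count P s)) addn0 => /leq_trans; apply.
rewrite -count_predUI (@eq_in_count _ (predI P (predD Q P)) pred0).
  rewrite count_pred0 addn0; apply: leq_count_in => y ys /=.
  by case: (boolP (P y)) => //= /(PQ _ ys).
by move=> y ys /=; case: (P y).
Qed.

Lemma count_sub_eq P Q : {in s, forall x, P x -> Q x} ->
  (count Q s <= count P s)%N -> {in s, forall x, Q x -> P x}.
Proof.
move=> PQ QP x xs Qx; apply: contraT => Px.
by move: QP; rewrite leqNgt (ltn_count_in PQ xs Qx Px).
Qed.

End Counting.

Lemma seq_min (T : eqType) (r : rel T) (s : seq T) : total r -> transitive r ->
  s != [::] -> exists2 m, m \in s & forall x, x \in s -> r m x.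
Proof.
move=> rT rt; elim: s => // x [|y s] IHs _.
  exists x; rewrite ?inE // => z; rewrite inE => /eqP->.
  by have := rT x x; rewrite orbb.
have [//|m ms mP] := IHs; have [xm|mx] := orP (rT x m).
  exists x; first by rewrite inE eqxx.
  move=> z; rewrite inE => /predU1P[->|/mP]; last exact: rt.
  by have := rT x x; rewrite orbb.
exists m; first by rewrite inE ms orbT.
by move=> z; rewrite inE => /predU1P[->|/mP].
Qed.

Section FsetCombinations.
Variables (K : fieldType) (V : lmodType K) (J : choiceType).

Lemma sum_fset_widen (c : J -> K) (l : J -> V) (s t : {fset J}) :
  (s `<=` t)%fset -> (forall e, e \notin s -> c e = 0) ->
  \sum_(e <- s) c e *: l e = \sum_(e <- t) c e *: l e.
Proof.
by move=> st c0; apply: big_fset_incl => // e _ /c0->; rewrite scale0r.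
Qed.

Lemma basis_notin_span (l : J -> V) j : basis_of setT l ->
  ~ span (l @` [set k | k <> j]) (l j).
Proof.
move=> [_ indl] /(span_ind (U := [set v | exists (s : {fset J}) (c : J -> K),
  [/\ forall k, k \notin s -> c k = 0, c j = 0 & v = \sum_(k <- s) c k *: l k]])).
case=> [|_ [k /= kj <-]|s [c [c0 cj lj]]].
- split; first by exists fset0, (fun=> 0); split=> //; rewrite big_seq_fset0.
  move=> a _ _ [s [c [c0 cj ->]]] [s' [c' [c'0 c'j ->]]].
  exists (s `|` s')%fset, (fun k => a * c k + c' k); split.
  + by move=> k; rewrite inE negb_or => /andP[/c0-> /c'0->]; rewrite mulr0 addr0.
  + by rewrite cj c'j mulr0 addr0.
  + rewrite (sum_fset_widen _ (fsubsetUl s s')) //.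
    rewrite (sum_fset_widen _ (fsubsetUr s s')) // scaler_sumr -big_split /=.
    by apply: eq_bigr => k _; rewrite scalerDl scalerA.
- exists [fset k]%fset, (fun i => (i == k)%:R); split.
  + by move=> i; rewrite inE => /negPf->.
  + by rewrite eq_sym; case: eqP kj.
  + by rewrite big_seq_fset1 eqxx scale1r.
have jjs : j \in (j |` s)%fset by rewrite !inE eqxx.
have c1 h := indl (j |` s)%fset (fun k => (k == j)%:R - c k) h j jjs.
suff /c1/eqP : \sum_(k <- (j |` s)%fset) ((k == j)%:R - c k) *: l k = 0.
  by rewrite eqxx cj subr0 oner_eq0.
under eq_bigr do rewrite scalerBl; rewrite big_split /= sumrN.
rewrite -(sum_fset_widen l (fsubsetUr [fset j]%fset s) c0) -lj.
rewrite (bigD1_seq j) ?fset_uniq //= eqxx scale1r big1 ?addr0 ?subrr //.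
by move=> k /negPf->; rewrite scale0r.
Qed.

End FsetCombinations.

Lemma ltn_sum_seq (T : eqType) (r : seq T) (F G : T -> nat) z : z \in r ->
  (forall x, F x <= G x)%N -> (F z < G z)%N ->
  (\sum_(x <- r) F x < \sum_(x <- r) G x)%N.
Proof.
move=> zr FG lt_z; elim: r zr => // x r IHr; rewrite inE !big_cons.
have [<- _|_ /= /IHr] := eqVneq z x; last first.
  by move=> lt_r; rewrite -addnS leq_add.
by rewrite -addSn leq_add // leq_sum.
Qed.

Lemma count_D1 (T : eqType) (r : seq T) (P : pred T) x : uniq r -> x \in r ->
  count P r = (P x + count (fun y => P y && (y != x)) r)%N.
Proof.
by move=> ur xr; rewrite (permP (perm_to_rem xr)) /= rem_filter // count_filter.
Qed.

(** Here l1, l2 say whether the values at two places lie in a lower set of A, and d1, d2 whether the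
    places lie in a lower set of E. Exchanging the two values lowers the count by one exactly when
    the rectangle d1, not d2, l1, not l2 is met. *)
Lemma swap_rect (l1 l2 d1 d2 : bool) : (l2 -> l1) -> (d2 -> d1) ->
  ((l1 && d2) + (l2 && d1) + [&& d1, ~~ d2, l1 & ~~ l2] = (l1 && d1) + (l2 && d2))%N.
Proof.
by case: l1; case: l2; case: d1; case: d2 => // h1 h2;
  do ?[by have := h1 isT]; have := h2 isT.
Qed.

Lemma ltn_of_leq_add (k1 k2 k3 k4 : nat) : (k1 + k2 <= k3 + k4 -> k4 < k2 -> k1 < k3)%N.
Proof. lia. Qed.

Lemma addn_swap2 (x1 x2 x3 x4 r1 r2 y1 y2 y3 y4 N : nat) :
  (x1 + x2 + r1 = y1 + y2 -> x4 + x3 + r2 = y4 + y3 ->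
   x1 + x2 + x3 + x4 + N + r1 + r2 = y1 + y2 + y3 + y4 + N)%N.
Proof. lia. Qed.

Lemma set_bij_size (T : countType) (R : set T) :
  let N := if `[< finite_set R >] then Some #|` fset_set R| else None in
  exists f : T -> nat,
    set_bij R [set i | is_true (if N is Some m then (i < m)%N else true)] f.
Proof.
move=> N; rewrite /N; case: asboolP => Rf.
  have /card_set_bijP[f fb] : (R #= `I_#|` fset_set R|)%card.
    by rewrite -{1}(fset_setK Rf); exact/card_eq_fsetP.
  by exists f.
have /card_set_bijP[f fb] : (R #= [set: nat])%card.
  by apply: eq_card_nat => //; exact: countableP.
exists f; rewrite (_ : [set _ | _] = setT) //; exact/seteqP.
Qed.

(** * Coordinates in the basis E *)

Section IsotropicFlags.
Variables (K : fieldType) (V : lmodType K) (E : countType) (b : E -> V).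
Hypothesis b_basis : basis_of setT b.

Let coord_fun (v : V) : set (E -> K) := [set c | exists s : {fset E},
  v = \sum_(e <- s) c e *: b e /\ forall e, e \notin s -> c e = 0].

Definition coef (v : V) : E -> K :=
  if pselect (exists c, coord_fun v c) is left ex then projT1 (cid ex)
  else fun=> 0.

Lemma coefP v : exists s : {fset E},
  v = \sum_(e <- s) coef v e *: b e /\ forall e, e \notin s -> coef v e = 0.
Proof.
have ex u : exists c, coord_fun u c.
  have : span (range b) u by rewrite b_basis.1.
  apply: (span_ind (U := [set u | exists c, coord_fun u c])); last first.
    move=> _ [e _ <-]; exists (fun f => (f == e)%:R), [fset e]%fset; split.
      by rewrite big_seq_fset1 eqxx scale1r.
    by move=> f; rewrite inE => /negPf->.
  split; first by exists (fun=> 0), fset0; split=> //; rewrite big_seq_fset0.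
  move=> a x w [c [s [xE c0]]] [c' [s' [wE c'0]]].
  exists (fun e => a * c e + c' e), (s `|` s')%fset; split=> [|e]; last first.
    by rewrite inE negb_or => /andP[/c0-> /c'0->]; rewrite mulr0 addr0.
  rewrite xE wE (sum_fset_widen _ (fsubsetUl s s')) //.
  rewrite (sum_fset_widen _ (fsubsetUr s s')) // scaler_sumr -big_split /=.
  by apply: eq_bigr => e _; rewrite scalerDl scalerA.
rewrite /coef; case: pselect => [exv|/(_ (ex v))//].
exact: (projT2 (cid exv)).
Qed.

Lemma coef_uniq v (c : E -> K) (s : {fset E}) :
  v = \sum_(e <- s) c e *: b e -> (forall e, e \notin s -> c e = 0) ->
  coef v = c.
Proof.
have [t [vE t0]] := coefP v; move=> vE' s0; apply/funext => e.
pose d f := coef v f - c f.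
have d0 : \sum_(f <- (s `|` t)%fset) d f *: b f = 0.
  under eq_bigr do rewrite scalerBl; rewrite big_split /= sumrN.
  rewrite -(sum_fset_widen b (fsubsetUr s t) t0).
  by rewrite -(sum_fset_widen b (fsubsetUl s t) s0) -vE -vE' subrr.
have [est|] := boolP (e \in (s `|` t)%fset).
  by apply/eqP; rewrite -subr_eq0; apply/eqP; exact: (b_basis.2 _ _ d0).
by rewrite inE negb_or => /andP[/s0-> /t0].
Qed.

Lemma coefB_lin a u v e : coef (a *: u + v) e = a * coef u e + coef v e.
Proof.
have [[s [uE s0]] [t [vE t0]]] := (coefP u, coefP v).
suff -> : coef (a *: u + v) = fun e => a * coef u e + coef v e by [].
apply: (@coef_uniq _ _ (s `|` t)%fset) => [|f]; last first.
  by rewrite inE negb_or => /andP[/s0-> /t0->]; rewrite mulr0 addr0.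
rewrite {1}uE {1}vE (sum_fset_widen _ (fsubsetUl s t)) //.
rewrite (sum_fset_widen _ (fsubsetUr s t)) // scaler_sumr -big_split /=.
by apply: eq_bigr => f _; rewrite scalerDl scalerA.
Qed.

Lemma coef_linear e : linear (coef^~ e : V -> K^o).
Proof. by move=> a u v; rewrite coefB_lin. Qed.

Lemma coef0 e : coef 0 e = 0.
Proof. exact: (linear_apply0 (@coef_linear e)). Qed.

Lemma coefD u v e : coef (u + v) e = coef u e + coef v e.
Proof. exact: (linear_applyD _ _ (@coef_linear e)). Qed.

Lemma coefB u v e : coef (u - v) e = coef u e - coef v e.
Proof. exact: (linear_applyB _ _ (@coef_linear e)). Qed.

Lemma coefZ a u e : coef (a *: u) e = a * coef u e.
Proof. exact: (linear_applyZ _ _ (@coef_linear e)). Qed.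

Lemma coef_sum (I : Type) (r : seq I) (P : pred I) (F : I -> V) e :
  coef (\sum_(i <- r | P i) F i) e = \sum_(i <- r | P i) coef (F i) e.
Proof. exact: (linear_apply_sum _ _ _ (@coef_linear e)). Qed.

Lemma coef_basis e f : coef (b e) f = (f == e)%:R.
Proof.
rewrite (@coef_uniq _ (fun f => (f == e)%:R) [fset e]%fset) //.
  by rewrite big_seq_fset1 eqxx scale1r.
by move=> g; rewrite inE => /negPf->.
Qed.

Definition supp (v : V) : {fset E} :=
  xget fset0 [set s : {fset E} | forall e, (e \in s) = (coef v e != 0)].

Lemma mem_supp v e : (e \in supp v) = (coef v e != 0).
Proof.
rewrite /supp; apply: (xgetPex fset0 (P := [set s : {fset E} |
  forall e, (e \in s) = (coef v e != 0)])).
have [s [_ s0]] := coefP v; exists [fset f in s | coef v f != 0]%fset => f.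
rewrite !inE /=; have [//|fs] := boolP (f \in s).
by rewrite s0 // eqxx.
Qed.

Lemma expand_in (I : {fset E}) v : (forall e, coef v e != 0 -> e \in I) ->
  v = \sum_(e <- I) coef v e *: b e.
Proof.
move=> vI; have [s [vE s0]] := coefP v.
rewrite {1}vE (sum_fset_widen _ (fsubsetUl s I)) //.
rewrite -(sum_fset_widen _ (fsubsetUr s I)) // => e eI.
by apply: contraNeq eI => /vI.
Qed.

Lemma expand v : v = \sum_(e <- supp v) coef v e *: b e.
Proof. by apply: expand_in => e; rewrite mem_supp. Qed.

Lemma coef_inj u v : coef u =1 coef v -> u = v.
Proof.
move=> uv; rewrite (expand v) (@expand_in (supp v) u); last first.
  by move=> e; rewrite uv mem_supp.
by apply: eq_bigr => e _; rewrite uv.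
Qed.

Lemma coef_mk (I : {fset E}) (c : E -> K) e :
  coef (\sum_(f <- I) c f *: b f) e = if e \in I then c e else 0.
Proof.
rewrite coef_sum; case: ifPn => eI.
  rewrite (bigD1_seq e) ?fset_uniq //= coefZ coef_basis eqxx mulr1.
  rewrite big1 ?addr0 // => f fe.
  by rewrite coefZ coef_basis eq_sym (negPf fe) mulr0.
rewrite big_seq big1 // => f fI; rewrite coefZ coef_basis.
by case: eqVneq eI => [->|]; rewrite ?fI ?mulr0.
Qed.

Lemma coord_spaceP (P : set E) v :
  coord_space b P v <-> forall e, coef v e != 0 -> P e.
Proof.
split; last first.
  move=> vP; rewrite (expand v) big_seq.
  apply: (subspace_sum _ (span_subspace _)) => e; rewrite mem_supp => /vP Pe.
  apply: (subspaceZ _ (span_subspace _)).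
  by apply: mem_span; exists e.
apply: (span_ind (U := [set v | forall e, coef v e != 0 -> P e])).
  split=> [e|a u w uP wP e]; first by rewrite coef0 eqxx.
  rewrite coefB_lin; have [->|/uP//] := eqVneq (coef u e) 0.
  by rewrite mulr0 add0r => /wP.
move=> _ [e Pe <-] f; rewrite coef_basis.
by have [->|_] := eqVneq f e; rewrite ?eqxx.
Qed.

Lemma mem_fspan (I : {fset E}) v :
  fspan b I v <-> forall e, coef v e != 0 -> e \in I.
Proof. exact: coord_spaceP. Qed.

Definition lin (W : lmodType K) (l : E -> W) (v : V) : W :=
  \sum_(e <- supp v) coef v e *: l e.

Lemma lin_in (W : lmodType K) (l : E -> W) (I : {fset E}) v :
  (forall e, coef v e != 0 -> e \in I) ->
  lin l v = \sum_(e <- I) coef v e *: l e.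
Proof.
move=> vI; apply: sum_fset_widen => [|e].
  by apply/fsubsetP => e; rewrite mem_supp => /vI.
by rewrite mem_supp negbK => /eqP.
Qed.

Lemma lin_linear (W : lmodType K) (l : E -> W) : linear (lin l).
Proof.
move=> a u v.
rewrite (@lin_in _ _ (supp u `|` supp v)%fset (a *: u + v)); last first.
  move=> e; rewrite coefB_lin inE !mem_supp.
  have [->|//] := eqVneq (coef u e) 0.
  by rewrite mulr0 add0r.
rewrite (@lin_in _ _ (supp u `|` supp v)%fset u); last first.
  by move=> e ue; rewrite inE mem_supp ue.
rewrite (@lin_in _ _ (supp u `|` supp v)%fset v); last first.
  by move=> e ue; rewrite inE !mem_supp ue orbT.
rewrite scaler_sumr -big_split /=; apply: eq_bigr => e _.
by rewrite coefB_lin scalerDl scalerA.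
Qed.

Lemma lin_basis (W : lmodType K) (l : E -> W) e : lin l (b e) = l e.
Proof.
rewrite (@lin_in _ _ [fset e]%fset).
  by rewrite big_seq_fset1 coef_basis eqxx scale1r.
by move=> f; rewrite coef_basis inE; have [|_] := eqVneq f e; rewrite ?eqxx.
Qed.

Lemma linear_expand (W : lmodType K) (g : V -> W) v :
  linear g -> g v = lin (g \o b) v.
Proof.
move=> lg; rewrite {1}(expand v) linear_apply_sum //.
by apply: eq_bigr => e _; rewrite linear_applyZ.
Qed.

Lemma eq_linear (W : lmodType K) (g h : V -> W) :
  linear g -> linear h -> (forall e, g (b e) = h (b e)) -> g =1 h.
Proof.
move=> lg lh gh v; rewrite (linear_expand v lg) (linear_expand v lh).
by apply: eq_bigr => e _; rewrite /= gh.
Qed.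

Lemma coef_lin (l : E -> V) v j :
  coef (lin l v) j = \sum_(e <- supp v) coef v e * coef (l e) j.
Proof. by rewrite coef_sum; apply: eq_bigr => e _; rewrite coefZ. Qed.

Lemma image_span (W : lmodType K) (g : V -> W) (S : set V) :
  linear g -> g @` span S = span (g @` S).
Proof.
move=> lg; apply/seteqP; split; last first.
  apply: span_min => [|_ [v Sv <-]]; last by exists v => //; exact: mem_span.
  have sS := span_subspace S.
  split; first by exists 0; [exact: sS.1|exact: linear_apply0].
  move=> a _ _ [u Su <-] [v Sv <-]; exists (a *: u + v); last exact: lg.
  exact: sS.2.
move=> _ [v Sv <-]; move: Sv.
apply: (span_ind (U := [set v | span (g @` S) (g v)])); last first.
  by move=> w Sw; apply: mem_span; exists w.
have sS := span_subspace (g @` S).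
split; first by rewrite /= linear_apply0 //; exact: sS.1.
by move=> a u w /= gu gw; rewrite lg; exact: sS.2.
Qed.

Lemma image_coord_space (W : lmodType K) (g : V -> W) (J : Type) (l : J -> V)
    (P : set J) :
  linear g -> g @` coord_space l P = coord_space (g \o l) P.
Proof. by move=> lg; rewrite /coord_space image_span // -image_comp. Qed.

Lemma coord_space_lin (W : lmodType K) (l : E -> W) (P : set E) :
  coord_space l P = lin l @` coord_space b P.
Proof.
rewrite image_coord_space; last exact: lin_linear.
by congr coord_space; apply/funext => e; rewrite /= lin_basis.
Qed.

Definition vec (I : {fset E}) (r : 'rV[K]_(size I)) : V :=
  \sum_(i < size I) r 0 i *: b (tnth (in_tuple I) i).

Definition row_of (I : {fset E}) (v : V) : 'rV[K]_(size I) :=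
  \row_i coef v (tnth (in_tuple I) i).

Lemma vec_linear I : linear (@vec I).
Proof.
move=> a u v; rewrite /vec scaler_sumr -big_split /=; apply: eq_bigr => i _.
by rewrite !mxE scalerDl scalerA.
Qed.

Lemma row_of_linear I : linear (row_of I).
Proof. by move=> a u v; apply/rowP => i; rewrite !mxE coefB_lin. Qed.

Lemma fspan_subspace I : subspace (fspan b I).
Proof. exact: span_subspace. Qed.

Lemma vec_fspan I r : fspan b I (@vec I r).
Proof.
apply: (subspace_sum _ (fspan_subspace I)) => i _.
apply: (subspaceZ _ (fspan_subspace I)).
by apply: mem_span; exists (tnth (in_tuple I) i) => //=; rewrite mem_tnth.
Qed.

Lemma row_ofK (I : {fset E}) v : fspan b I v -> vec (row_of I v) = v.
Proof.
move=> /mem_fspan vI; rewrite {2}(expand_in vI) big_tnth.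
by apply: eq_bigr => i _; rewrite mxE.
Qed.

Lemma tnth_in_tuple_inj (I : {fset E}) : injective (tnth (in_tuple I)).
Proof. exact/(tuple_uniqP (in_tuple I))/fset_uniq. Qed.

Lemma vecK (I : {fset E}) : cancel (@vec I) (row_of I).
Proof.
move=> r; apply/rowP => i; rewrite mxE coef_sum (bigD1 i) //=.
rewrite coefZ coef_basis eqxx mulr1 big1 ?addr0 // => j ji.
rewrite coefZ coef_basis (inj_eq (@tnth_in_tuple_inj I)) eq_sym (negPf ji).
by rewrite mulr0.
Qed.

(** * Standard subspaces *)

Implicit Types (I J : {fset E}) (U : set V) (P Q : pred E).

(** The trace of [U] on <I>, moved to row vectors so that the dimension theory of [{vspace _}]
    applies. The default value is never reached when [U] is a subspace. *)
Definition vs I U : {vspace 'rV[K]_(size I)} :=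
  if pselect (exists W : {vspace 'rV[K]_(size I)},
                forall r, r \in W <-> U (vec r)) is left ex
  then projT1 (cid ex) else 0%VS.

Lemma mem_vs I U r : subspace U -> r \in vs I U <-> U (vec r).
Proof.
move=> sU; rewrite /vs; case: pselect => [ex|[]].
  exact: (projT2 (cid ex)).
apply: (@vspace_of_set K 'rV[K]_(size I) [set r | U (vec r)]).
split; first by rewrite /= (linear_apply0 (@vec_linear I)); exact: sU.1.
by move=> a u v /= Uu Uv; rewrite vec_linear; exact: sU.2.
Qed.

Lemma sub_vs I U U' : subspace U -> subspace U' ->
  (U `&` fspan b I `<=` U') <-> (vs I U <= vs I U')%VS.
Proof.
move=> sU sU'; split=> [UU'|UU' v [Uv Iv]].
  apply/subvP => r /(mem_vs _ sU) Ur; apply/(mem_vs _ sU')/UU'.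
  by split=> //; exact: vec_fspan.
rewrite -(row_ofK Iv); apply/(mem_vs _ sU')/(subvP UU')/(mem_vs _ sU).
by rewrite row_ofK.
Qed.

Lemma eq_vs I U U' : subspace U -> subspace U' ->
  U `&` fspan b I = U' `&` fspan b I -> vs I U = vs I U'.
Proof.
move=> sU sU' E0; apply/eqP; rewrite eqEsubv; apply/andP; split.
  by apply/sub_vs => //; rewrite E0 => v [].
by apply/sub_vs => //; rewrite -E0 => v [].
Qed.

Lemma vsI I U U' : subspace U -> subspace U' ->
  vs I (U `&` U') = (vs I U :&: vs I U')%VS.
Proof.
move=> sU sU'; have sI := subspaceI sU sU'.
apply/vspaceP => r; rewrite memv_cap; apply/idP/andP.
  by move/(mem_vs _ sI) => [Ur U'r]; split; apply/mem_vs.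
by move=> [/(mem_vs _ sU) Ur /(mem_vs _ sU') U'r]; apply/mem_vs.
Qed.

Lemma addsp_subspace U U' : subspace U -> subspace U' -> subspace (addsp U U').
Proof.
move=> sU sU'; split.
  by exists 0; [exact: sU.1|exists 0; [exact: sU'.1|rewrite addr0]].
move=> a _ _ [u Uu [w Uw <-]] [u' Uu' [w' Uw' <-]].
exists (a *: u + u'); first exact: sU.2.
exists (a *: w + w'); first exact: sU'.2.
by rewrite scalerDr addrACA.
Qed.

Lemma vsD I U U' : subspace U -> subspace U' ->
  U `<=` fspan b I -> U' `<=` fspan b I ->
  vs I (addsp U U') = (vs I U + vs I U')%VS.
Proof.
move=> sU sU' UI U'I; have sA := addsp_subspace sU sU'.
apply/vspaceP => r; apply/idP/memv_addP.
  move/(mem_vs _ sA) => [u Uu [w Uw E0]].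
  exists (row_of I u); first by apply/mem_vs; rewrite ?row_ofK //; exact: UI.
  exists (row_of I w); first by apply/mem_vs; rewrite ?row_ofK //; exact: U'I.
  by rewrite -(linear_applyD _ _ (@row_of_linear I)) E0 vecK.
move=> [u /(mem_vs _ sU) Uu [w /(mem_vs _ sU') Uw ->]].
apply/mem_vs => //; exists (vec u) => //; exists (vec w) => //.
by rewrite (linear_applyD _ _ (@vec_linear I)).
Qed.

Lemma sum_enum_fset (k : nat) (W : nmodType) (F : 'I_k -> W) :
  \sum_(j <- [fset j in 'I_k]%fset) F j = \sum_j F j.
Proof.
rewrite -[RHS]big_enum /=; apply: perm_big; apply: uniq_perm.
- exact: fset_uniq.
- exact: enum_uniq.
- by move=> j; rewrite inE mem_enum.
Qed.

Lemma basis_ofP (k : nat) U (l : 'I_k -> V) : subspace U ->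
  basis_of U l <-> [/\ forall i, U (l i),
    forall v, U v -> exists c : 'I_k -> K, v = \sum_i c i *: l i &
    forall c : 'I_k -> K, \sum_i c i *: l i = 0 -> forall i, c i = 0].
Proof.
move=> sU; split=> [[spU indU]|[Ul lU indU]].
  split=> [i|v|c c0 i].
  - by rewrite -spU; apply: mem_span; exists i.
  - rewrite -spU; apply: (span_ind (U := [set v | exists c, _])).
      split; first by exists (fun=> 0); rewrite big1 // => i; rewrite scale0r.
      move=> a _ _ [c ->] [c' ->]; exists (fun i => a * c i + c' i).
      rewrite scaler_sumr -big_split /=; apply: eq_bigr => i _.
      by rewrite scalerDl scalerA.
    move=> _ [i _ <-]; exists (fun j => (j == i)%:R).
    rewrite (bigD1 i) //= eqxx scale1r big1 ?addr0 // => j /negPf->.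
    by rewrite scale0r.
  - by apply: (indU [fset j in 'I_k]%fset c); rewrite ?sum_enum_fset ?inE.
split.
  apply/seteqP; split.
    by apply: span_min => // _ [i _ <-]; exact: Ul.
  move=> v /lU[c ->]; apply: (subspace_sum _ (span_subspace _)) => i _.
  by apply: (subspaceZ _ (span_subspace _)); apply: mem_span; exists i.
move=> s c c0 j js.
pose c' i := if i \in s then c i else 0.
suff : c' j = 0 by rewrite /c' js.
apply: indU; rewrite -[RHS]c0 -sum_enum_fset.
have -> : \sum_(j <- s) c j *: l j = \sum_(j <- s) c' j *: l j.
  by rewrite !big_seq; apply: eq_bigr => i si; rewrite /c' si.
symmetry; apply: big_fset_incl; first by apply/fsubsetP => i; rewrite !inE.
by move=> i _ /negPf si; rewrite /c' si scale0r.
Qed.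

Lemma has_dimP I U k : subspace U -> U `<=` fspan b I ->
  has_dim U k <-> \dim (vs I U) = k.
Proof.
move=> sU UI; split.
  move=> [l /(basis_ofP _ sU)[Ul lU indU]].
  pose X := [tuple row_of I (l i) | i < k].
  suff : vector.basis_of (vs I U) X by move=> /vector.size_basis.
  rewrite vector.basisEfree; apply/and3P; split.
  - apply/freeP => c; under eq_bigr do rewrite -tnth_nth tnth_mktuple.
    move=> c0; apply: indU.
    rewrite -[RHS](linear_apply0 (@vec_linear I)) -[in RHS]c0.
    rewrite (linear_apply_sum _ _ _ (@vec_linear I)).
    apply: eq_bigr => i _; rewrite (linear_applyZ _ _ (@vec_linear I)).
    by rewrite row_ofK //; apply: UI; exact: Ul.
  - apply/span_subvP => _ /mapP[i _ ->]; apply/mem_vs => //.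
    by rewrite row_ofK //; apply: UI; exact: Ul.
  - rewrite size_tuple -[X in (_ <= X)%N](size_tuple X).
    apply: leq_trans (dim_span X); apply/dimvS/subvP => r.
    move/(mem_vs _ sU) => /lU[c rE].
    rewrite -[r]vecK rE (linear_apply_sum _ _ _ (@row_of_linear I)).
    apply: memv_suml => i _; rewrite (linear_applyZ _ _ (@row_of_linear I)).
    by apply/memvZ/memv_span/mapP; exists i; rewrite ?mem_enum.
move=> <-.
pose X := vbasis (vs I U); have Xb : vector.basis_of (vs I U) X by exact: vbasisP.
exists (fun i => vec (tnth X i)); apply/basis_ofP => //; split.
- by move=> i; apply/mem_vs => //; apply: vbasis_mem; exact: mem_tnth.
- move=> v Uv; have vI := UI _ Uv.
  exists (fun i => coord X i (row_of I v)).
  rewrite -{1}(row_ofK vI) {1}(@coord_vbasis _ _ (row_of I v) (vs I U)).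
    rewrite (linear_apply_sum _ _ _ (@vec_linear I)); apply: eq_bigr => i _.
    by rewrite (linear_applyZ _ _ (@vec_linear I)) -tnth_nth.
  by apply/mem_vs; rewrite ?row_ofK.
- move=> c c0; have /freeP := basis_free Xb; apply.
  rewrite -[RHS](linear_apply0 (@row_of_linear I)) -[in RHS]c0.
  rewrite (linear_apply_sum _ _ _ (@row_of_linear I)).
  apply: eq_bigr => i _; rewrite (linear_applyZ _ _ (@row_of_linear I)).
  by rewrite vecK -tnth_nth.
Qed.

Lemma has_dim_subspace U k : has_dim U k -> subspace U.
Proof. by move=> [l [<- _]]; exact: span_subspace. Qed.

Lemma has_dim_fspan U k : has_dim U k -> exists I, U `<=` fspan b I.
Proof.
move=> [l [UE _]].
exists (\bigcup_(i in [fset i in 'I_k]) supp (l i))%fset.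
rewrite -UE; apply: span_min; first exact: fspan_subspace.
move=> _ [i _ <-]; apply/mem_fspan => e le.
apply/bigfcupP; exists i; last by rewrite mem_supp.
by rewrite mem_index_enum !inE.
Qed.

Lemma has_dim_uniq U k m : has_dim U k -> has_dim U m -> k = m.
Proof.
move=> Uk; have [I UI] := has_dim_fspan Uk; have sU := has_dim_subspace Uk.
move=> Um; rewrite -((has_dimP k sU UI).1 Uk).
by rewrite -((has_dimP m sU UI).1 Um).
Qed.

Lemma has_dim_image (g : V -> V) U k :
  linear g -> injective g -> has_dim U k -> has_dim (g @` U) k.
Proof.
move=> lg ig [l lU]; have sU : subspace U by rewrite -lU.1; exact: span_subspace.
have sgU : subspace (g @` U) by rewrite -lU.1 image_span //; exact: span_subspace.
have /(basis_ofP _ sU)[Ul Ulc ind] := lU.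
exists (g \o l); apply/basis_ofP => //; split.
- by move=> i; exists (l i).
- move=> _ [v /Ulc[c ->] <-]; exists c; rewrite linear_apply_sum //.
  by apply: eq_bigr => i _; rewrite linear_applyZ.
- move=> c c0; apply: ind; apply: ig; rewrite [RHS](linear_apply0 lg) -[RHS]c0.
  by rewrite linear_apply_sum //; apply: eq_bigr => i _; rewrite linear_applyZ.
Qed.

Lemma has_dim_coord P I :
  has_dim (coord_space b [set e | P e] `&` fspan b I) (count P I).
Proof.
rewrite -size_filter; set s := [seq e <- I | P e].
have us : uniq s by rewrite filter_uniq // fset_uniq.
have sC : subspace (coord_space b [set e | P e] `&` fspan b I).
  by apply: subspaceI; exact: span_subspace.
exists (fun i => b (tnth (in_tuple s) i)); apply/basis_ofP => //.
have ms i : tnth (in_tuple s) i \in s by exact: mem_tnth.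
split.
- move=> i; have := ms i; rewrite mem_filter => /andP[Pi iI].
  by split; apply: mem_span; exists (tnth (in_tuple s) i).
- move=> v [/coord_spaceP vP /mem_fspan vI].
  exists (fun i => coef v (tnth (in_tuple s) i)).
  rewrite {1}(expand_in vI) -(big_tnth _ _ s xpredT (fun e => coef v e *: b e)).
  rewrite big_filter [RHS]big_mkcond; apply: eq_bigr => e _.
  by case: ifPn => // /negP Pe; have [->|/vP//] := eqVneq (coef v e) 0; rewrite scale0r.
- move=> c c0 i; have := congr1 (coef^~ (tnth (in_tuple s) i)) c0.
  rewrite coef0 coef_sum (bigD1 i) //= coefZ coef_basis eqxx mulr1.
  rewrite big1 ?addr0 // => j ji; rewrite coefZ coef_basis.
  have inj : injective (tnth (in_tuple s)) by exact/(tuple_uniqP (in_tuple s)).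
  by rewrite (inj_eq inj) eq_sym (negPf ji) mulr0.
Qed.

Lemma dim_vs_coord P I : \dim (vs I (coord_space b [set e | P e])) = count P I.
Proof.
have sC : subspace (coord_space b [set e | P e]) by exact: span_subspace.
rewrite -(@eq_vs I (coord_space b [set e | P e] `&` fspan b I)) //.
- apply/has_dimP; last exact: has_dim_coord.
    by apply: subspaceI => //; exact: span_subspace.
  by move=> v [].
- by apply: subspaceI => //; exact: span_subspace.
- by rewrite -setIA setIid.
Qed.

(* The terms of the flags in Fl(F, omega, I) have this form, <P> being the
   corresponding term of F. *)
Definition std I P U := [/\ subspace U, forall e, e \notin I -> P e -> U (b e),
  forall v e, U v -> e \notin I -> coef v e != 0 -> P e &
  \dim (vs I U) = count P I].

Definition restr I (v : V) : V := \sum_(e <- I) coef v e *: b e.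

Lemma coef_restr I v e : coef (restr I v) e = if e \in I then coef v e else 0.
Proof. exact: coef_mk. Qed.

Lemma restr_fspan I v : fspan b I (restr I v).
Proof.
by apply/mem_fspan => e; rewrite coef_restr; case: ifP => //; rewrite eqxx.
Qed.

(** The vector v differs from its restriction by a combination of vectors b e with e outside I and P
    e, all of which belong to [U]. *)
Lemma mem_restr I P U v : std I P U ->
  (forall e, e \notin I -> coef v e != 0 -> P e) -> U v <-> U (restr I v).
Proof.
move=> [sU bU _ _] vP; have Ud : U (v - restr I v).
  rewrite (expand (v - restr I v)) big_seq; apply: subspace_sum => // e.
  rewrite mem_supp coefB coef_restr; case: ifPn => eI; first by rewrite subrr eqxx.
  by rewrite subr0 => /(vP _ eI) Pe; apply: subspaceZ => //; exact: bU.
split=> [Uv|Ur]; last by rewrite -[v](subrK (restr I v)); exact: subspaceD.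
by rewrite -[restr I v](subKr v); exact: subspaceB.
Qed.

Lemma count_widen I J P : (I `<=` J)%fset ->
  count P J = (count P I + count (fun e => P e && (e \notin I)) J)%N.
Proof.
move=> /fsubsetP IJ.
have -> : count P I = count (fun e => P e && (e \in I)) J.
  rewrite -!size_filter; apply: perm_size; apply: uniq_perm.
  - by rewrite filter_uniq // fset_uniq.
  - by rewrite filter_uniq // fset_uniq.
  move=> e; rewrite !mem_filter -andbA; congr (_ && _).
  by case: (boolP (e \in I)) => //= /IJ->.
rewrite -[LHS]size_filter -(count_predC (fun e => e \in I)) !count_filter.
by congr (_ + _)%N; apply: eq_count => e /=; rewrite andbC.
Qed.

(** Both spaces have the same coordinate part outside I, and their traces on <I> have the same
    finite dimension. *)
Lemma std_sub_eq I P U U' : std I P U -> std I P U' -> U `<=` U' -> U = U'.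
Proof.
move=> Us U's UU'; apply/seteqP; split=> // v U'v.
have [[sU _ _ dU] [sU' _ U'P dU']] := (Us, U's).
apply: (mem_restr Us _).2 => [e|]; first exact: U'P.
have /eqP E0 : vs I U == vs I U'.
  by rewrite eqEdim dU dU' leqnn andbT; apply/sub_vs => // w [/UU'].
have := (sub_vs I sU' sU).2; rewrite E0; apply=> //.
split; last exact: restr_fspan.
by apply: (mem_restr U's _).1 => // e; exact: U'P.
Qed.

(** The trace on <J> is the direct sum of the trace on <I> and of the span of the b e with P e and e
    in J but not in I. *)
Lemma std_widen I J P U : (I `<=` J)%fset -> std I P U -> std J P U.
Proof.
move=> IJ Us; have [sU bU UP dU] := Us; have IJP := fsubsetP IJ.
split=> // [e eJ|v e Uv eJ|]; first by apply: bU; apply: contraNN eJ => /IJP.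
  by apply: UP => //; apply: contraNN eJ => /IJP.
pose Q e := P e && (e \notin I).
have sI : subspace (U `&` fspan b I) by exact/subspaceI/fspan_subspace.
have sQ : subspace (coord_space b [set e | Q e] `&` fspan b J).
  by apply: subspaceI; exact: span_subspace.
have IJs : U `&` fspan b I `<=` fspan b J.
  by move=> v [_ /mem_fspan vI]; apply/mem_fspan => e /vI/IJP.
have QJs : coord_space b [set e | Q e] `&` fspan b J `<=` fspan b J by move=> v [].
rewrite (@eq_vs J U (addsp (U `&` fspan b I)
                           (coord_space b [set e | Q e] `&` fspan b J))) //.
- rewrite vsD // dimv_disjoint_sum.
    have /(has_dimP _ sI) : has_dim (U `&` fspan b I) (count P I).
      have sub1 : U `&` fspan b I `<=` fspan b I by move=> v [].
      apply/(has_dimP _ sI sub1).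
      by rewrite -dU; congr (\dim _); apply: eq_vs => //; rewrite -setIA setIid.
    move=> ->//; have := has_dim_coord Q J => /(has_dimP _ sQ QJs)->.
    by rewrite (count_widen P IJ).
  apply/eqP; rewrite -subv0; apply/subvP => r; rewrite -vsI // => /mem_vs.
  case; first exact: subspaceI.
  move=> [_ /mem_fspan rI] [/coord_spaceP rQ _].
  suff r0 : vec r = 0.
    by rewrite -[r]vecK r0 (linear_apply0 (@row_of_linear J)) mem0v.
  apply: coef_inj => e; rewrite coef0; apply/eqP; apply: contraT => re.
  by have := rQ _ re; rewrite /Q /= (rI _ re) andbF.
- exact: addsp_subspace.
apply/seteqP; split=> v [Uv Jv]; split=> //; last first.
  case: Uv => u [Uu _] [w [/coord_spaceP Qw _] <-].
  apply: subspaceD => //; rewrite (expand w) big_seq.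
  apply: subspace_sum => // e; rewrite mem_supp => /Qw/andP[Pe eI].
  by apply: subspaceZ => //; exact: bU.
exists (restr I v).
  split; last exact: restr_fspan.
  by apply: (mem_restr Us _).1 => // e; exact: UP.
exists (v - restr I v); last by rewrite addrC subrK.
split; last first.
  apply: (subspaceB (fspan_subspace J)) => //.
  by apply/mem_fspan => e; rewrite coef_restr; case: ifP => [/IJP//|]; rewrite eqxx.
apply/coord_spaceP => e; rewrite coefB coef_restr /Q /=.
case: ifPn => eI; first by rewrite subrr eqxx.
by rewrite subr0 andbT; exact: UP.
Qed.

(** * The form and its isometries *)

Implicit Types (l : E -> V).
Hypothesis charK : [pchar K] =i pred0.
Variable omega : {biscalar V}.
Hypothesis omega_nondeg : forall u, (forall v, omega u v = 0) -> u = 0.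
Variable iE : E -> E.
Hypothesis iE_inv : involutive iE.
Hypothesis b_isotropic : forall e f, f <> iE e -> omega (b e) (b f) = 0.
Hypothesis omega_sym :
  ((forall u v, omega u v = omega v u) /\ exists! e, iE e = e) \/
  ((forall u v, omega u v = - omega v u) /\ forall e, iE e <> e).

Definition eps e : K := omega (b e) (b (iE e)).

Lemma omega_suml (T : Type) (r : seq T) (R : pred T) (F : T -> V) v :
  omega (\sum_(i <- r | R i) F i) v = \sum_(i <- r | R i) omega (F i) v.
Proof. exact: linear_sumlz. Qed.

Lemma omega_sumr (T : Type) (r : seq T) (R : pred T) (F : T -> V) v :
  omega v (\sum_(i <- r | R i) F i) = \sum_(i <- r | R i) omega v (F i).
Proof. exact: linear_sumr. Qed.

Lemma omegaZl a u v : omega (a *: u) v = a * omega u v.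
Proof. by rewrite linearZl_LR. Qed.

Lemma omegaZr a u v : omega u (a *: v) = a * omega u v.
Proof. by rewrite linearZr_LR. Qed.

Lemma omega_expandr e v : omega (b e) v = coef v (iE e) * eps e.
Proof.
rewrite {1}(expand v) omega_sumr.
rewrite (eq_bigr (fun f => coef v f * omega (b e) (b f))); last first.
  by move=> f _; rewrite omegaZr.
have [ev|ev] := boolP (iE e \in supp v); last first.
  have /eqP-> : coef v (iE e) == 0 by rewrite mem_supp negbK in ev.
  rewrite mul0r big_seq big1 // => f fv; rewrite b_isotropic ?mulr0 // => fe.
  by rewrite -fe fv in ev.
rewrite (bigD1_seq _ ev) ?fset_uniq //= big1 ?addr0 // => f /eqP fe.
by rewrite b_isotropic ?mulr0.
Qed.

Lemma omega_expand u v :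
  omega u v = \sum_(e <- supp u) coef u e * (coef v (iE e) * eps e).
Proof.
rewrite {1}(expand u) omega_suml.
by apply: eq_bigr => e _; rewrite omegaZl omega_expandr.
Qed.

Lemma omega_basis e f : omega (b e) (b f) = if f == iE e then eps e else 0.
Proof.
rewrite omega_expandr coef_basis eq_sym.
by case: eqP => _; rewrite ?mul1r ?mul0r.
Qed.

Lemma eps_neq0 e : eps e != 0.
Proof.
apply/eqP => e0; suff /(congr1 (coef^~ e)) : b e = 0.
  by move/eqP; rewrite coef0 coef_basis eqxx oner_eq0.
by apply: omega_nondeg => v; rewrite omega_expandr e0 mulr0.
Qed.

Lemma omega_sign : exists2 s : K, s * s = 1 & forall u v, omega u v = s * omega v u.
Proof.
case: omega_sym => [[sy _]|[sk _]].
  by exists 1; rewrite ?mulr1 // => u v; rewrite mul1r.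
by exists (-1) => [|u v]; rewrite ?mulrNN ?mulr1 // mulN1r.
Qed.

Lemma omega_eq0C u v : omega u v = 0 -> omega v u = 0.
Proof. by have [s _ sE] := omega_sign; move=> uv; rewrite sE uv mulr0. Qed.

Lemma perp_subspace U : subspace (perp omega U).
Proof.
split=> [u _|a u v uU vU w Uw]; first by rewrite linear0r.
by rewrite linearDr omegaZr uU // vU // mulr0 addr0.
Qed.

Lemma perp_coord (R : set E) :
  perp omega (coord_space b R) = coord_space b [set e | ~ R (iE e)].
Proof.
apply/seteqP; split=> v.
  move=> vR; apply/coord_spaceP => e ve Re.
  have /vR : coord_space b R (b (iE e)) by apply: mem_span; exists (iE e).
  rewrite omega_expandr iE_inv => /eqP; rewrite mulf_eq0 (negPf ve) /=.
  by rewrite (negPf (eps_neq0 _)).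
move=> /coord_spaceP vR u /coord_spaceP uR; rewrite omega_expand big_seq big1 //.
move=> e; rewrite mem_supp => /uR Re.
have [->|/vR] := eqVneq (coef v (iE e)) 0; first by rewrite mul0r mulr0.
by rewrite /= iE_inv.
Qed.

Lemma perp_image (g : V -> V) U : bijective g ->
  (forall u v, omega (g u) (g v) = omega u v) ->
  perp omega (g @` U) = g @` perp omega U.
Proof.
move=> [h gK hK] go; apply/seteqP; split=> [v vU|_ [v vU <-] _ [u Uu <-]].
  by exists (h v) => // u Uu; rewrite -go hK vU //; exists u.
by rewrite go vU.
Qed.

Lemma has_dim_sub_eq U U' k : has_dim U k -> has_dim U' k -> U `<=` U' -> U = U'.
Proof.
move=> Uk U'k UU'; have [I U'I] := has_dim_fspan U'k.
have [sU sU'] := (has_dim_subspace Uk, has_dim_subspace U'k).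
have UI : U `<=` fspan b I by move=> v /UU'/U'I.
apply/seteqP; split=> // v U'v.
have /eqP E0 : vs I U == vs I U'.
  rewrite eqEdim ((has_dimP k sU UI).1 Uk) ((has_dimP k sU' U'I).1 U'k) leqnn.
  by rewrite andbT; apply/sub_vs => // w [/UU'].
have := (sub_vs I sU' sU).2; rewrite E0; apply=> //.
by split=> //; exact: U'I.
Qed.

Lemma has_dim_fspanP I : has_dim (fspan b I) (size I).
Proof.
have := has_dim_coord predT I; rewrite count_predT.
have -> // : coord_space b [set e | predT e] `&` fspan b I = fspan b I.
by apply/seteqP; split=> [v []//|v vI]; split=> //; apply/coord_spaceP.
Qed.

Definition local I (l : E -> V) :=
  (forall e, e \notin I -> l e = b e) /\ (forall e, e \in I -> fspan b I (l e)).

Definition isom (l : E -> V) := forall e f, omega (l e) (l f) = omega (b e) (b f).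

Lemma lin_isom l : isom l -> forall u v, omega (lin l u) (lin l v) = omega u v.
Proof.
move=> li u v; rewrite [in RHS](expand u) [in RHS](expand v) !omega_suml.
apply: eq_bigr => e _; rewrite !omega_sumr; apply: eq_bigr => f _.
by rewrite !omegaZl !omegaZr li.
Qed.

Lemma local_fspan I l v : local I l -> fspan b I v -> fspan b I (lin l v).
Proof.
move=> [_ lI] /mem_fspan vI; rewrite (lin_in _ vI) big_seq.
apply: (subspace_sum _ (fspan_subspace I)) => e eI.
by apply: (subspaceZ _ (fspan_subspace I)); exact: lI.
Qed.

Lemma local_coef I l v e : local I l -> e \notin I -> coef (lin l v) e = coef v e.
Proof.
move=> [lE lI] eI; rewrite coef_lin [in RHS](expand v) coef_sum.
apply: eq_bigr => f _; rewrite coefZ; congr (_ * _).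
have [fI|/lE->//] := boolP (f \in I).
have [fe|fe] := eqVneq f e; first by rewrite -fe fI in eI.
rewrite coef_basis eq_sym (negPf fe); apply/eqP; apply: contraT => le.
by move/mem_fspan: (lI f fI) => /(_ e le); rewrite (negPf eI).
Qed.

Lemma local_fspan_eq I l v : local I l -> fspan b I (lin l v) -> fspan b I v.
Proof.
move=> ll /mem_fspan lv; apply/mem_fspan => e ve; apply: contraT => eI.
by rewrite -(negPf eI); apply: lv; rewrite (local_coef _ ll).
Qed.

Lemma lin_inj l : (forall v, lin l v = 0 -> v = 0) -> injective (lin l).
Proof.
move=> l0 u v uv; apply/eqP; rewrite -subr_eq0; apply/eqP/l0.
by rewrite (linear_applyB _ _ (lin_linear l)) uv subrr.
Qed.

Lemma local_image I l : local I l -> injective (lin l) ->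
  lin l @` fspan b I = fspan b I.
Proof.
move=> ll li; apply: (@has_dim_sub_eq _ _ (size I)).
- by apply: has_dim_image => //; [exact: lin_linear|exact: has_dim_fspanP].
- exact: has_dim_fspanP.
- by move=> _ [v vI <-]; exact: local_fspan.
Qed.

(** On <I> injectivity gives surjectivity by dimension, and the vectors b e with e outside I are
    fixed. *)
Lemma local_bij I l : local I l -> injective (lin l) -> bijective (lin l).
Proof.
move=> ll li.
have sur v : exists u, lin l u = v.
  have : (lin l @` fspan b I) (restr I v).
    by rewrite local_image //; exact: restr_fspan.
  move=> [u _ uE]; exists (u + (v - restr I v)).
  rewrite (linear_applyD _ _ (lin_linear l)) uE.
  rewrite [X in _ + X](_ : _ = v - restr I v); first by rewrite addrC subrK.
  rewrite {1}/lin [RHS]expand big_seq [RHS]big_seq; apply: eq_bigr => e.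
  rewrite mem_supp coefB coef_restr; case: ifPn => eI; first by rewrite subrr eqxx.
  by rewrite ll.1.
have [h hK] := choice sur.
by exists h => // u; apply: li; rewrite hK.
Qed.

Lemma isom_inj l : isom l -> injective (lin l).
Proof.
move=> li; apply: lin_inj => v lv0; apply: omega_nondeg => u.
by rewrite -(lin_isom li) lv0 linear0l.
Qed.

Local Notation G := (Gom omega b).

Lemma isom_G I l : local I l -> isom l -> G (lin l).
Proof.
move=> ll li; split.
- exact: lin_linear.
- exact: local_bij ll (isom_inj li).
- exact: lin_isom.
- apply: (@sub_finite_set _ _ [set` I]); last exact: finite_fset.
  move=> e /= lbe; apply: contraT => /ll.1 le.
  by case: lbe; rewrite lin_basis.
Qed.

Lemma G_linear g : G g -> linear g. Proof. by case. Qed.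

Lemma G_isom g : G g -> forall u v, omega (g u) (g v) = omega u v.
Proof. by case. Qed.

Lemma G_bij g : G g -> bijective g. Proof. by case. Qed.

Lemma G_lin g : G g -> g = lin (g \o b).
Proof. by move=> Gg; apply/funext => v; exact/linear_expand/G_linear. Qed.

Lemma G_comp g h : G g -> G h -> G (g \o h).
Proof.
move=> [lg bg og fg] [lh bh oh fh]; split.
- by move=> a u v /=; rewrite lh lg.
- exact: bij_comp.
- by move=> u v /=; rewrite og oh.
- apply: (@sub_finite_set _ _ ([set e | g (b e) <> b e] `|`
    [set e | h (b e) <> b e])); last by rewrite finite_setU.
  move=> e /= gh; have [he|he] := pselect (h (b e) = b e); last by right.
  by left => /= ge; rewrite he ge in gh.
Qed.

Lemma G_inv g : G g -> exists h, [/\ G h, cancel g h & cancel h g].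
Proof.
move=> [lg bg og fg]; have [h gK hK] := bg; exists h; split=> //; split.
- by move=> a u v; apply: (bij_inj bg); rewrite lg !hK.
- by exists g.
- by move=> u v; rewrite -og !hK.
- apply: sub_finite_set fg => e /= he ge; apply: he.
  by rewrite -{1}ge gK.
Qed.

Variable En : nat -> {fset E}.
Hypothesis En_stable : forall n e, e \in En n -> iE e \in En n.
Hypothesis En_incr : forall n e, e \in En n -> e \in En n.+1.
Hypothesis En_exhaust : forall e, exists n, e \in En n.
Hypothesis En_fixed : forall n e, iE e = e -> e \in En n.

Lemma En_mono m n : (m <= n)%N -> (En m `<=` En n)%fset.
Proof.
move=> /subnK <-; elim: (n - m)%N => [|k IHk]; first by rewrite add0n fsubset_refl.
by apply: (fsubset_trans IHk); apply/fsubsetP => e; exact: En_incr.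
Qed.

Lemma En_iE n e : (iE e \in En n) = (e \in En n).
Proof.
by apply/idP/idP => [/En_stable|]; [rewrite iE_inv|exact: En_stable].
Qed.

Lemma En_cover_seq (s : seq E) : exists n, forall e, e \in s -> e \in En n.
Proof.
elim: s => [|e s [n sn]]; first by exists 0%N.
have [m em] := En_exhaust e; exists (maxn m n) => f; rewrite inE => /predU1P[->|].
  exact: (fsubsetP (En_mono (leq_maxl m n))).
by move/sn; exact: (fsubsetP (En_mono (leq_maxr m n))).
Qed.

Lemma En_cover I : exists n, (I `<=` En n)%fset.
Proof. by have [n In] := En_cover_seq I; exists n; apply/fsubsetP. Qed.

Lemma local_widen I J l : (I `<=` J)%fset -> local I l -> local J l.
Proof.
move=> /fsubsetP IJ [lE lI]; split=> e.
  by move=> eJ; apply: lE; apply: contraNN eJ; exact: IJ.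
move=> eJ; have [/lI/mem_fspan leI|eI] := boolP (e \in I).
  by apply/mem_fspan => f /leI/IJ.
by rewrite lE //; apply: mem_span; exists e.
Qed.

Lemma finite_local (l : E -> V) : finite_set [set e | l e <> b e] ->
  exists n, local (En n) l.
Proof.
move=> fl; pose I := fset_set [set e | l e <> b e].
have mI e : l e <> b e -> e \in I by move=> le; rewrite in_fset_set // inE.
have [n nI] := En_cover (I `|` \bigcup_(e <- I) supp (l e))%fset.
exists n; split=> [e en|e en].
  apply: contrapT => /mI eI; move/negP: en; apply; apply: (fsubsetP nI).
  by rewrite inE eI.
have [->|/mI eI] := pselect (l e = b e); first by apply: mem_span; exists e.
apply/mem_fspan => f lf; apply: (fsubsetP nI); rewrite inE; apply/orP; right.
by apply/bigfcupP; exists e; rewrite ?eI ?mem_supp.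
Qed.

Lemma G_local g : G g -> exists n, local (En n) (g \o b).
Proof. by move=> [_ _ _ fg]; exact: finite_local. Qed.

(** * Triangular families *)

Variable leB : rel E.
Hypothesis leB_anti : antisymmetric leB.
Hypothesis leB_trans : transitive leB.
Hypothesis leB_total : total leB.
Hypothesis leB_iE : forall e f, leB (iE e) (iE f) = leB f e.
Local Notation lt := (ltB leB).

Lemma leB_refl e : leB e e.
Proof. by have := leB_total e e; rewrite orbb. Qed.

Lemma ltBNge e f : lt e f = ~~ leB f e.
Proof.
rewrite /ltB; have [->|ef] := eqVneq e f; first by rewrite leB_refl.
have := leB_total e f; case: (boolP (leB f e)) => //= fe; last by rewrite orbF.
by case: (boolP (leB e f)) => // ef'; rewrite (leB_anti (introT andP (conj ef' fe))) eqxx in ef.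
Qed.

Lemma ltB_neq e f : lt e f -> e != f. Proof. by case/andP. Qed.

Lemma ltBW e f : lt e f -> leB e f. Proof. by case/andP. Qed.

Lemma ltB_irr e : lt e e = false. Proof. by rewrite /ltB eqxx. Qed.

Lemma leB_ltB_trans e f g : leB e f -> lt f g -> lt e g.
Proof. rewrite !ltBNge => ef; apply: contraNN => ge; exact: leB_trans ef. Qed.

Lemma ltB_leB_trans e f g : lt e f -> leB f g -> lt e g.
Proof. rewrite !ltBNge => ef fg; apply: contraNN ef => ge; exact: leB_trans ge. Qed.

Lemma ltB_trans e f g : lt e f -> lt f g -> lt e g.
Proof. by move=> /ltBW; exact: leB_ltB_trans. Qed.

Lemma ltB_iE e f : lt (iE e) (iE f) = lt f e.
Proof. by rewrite !ltBNge leB_iE. Qed.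

Lemma leB_eqVlt e f : leB e f = (e == f) || lt e f.
Proof. by rewrite /ltB; have [->|] := eqVneq e f; rewrite ?leB_refl. Qed.

(** Leading places play the part of pivots in echelon forms. *)
Definition leads v e := coef v e != 0 /\ forall j, coef v j != 0 -> leB j e.

Lemma ex_leads v : v != 0 -> exists e, leads v e.
Proof.
move=> v0; have s0 : (supp v : seq E) != [::].
  by apply: contraNneq v0 => s0; rewrite (expand v) s0 big_nil.
have [||e es eP] := @seq_min _ (fun x y => leB y x) _ _ _ s0.
- by move=> x y; exact: leB_total.
- by move=> y x z xy yz; exact: leB_trans xy.
by exists e; rewrite /leads -mem_supp; split=> // j; rewrite -mem_supp => /eP.
Qed.

Lemma leads_uniq v e f : leads v e -> leads v f -> e = f.
Proof. by move=> [ve eP] [vf fP]; apply: leB_anti; rewrite fP ?eP. Qed.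

Lemma leads_basis e : leads (b e) e.
Proof.
split=> [|j]; rewrite coef_basis ?eqxx ?oner_neq0 //.
by have [->|_] := eqVneq j e; rewrite ?leB_refl ?eqxx.
Qed.

(** The order on E need not be well founded. The entries of the families considered, off the
    diagonal, sit at places of a finite set I, so the induction runs on the number of elements of I
    below e. *)
Lemma ltB_ind I (R : E -> Prop) :
  (forall e, (forall j, j \in I -> lt j e -> R j) -> R e) -> forall e, R e.
Proof.
move=> IH e; have [n] := ubnP (count (lt^~ e) I); elim: n e => // n IHn e en.
apply: IH => j jI je; apply: IHn; rewrite ltnS in en; apply: leq_trans en.
apply: (@ltn_count_in _ _ _ _ j) => //=; last by rewrite ltB_irr.
by move=> k _ /= kj; exact: ltB_trans je.
Qed.

Definition tri l := forall e, leads (l e) e.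

(* Unitriangular families; [R] restricts the positions of the nonzero entries. *)
Definition utri I (R : E -> E -> Prop) l := forall e, coef (l e) e = 1 /\
  forall j, j != e -> coef (l e) j != 0 -> [/\ e \in I, j \in I, lt j e & R e j].

Lemma utri_tri I R l : utri I R l -> tri l.
Proof.
move=> lu e; have [l1 lP] := lu e; split; first by rewrite l1 oner_neq0.
move=> j lj; have [->|je] := eqVneq j e; first exact: leB_refl.
by have [_ _ /ltBW] := lP j je lj.
Qed.

Lemma utri_local I R l : utri I R l -> local I l.
Proof.
move=> lu; split=> e eI; have [l1 lP] := lu e.
  apply: coef_inj => j; rewrite coef_basis; have [->|je] := eqVneq j e => //.
  by apply/eqP; apply: contraT => /(lP _ je)[]; rewrite (negPf eI).
apply/mem_fspan => j lj; have [->//|je] := eqVneq j e.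
by have [] := lP j je lj.
Qed.

Lemma tri_lead l v e : tri l -> leads v e -> leads (lin l v) e.
Proof.
move=> lt_ [ve eP]; split=> [|j].
  rewrite coef_lin (bigD1_seq e) ?fset_uniq ?mem_supp //= big1_seq ?addr0.
    by rewrite mulf_neq0 // (lt_ e).1.
  move=> f /andP[fe]; rewrite mem_supp => /eP fle; apply/eqP.
  rewrite mulf_eq0; apply/orP; right; apply: contraT => /(lt_ f).2 ef.
  by rewrite (leB_anti (introT andP (conj ef fle))) eqxx in fe.
rewrite coef_lin => lj.
have [f fv fj] : exists2 f, f \in supp v & coef v f * coef (l f) j != 0.
  apply: contrapT => no; move/eqP: lj; apply; rewrite big_seq big1 // => f fv.
  by apply/eqP; apply: contraT => fj; case: no; exists f.
move: fj; rewrite mulf_eq0 => /norP[_ /(lt_ f).2 jf].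
by apply: leB_trans jf _; apply: eP; rewrite -mem_supp.
Qed.

Lemma tri_inj l : tri l -> injective (lin l).
Proof.
move=> lt_; apply: lin_inj => v lv; apply/eqP; apply: contraT => /ex_leads[e ve].
by have [] := tri_lead lt_ ve; rewrite lv coef0 eqxx.
Qed.

Lemma utri_span I R l (D : set E) e : utri I R l ->
  (forall e j, D e -> lt j e -> D j) -> D e -> coord_space l D (b e).
Proof.
move=> lu Dl; elim/(@ltB_ind I): e => e IH De.
have [l1 lP] := lu e.
have -> : b e = l e - (l e - b e) by rewrite subKr.
apply: (subspaceB (span_subspace _)); first by apply: mem_span; exists e.
rewrite (expand (l e - b e)) big_seq; apply: (subspace_sum _ (span_subspace _)) => j.
rewrite mem_supp coefB coef_basis; have [->|je] := eqVneq j e.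
  by rewrite l1 subrr eqxx.
rewrite subr0 => /(lP _ je)[_ jI jle _]; apply: (subspaceZ _ (span_subspace _)).
by apply: IH => //; exact: Dl jle.
Qed.

Lemma utri_image I R l (D : set E) : utri I R l ->
  (forall e j, D e -> lt j e -> D j) -> coord_space l D = coord_space b D.
Proof.
move=> lu Dl; apply/seteqP; split.
  apply: span_min; first exact: span_subspace.
  move=> _ [e De <-]; apply/coord_spaceP => j lj; have [l1 lP] := lu e.
  have [->//|je] := eqVneq j e; have [_ _ jle _] := lP j je lj.
  exact: Dl jle.
apply: span_min; first exact: span_subspace.
by move=> _ [e De <-]; exact: (utri_span lu).
Qed.

(** * Leading places of the members of a flag *)

Variables (d : Order.disp_t) (A : orderType d).
Implicit Types (s : E -> A) (H : A -> set V).

Lemma coord_space_mono l s (a c : A) : (a <= c)%O ->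
  coord_space l [set e | (s e <= a)%O] `<=` coord_space l [set e | (s e <= c)%O].
Proof.
move=> ac; apply: span_min; first exact: span_subspace.
move=> _ [e ea <-]; apply: mem_span; exists e => //=; exact: le_trans ac.
Qed.

(** By [hitP] this is the condition U ∩ F''_{0,e} ≠ U ∩ F'_{0,e} which defines relative
    positions. *)
Definition hit (U : set V) e := exists2 v, U v & leads v e.

Lemma hit_coord l (D : set E) e : tri l -> hit (coord_space l D) e <-> D e.
Proof.
move=> lt_; split=> [[v]|De]; last first.
  by exists (l e) => //; apply: mem_span; exists e.
rewrite coord_space_lin => -[w /coord_spaceP wD <-] lve.
have [f wf] : exists f, leads w f.
  apply: ex_leads; apply: contraTneq isT => w0.
  by have [] := lve; rewrite w0 (linear_apply0 (lin_linear l)) coef0 eqxx.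
by rewrite (leads_uniq lve (tri_lead lt_ wf)); apply: wD; exact: wf.1.
Qed.

(** From a vector of H a, expanded in [l], the terms with s e <= a are subtracted; they lie in H a.
    If a remainder were left, its leading place would be hit by H a and hence satisfy s e <= a,
    although these terms are gone. *)
Lemma utri_basis_eq I R l s H : utri I R l ->
  (forall a, subspace (H a)) -> (forall a c, (a <= c)%O -> H a `<=` H c) ->
  (forall e, H (s e) (l e)) -> (forall a e, hit (H a) e -> (s e <= a)%O) ->
  forall a, H a = coord_space l [set e | (s e <= a)%O].
Proof.
move=> lu sH Hmono Hl hitH a; apply/seteqP; split; last first.
  by apply: span_min => // _ [e ea <-]; exact: (Hmono _ _ ea).
move=> v Hv; have : coord_space l setT v.
  by rewrite (utri_image lu) //; apply/coord_spaceP.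
rewrite (coord_space_lin l setT) (coord_space_lin l [set e | s e <= a]%O).
move=> -[w _ wv]; exists w => //; apply/coord_spaceP.
pose w1 := \sum_(e <- supp w | (s e <= a)%O) coef w e *: b e.
have Hw1 : H a (lin l w1).
  rewrite (linear_apply_sum _ _ _ (lin_linear l)); apply: subspace_sum => // e ea.
  rewrite (linear_applyZ _ _ (lin_linear l)) lin_basis; apply: subspaceZ => //.
  exact: (Hmono _ _ ea).
have w1E e : coef w1 e = if (s e <= a)%O then coef w e else 0.
  rewrite /w1 big_mkcond (eq_bigr (fun e =>
    (if (s e <= a)%O then coef w e else 0) *: b e)); last first.
    by move=> f _; case: ifP => // _; rewrite scale0r.
  rewrite coef_mk mem_supp; case: eqVneq => [->|]; first by rewrite if_same.
  by case: ifP.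
have [ww1|/ex_leads[e we]] := eqVneq (w - w1) 0; last first.
  have Hd : H a (lin l (w - w1)).
    rewrite (linear_applyB _ _ (lin_linear l)); apply: subspaceB => //.
    by rewrite wv.
  have He : hit (H a) e.
    by exists (lin l (w - w1)) => //; exact: tri_lead (utri_tri lu) we.
  have := hitH a e He; by case: we; rewrite coefB w1E; case: ifP => // _; rewrite subrr eqxx.
move=> e; have -> : w = w1 by apply/eqP; rewrite -subr_eq0 ww1.
by rewrite w1E; case: ifP => // _; rewrite eqxx.
Qed.

(** * Normal form of isotropic flags *)

Variables (iA : A -> A) (sigma0 : E -> A).
Hypothesis iA_inv : involutive iA.
Hypothesis iA_anti : forall a c, (iA a <= iA c)%O = (c <= a)%O.
Hypothesis sigma0_surj : forall a, exists e, sigma0 e = a.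
Hypothesis sigma0_iso : forall e, sigma0 (iE e) = iA (sigma0 e).

Lemma iA_lt a c : (iA a < iA c)%O = (c < a)%O.
Proof. by rewrite !ltNge iA_anti. Qed.

Lemma iA_le a c : (iA a <= c)%O = (iA c <= a)%O.
Proof. by rewrite -{1}[c]iA_inv iA_anti. Qed.

Definition below s (a : A) : pred E := fun e => (s e <= a)%O.

(* Only the spaces F''_a are recorded: the F'_a are their orthogonals. *)
Definition iflag I H := [/\ forall a, std I (below sigma0 a) (H a),
  forall a c, (a <= c)%O -> H a `<=` H c &
  forall a c u v, (c < iA a)%O -> H a u -> H c v -> omega u v = 0].

(* The maps sigma0 o w^-1, for w in the Weyl group supported in [I]. *)
Definition wtype I s := [/\ forall e, s (iE e) = iA (s e),
  forall e, e \notin I -> s e = sigma0 e &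
  forall a, count (below s a) I = count (below sigma0 a) I].

(** An inequality between two maps taking their values equally often on a finite set is an
    equality. *)
Lemma wtype_below_eq I s s' :
  (forall a, {in I, forall e, below s a e -> below s' a e}) ->
  (forall a, count (below s a) I = count (below sigma0 a) I) ->
  (forall a, count (below s' a) I = count (below sigma0 a) I) ->
  {in I, s =1 s'}.
Proof.
move=> ss' sc s'c e eI; apply/eqP; rewrite eq_le; apply/andP; split; last first.
  by apply: (ss' (s e) e eI); rewrite /below lexx.
apply: (count_sub_eq (ss' (s' e)) _ eI); last by rewrite /below lexx.
by rewrite sc s'c.
Qed.

Lemma iflag_hit_out n H e a : iflag (En n) H -> e \notin En n ->
  hit (H a) e <-> (sigma0 e <= a)%O.
Proof.
move=> [Hs _ _] eI; have [_ bH HP _] := Hs a; split=> [[v Hv [ve _]]|ea].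
  exact: (HP _ _ Hv).
by exists (b e); [exact: bH|exact: leads_basis].
Qed.

Lemma hit_restr n H e a : iflag (En n) H -> e \in En n -> hit (H a) e ->
  exists2 v, H a v & leads v e /\ fspan b (En n) v.
Proof.
move=> [Hs _ _] eI [v Hv [ve vP]]; exists (restr (En n) v).
  by apply: (mem_restr (Hs a) _).1 => // j; have [_ _ HP _] := Hs a; exact: HP.
split; last exact: restr_fspan.
split=> [|j]; rewrite coef_restr ?eI //.
by case: ifP => [_ /vP|]; rewrite ?eqxx.
Qed.

Lemma std_eq_in I P Q U U' v : std I P U -> std I Q U' -> {in I, P =1 Q} ->
  U' `<=` U -> U v -> fspan b I v -> U' v.
Proof.
move=> [sU _ _ dU] [sU' _ _ dU'] PQ U'U Uv vI.
have /eqP E0 : vs I U' == vs I U.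
  rewrite eqEdim dU dU' (eq_in_count PQ) leqnn andbT.
  by apply/sub_vs => // w [/U'U].
have := (sub_vs I sU sU').2; rewrite E0; apply=> //.
Qed.

(** Minima over A need not exist. On <E_n>, however, the trace of H a is that of H at the largest
    value <= a of sigma0 on E_n, so finitely many values decide; this is what makes relative
    positions exist. *)
Lemma iflag_max n H a v : iflag (En n) H -> H a v -> v != 0 -> fspan b (En n) v ->
  exists2 j, j \in En n & (sigma0 j <= a)%O /\ H (sigma0 j) v.
Proof.
move=> [Hs Hmono _] Hv v0 vI.
have [||| m] := @seq_min A (fun x y => y <= x)%O
    [seq sigma0 j | j <- En n & below sigma0 a j].
- by move=> x y; exact: le_total.
- by move=> y x z xy yz; exact: le_trans xy.
- apply: contraNneq v0 => /(congr1 size) /=; rewrite size_map size_filter => c0.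
  have [sH _ _ dH] := Hs a; rewrite c0 in dH.
  have : row_of (En n) v \in vs (En n) (H a) by apply/mem_vs; rewrite ?row_ofK.
  move/eqP: dH; rewrite dimv_eq0 => /eqP->; rewrite memv0 => /eqP r0.
  by rewrite -(row_ofK vI) r0 (linear_apply0 (@vec_linear (En n))).
move=> /mapP[j]; rewrite mem_filter => /andP[ja jI] -> jmax.
exists j => //; split=> //; apply: (std_eq_in (Hs a) (Hs _)) vI => //.
  move=> k kI; apply/idP/idP; last by move/le_trans; apply.
  by move=> ka; apply: jmax; apply/mapP; exists k; rewrite // mem_filter ka.
exact: Hmono.
Qed.

Lemma iflag_top n H a : iflag (En n) H -> (forall j, j \in En n -> sigma0 j <= a)%O ->
  fspan b (En n) `<=` H a.
Proof.
move=> [Hs _ _] Ja; have [sH _ _ dH] := Hs a.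
move=> v vI; apply: ((sub_vs (En n) (fspan_subspace (En n)) sH).2 _ v (conj vI vI)).
suff -> : vs (En n) (H a) = fullv by exact: subvf.
apply/eqP; rewrite eqEdim subvf dimvf dH dim_matrix.
rewrite -[X in (X <= _)%N]/(1 * size (En n))%N mul1n.
rewrite (@eq_in_count _ _ predT) => [|j jI]; last by rewrite /= /below Ja.
by rewrite count_predT leqnn.
Qed.

Lemma iflag_position n H : iflag (En n) H -> exists s : E -> A, forall e,
  hit (H (s e)) e /\ forall c, hit (H c) e -> (s e <= c)%O.
Proof.
move=> Hf; suff ex e : exists a, hit (H a) e /\ forall c, hit (H c) e -> (a <= c)%O.
  by have [s sP] := choice ex; exists s.
have [eI|eI] := boolP (e \in En n); last first.
  exists (sigma0 e); split=> [|c]; first exact/(iflag_hit_out _ Hf eI).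
  by move=> /(iflag_hit_out _ Hf eI).
have red c : hit (H c) e -> exists2 j, j \in En n &
    (sigma0 j <= c)%O /\ hit (H (sigma0 j)) e.
  move=> /(hit_restr Hf eI)[v Hv [ve vI]].
  have v0 : v != 0 by apply: contraTneq isT => v0; case: ve; rewrite v0 coef0 eqxx.
  have [j jI [jc Hj]] := iflag_max Hf Hv v0 vI.
  by exists j => //; split=> //; exists v.
pose S := [seq sigma0 j | j <- En n & `[< hit (H (sigma0 j)) e >]].
have [|||m mS mP] := @seq_min A (fun x y => x <= y)%O S.
- by move=> x y; exact: le_total.
- by move=> y x z; exact: le_trans.
(* [S] is not empty: at the largest value of sigma0 on E_n the space contains <E_n>, hence b e. *)
- have [||| m mS mP] := @seq_min A (fun x y => y <= x)%O [seq sigma0 j | j <- En n].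
  + by move=> x y; exact: le_total.
  + by move=> y x z xy yz; exact: le_trans xy.
  + apply: contraTneq isT => /(congr1 size); rewrite size_map => /size0nil E0.
    by have : e \in (En n : seq E) by []; rewrite E0.
  have /red[j jI [_ Hj]] : hit (H m) e.
    exists (b e); last exact: leads_basis.
    apply: (iflag_top Hf) => [j jI|]; first by apply: mP; apply/mapP; exists j.
    by apply: mem_span; exists e.
  have : sigma0 j \in S.
    by apply/mapP; exists j => //; rewrite mem_filter jI andbT; apply/asboolP.
  by apply: contraTneq => ->.
exists m; split=> [|c /red[j jI [jc Hj]]].
  by case/mapP: mS => j; rewrite mem_filter => /andP[/asboolP Hj _] ->.
apply: le_trans jc; apply: mP; apply/mapP; exists j => //.
by rewrite mem_filter jI andbT; apply/asboolP.
Qed.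

Lemma dim_coord_local I l P : local I l -> injective (lin l) ->
  \dim (vs I (coord_space l [set e | P e])) = count P I.
Proof.
move=> ll li; have sC : subspace (coord_space l [set e | P e]) by exact: span_subspace.
have sCI : subspace (coord_space l [set e | P e] `&` fspan b I).
  by apply: subspaceI => //; exact: fspan_subspace.
rewrite -(@eq_vs I (coord_space l [set e | P e] `&` fspan b I)) //; last first.
  by rewrite -setIA setIid.
apply/(has_dimP _ sCI) => [v []//|].
have := has_dim_image (lin_linear l) li (has_dim_coord P I).
have -> // : lin l @` (coord_space b [set e | P e] `&` fspan b I) =
  coord_space l [set e | P e] `&` fspan b I.
rewrite (coord_space_lin l); apply/seteqP; split=> [_ [v [Pv vI] <-]|_ [[v Pv <-] vI]].
  by split; [exists v|exact: local_fspan].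
by exists v => //; split=> //; exact: local_fspan_eq vI.
Qed.

(** On a finite set the condition < a is the condition <= m, where m is the largest value below a of
    either map. *)
Lemma count_lt I s s' a : (forall c, count (below s c) I = count (below s' c) I) ->
  count (fun e => s e < a)%O I = count (fun e => s' e < a)%O I.
Proof.
move=> ss'; pose S := [seq s e | e <- I & (s e < a)%O] ++ [seq s' e | e <- I & (s' e < a)%O].
have [S0|Sn0] := eqVneq S [::].
  have : size S = 0%N by rewrite S0.
  by rewrite size_cat !size_map !size_filter => /eqP; rewrite addn_eq0 => /andP[/eqP-> /eqP->].
have [||m mS mP] := @seq_min A (fun x y => y <= x)%O _ _ _ Sn0.
- by move=> x y; exact: le_total.
- by move=> y x z xy yz; exact: le_trans xy.
have ma : (m < a)%O.
  by move: mS; rewrite mem_cat => /orP[] /mapP[e]; rewrite mem_filter => /andP[? _] ->.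
transitivity (count (below s m) I); last rewrite ss'.
  apply: eq_in_count => e eI; apply/idP/idP => [ea|/le_lt_trans]; last exact.
  by apply: mP; rewrite mem_cat map_f // mem_filter ea.
apply: eq_in_count => e eI; apply/idP/idP => [/le_lt_trans|ea]; first exact.
by apply: mP; rewrite mem_cat (map_f s') ?orbT // mem_filter ea.
Qed.

Lemma count_iE n P : count (fun e => P (iE e)) (En n) = count P (En n).
Proof.
rewrite -(count_map iE P); apply/permP/uniq_perm; last 1 first.
- move=> e; apply/mapP/idP => [[f fI ->]|eI]; first by rewrite En_iE.
  by exists (iE e); rewrite ?iE_inv ?En_iE.
- by rewrite map_inj_uniq ?fset_uniq //; exact: inv_inj.
- exact: fset_uniq.
Qed.

(** In omega (l e) (l (iE e)) only the leading terms pair: j <= e together with iE j <= iE e forces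
    j = e. The product is thus nonzero, and isotropy gives iA (s e) <= s (iE e). Equality follows
    because both sides take each value equally often. *)
Lemma iflag_symmetric n H s l : iflag (En n) H ->
  (forall e, e \notin En n -> s e = sigma0 e) ->
  (forall a, count (below s a) (En n) = count (below sigma0 a) (En n)) ->
  (forall e, leads (l e) e) -> (forall e, H (s e) (l e)) ->
  forall e, s (iE e) = iA (s e).
Proof.
move=> [_ _ Hp] s0 sc ll Hl.
have le_s e : (iA (s e) <= s (iE e))%O.
  rewrite leNgt; apply/negP => lt_s; have := Hp _ _ _ _ lt_s (Hl e) (Hl (iE e)).
  rewrite omega_expand (bigD1_seq e) ?fset_uniq ?mem_supp ?(ll e).1 //=.
  rewrite big1_seq => [|j /andP[je]]; last first.
    rewrite mem_supp => /(ll e).2 jle; have [->|/(ll (iE e)).2] := eqVneq (coef (l (iE e)) (iE j)) 0.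
      by rewrite mul0r mulr0.
    by rewrite leB_iE => ej; rewrite (leB_anti (introT andP (conj ej jle))) eqxx in je.
  rewrite addr0 => /eqP; rewrite !mulf_eq0 (negPf (eps_neq0 e)) orbF.
  by rewrite (negPf (ll e).1) (negPf (ll (iE e)).1).
move=> e; have [eI|eI] := boolP (e \in En n); last first.
  by rewrite !s0 ?En_iE.
move: e eI; apply: (wtype_below_eq (s := s \o iE)) => [a e _|a|a].
- by apply: le_trans; exact: le_s.
- by rewrite -sc -(count_iE n (below s a)).
have cntC t : count (fun e => iA (t e) <= a)%O (En n) =
    (size (En n) - count (fun e => t e < iA a)%O (En n))%N.
  rewrite -(count_predC (fun e => t e < iA a)%O) addKn.
  by apply: eq_count => e /=; rewrite -leNgt iA_le.
rewrite /below /= cntC (count_lt _ sc) -cntC -(count_iE n (below sigma0 a)).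
by apply: eq_count => e; rewrite /below /= sigma0_iso.
Qed.

(** Gaussian elimination: l f is cleared of its entries at the places j with s j <= s f by
    subtracting vectors of H (s f). *)
Lemma utri_reduce I R l s H : utri I R l ->
  (forall a, subspace (H a)) -> (forall a c, (a <= c)%O -> H a `<=` H c) ->
  (forall e, H (s e) (l e)) ->
  exists l', utri I (fun e j => s e < s j)%O l' /\ forall e, H (s e) (l' e).
Proof.
move=> lu sH Hmono Hl.
suff ex f : exists v, H (s f) v /\ (coef v f = 1 /\ forall j, j != f ->
    coef v j != 0 -> [/\ f \in I, j \in I, lt j f & (s f < s j)%O]).
  by have [l' l'P] := choice ex; exists l'; split=> e; [exact: (l'P e).2|exact: (l'P e).1].
have [l1 lP] := lu f.
(* In this mixed triangular basis, the part of l f - b f along the l j lies in H (s f) and can be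
   removed; what remains is supported at the places with s j > s f. *)
pose m j := if (s j <= s f)%O then l j else b j.
have mu : utri I R m.
  move=> e; rewrite /m; case: ifP => _; first exact: lu.
  by rewrite coef_basis eqxx; split=> // j je; rewrite coef_basis (negPf je) eqxx.
pose D : set E := [set j | [/\ f \in I, j \in I & lt j f]].
pose D' : set E := [set j | lt j f].
have [z zD zE] : exists2 z, forall j, coef z j != 0 -> D' j & l f - b f = lin m z.
  have : coord_space m D' (l f - b f).
    rewrite (utri_image mu); last by move=> e j; rewrite /D' /= => ef /ltB_trans; apply.
    apply/coord_spaceP => j; rewrite coefB coef_basis; have [->|jf] := eqVneq j f.
      by rewrite l1 subrr eqxx.
    by rewrite subr0 => /(lP _ jf)[].
  by rewrite coord_space_lin => -[z /coord_spaceP zD <-]; exists z.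
have zI j : coef z j != 0 -> f \in I /\ j \in I.
  have sub : local I (fun e => l e - b e + b e).
    by apply: (@utri_local I R) => e; rewrite subrK; exact: lu.
  have mI := utri_local mu.
  have fI : coef z j != 0 -> f \in I.
    move=> zj; apply: contraT => fI; have lf := (utri_local lu).1 f fI.
    have : lin m z = 0 by rewrite -zE lf subrr.
    rewrite -(linear_apply0 (lin_linear m)) => /(tri_inj (utri_tri mu)) z0.
    by rewrite z0 coef0 eqxx in zj.
  move=> zj; split; first exact: fI.
  have : fspan b I z.
    apply: (local_fspan_eq mI); rewrite -zE; apply: (subspaceB (fspan_subspace I)).
      by apply: (utri_local lu).2; exact: fI.
    by apply: mem_span; exists f => //; exact: fI.
  by move=> /mem_fspan; apply.
pose z1 := \sum_(j <- supp z) (if (s j <= s f)%O then coef z j else 0) *: b j.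
have z1E j : coef z1 j = if (s j <= s f)%O then coef z j else 0.
  rewrite /z1 coef_mk mem_supp; case: eqVneq => [->|]; first by rewrite if_same.
  by case: ifP.
exists (l f - lin m z1); split.
  apply: subspaceB => //; rewrite /lin; apply: subspace_sum => // j _.
  rewrite z1E /m; case: ifP => jf; last first.
    by rewrite scale0r; exact: (sH _).1.
  by apply: subspaceZ => //; exact: (Hmono _ _ jf).
have E0 : l f - lin m z1 = b f + (z - z1).
  have -> : l f = b f + lin m z by rewrite -zE addrC subrK.
  rewrite -addrA -(linear_applyB _ _ (lin_linear m)); congr (_ + _).
  rewrite /lin [RHS]expand; apply: eq_big_seq => j; rewrite mem_supp => dj.
  congr (_ *: _); move: dj; rewrite coefB z1E /m.
  by case: ifP; rewrite // subrr eqxx.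
rewrite E0 coefD coef_basis eqxx coefB z1E lexx subrr addr0; split=> // j jf.
rewrite coefD coef_basis (negPf jf) add0r coefB z1E leNgt.
case: ltP => /= [fj|_]; last by rewrite subrr eqxx.
by rewrite subr0 => zj; have [fI jI] := zI j zj; split=> //; exact: zD.
Qed.

(** If s f < s (iE e) the product vanishes by isotropy. Otherwise a term of omega (l e) (l f) at a
    place j other than e would require s e < s j and s f <= s (iE j), whereas s (iE j) < s (iE e) <=
    s f. Only the diagonal entries, equal to 1, remain. *)
Lemma reduced_isom I l s H : utri I (fun e j => s e < s j)%O l ->
  (forall e, s (iE e) = iA (s e)) ->
  (forall a c u v, (c < iA a)%O -> H a u -> H c v -> omega u v = 0) ->
  (forall e, H (s e) (l e)) -> isom l.
Proof.
move=> lu siE Hp Hl e f; rewrite omega_basis.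
have [lt_s|le_s] := ltP (s f) (s (iE e)).
  rewrite (Hp _ _ _ _ _ (Hl e) (Hl f)) -?siE //.
  by case: eqP lt_s => // ->; rewrite ltxx.
have red g j : coef (l g) j != 0 -> j = g \/ (s g < s j)%O.
  have [->|jg] := eqVneq j g; first by left.
  by move=> /((lu g).2 _ jg)[]; right.
have ee : e \in supp (l e) by rewrite mem_supp (lu e).1 oner_neq0.
rewrite omega_expand (bigD1_seq e) ?fset_uniq //= big1_seq => [|j /andP[je]].
  rewrite addr0 (lu e).1 mul1r; have [->|fe] := eqVneq f (iE e).
    by rewrite (lu (iE e)).1 mul1r.
  have [->|/red] := eqVneq (coef (l f) (iE e)) 0; first by rewrite mul0r.
  by move=> [E0|]; [rewrite E0 eqxx in fe|rewrite ltNge le_s].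
rewrite mem_supp => /red[E0|ej]; first by rewrite E0 eqxx in je.
have [->|/red fj] := eqVneq (coef (l f) (iE j)) 0; first by rewrite mul0r mulr0.
have : (s (iE j) < s (iE e))%O by rewrite !siE iA_lt.
move=> /lt_le_trans /(_ le_s); case: fj => [->|fj]; first by rewrite ltxx.
by rewrite ltNge ltW.
Qed.

Definition reduced I s l := utri I (fun e j => s e < s j)%O l.

Theorem iflag_normal_form n H : iflag (En n) H -> exists s l,
  [/\ wtype (En n) s, reduced (En n) s l, isom l &
      forall a, H a = coord_space l [set e | (s e <= a)%O]].
Proof.
move=> Hf; have [Hs Hmono Hp] := Hf; have [s sP] := iflag_position Hf.
have sH a : subspace (H a) by case: (Hs a).
have s0 e : e \notin En n -> s e = sigma0 e.
  move=> eI; have [se smin] := sP e; apply/eqP; rewrite eq_le; apply/andP; split.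
    by apply: smin; apply/(iflag_hit_out _ Hf eI).
  exact/(iflag_hit_out _ Hf eI).
suff [l0 [l0u l0H]] : exists l0, utri (En n) (fun _ _ => True) l0 /\
    forall e, H (s e) (l0 e).
  have [l [lr lH]] := utri_reduce l0u sH Hmono l0H.
  have HE := utri_basis_eq lr sH Hmono lH (fun a e => (sP e).2 a).
  have ltri := utri_tri lr.
  have sc a : count (below s a) (En n) = count (below sigma0 a) (En n).
    have [_ _ _ <-] := Hs a; rewrite HE.
    by rewrite (dim_coord_local _ (utri_local lr) (tri_inj ltri)).
  have siE := iflag_symmetric Hf s0 sc ltri lH.
  by exists s, l; split=> //; exact: reduced_isom lr siE Hp lH.
suff ex e : exists v, H (s e) v /\ (coef v e = 1 /\ forall j, j != e ->
    coef v j != 0 -> [/\ e \in En n, j \in En n, lt j e & True]).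
  by have [l lP] := choice ex; exists l; split=> e; [exact: (lP e).2|exact: (lP e).1].
have [eI|eI] := boolP (e \in En n); last first.
  exists (b e); split; last first.
    by rewrite coef_basis eqxx; split=> // j je; rewrite coef_basis (negPf je) eqxx.
  by have [_ bH _ _] := Hs (s e); apply: bH => //; rewrite /below s0.
have [v Hv [[ve vmax] /mem_fspan vI]] := hit_restr Hf eI (sP e).1.
exists ((coef v e)^-1 *: v); split; first exact: subspaceZ.
rewrite coefZ mulVf //; split=> // j je.
rewrite coefZ mulf_eq0 => /norP[_ vj]; split=> //; first exact: vI.
by rewrite /ltB je vmax.
Qed.

(** * Borel orbits and relative position *)

Local Notation B := (stab omega b (borel_flag leB b)).
Local Notation hi_ l s := (fun a => coord_space l [set e | (s e <= a)%O]).

Definition flag_from H : set (set V) :=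
  flag_of (fun a => perp omega (H (iA a))) H.

Lemma act_flag_of (g : V -> V) (lo hi : A -> set V) :
  act g (flag_of lo hi) = flag_of (fun a => g @` lo a) (fun a => g @` hi a).
Proof.
apply/seteqP; split=> [_ [F [] [a _ <-] <-]|F [] [a _ <-]].
- by left; exists a.
- by right; exists a.
- by exists (lo a) => //; left; exists a.
- by exists (hi a) => //; right; exists a.
Qed.

Lemma act_coord_flag (g : V -> V) l s :
  linear g -> act g (coord_flag l s) = coord_flag (g \o l) s.
Proof.
move=> lg; rewrite act_flag_of /coord_flag.
by congr flag_of; apply/funext => a; rewrite /flag_lo /flag_hi image_coord_space.
Qed.

Lemma lin_comp_basis l : lin l \o b = l.
Proof. by apply/funext => e; rewrite /= lin_basis. Qed.

Lemma act_lin_coord_flag l s : act (lin l) (coord_flag b s) = coord_flag l s.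
Proof. by rewrite act_coord_flag ?lin_comp_basis //; exact: lin_linear. Qed.

Lemma iA_ge a c : (a <= iA c)%O = (c <= iA a)%O.
Proof. by rewrite -{1}[a]iA_inv iA_anti. Qed.

Lemma perp_coord_below l s a : Gom omega b (lin l) ->
  (forall e, s (iE e) = iA (s e)) ->
  perp omega (coord_space l [set e | (s e <= a)%O]) =
  coord_space l [set e | (s e < iA a)%O].
Proof.
move=> Gl siE; rewrite (coord_space_lin l) perp_image ?perp_coord; last 2 first.
- exact: G_bij.
- exact: G_isom.
rewrite [RHS](coord_space_lin l); congr (_ @` coord_space _ _).
apply/seteqP; split=> e /=; rewrite siE iA_le; first by move/negP; rewrite ltNge.
by rewrite ltNge => /negP.
Qed.

Lemma coord_flagE l s : Gom omega b (lin l) -> (forall e, s (iE e) = iA (s e)) ->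
  coord_flag l s = flag_from (hi_ l s).
Proof.
move=> Gl siE; congr flag_of; apply/funext => a.
by rewrite perp_coord_below // iA_inv.
Qed.

Lemma std_coord I l P Q : local I l -> injective (lin l) ->
  (forall e, e \notin I -> P e = Q e) -> count P I = count Q I ->
  std I Q (coord_space l [set e | P e]).
Proof.
move=> ll li PQ cPQ; split.
- exact: span_subspace.
- by move=> e eI Qe; apply: mem_span; exists e; rewrite /= ?PQ // ll.1.
- move=> v e; rewrite (coord_space_lin l) => -[w /coord_spaceP wP <-] eI.
  by rewrite (local_coef _ ll) // => /wP /=; rewrite PQ.
- by rewrite (dim_coord_local _ ll).
Qed.

Lemma wtype_count_lt I s a : wtype I s ->
  count (fun e => s e < a)%O I = count (fun e => sigma0 e < a)%O I.
Proof. by move=> [_ _ sc]; exact: count_lt. Qed.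

Lemma wtype_iflag n l s : wtype (En n) s -> local (En n) l -> isom l ->
  iflag (En n) (hi_ l s).
Proof.
move=> [siE s0 sc] ll li; split=> [a|a c|a c u v ca].
- apply: (@std_coord _ _ (below s a)) => //; first exact: isom_inj.
  by move=> e eI; rewrite /below s0.
- exact: coord_space_mono.
- have Gl := isom_G ll li.
  move=> Hu Hv; suff : perp omega (coord_space l [set e | (s e <= a)%O]) v by apply.
  rewrite perp_coord_below //; move: Hv; apply: span_min.
    exact: span_subspace.
  by move=> _ [e ec <-]; apply: mem_span; exists e => //=; exact: le_lt_trans ca.
Qed.

Lemma below_chain s (D D' : set E) :
  (exists a, D = [set e | s e < a]%O \/ D = [set e | s e <= a]%O) ->
  (exists a, D' = [set e | s e < a]%O \/ D' = [set e | s e <= a]%O) ->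
  D `<=` D' \/ D' `<=` D.
Proof.
have S a c : (a < c)%O -> [set e | s e <= a]%O `<=` [set e | s e < c]%O.
  by move=> ac e /= ea; exact: le_lt_trans ac.
have W a : [set e | s e < a]%O `<=` [set e | s e <= a]%O by move=> e /ltW.
move=> [a Da] [c Dc].
case: (ltgtP a c) => [ac|ca|E0]; [left|right|].
- case: Da Dc => -> [] -> //; do ?[exact: subset_trans (W _) (S _ _ ac)].
  + by apply: subset_trans (W _); exact: subset_trans (W _) (S _ _ ac).
  + exact: S.
  + by apply: subset_trans (W _); exact: S.
- case: Da Dc => -> [] -> //; do ?[exact: subset_trans (W _) (S _ _ ca)].
  + exact: S.
  + by apply: subset_trans (W _); exact: subset_trans (W _) (S _ _ ca).
  + by apply: subset_trans (W _); exact: S.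
- rewrite -E0 in Dc; case: Da Dc => -> [] ->; [by left|left|right|by left]; exact: W.
Qed.

Lemma coord_space_sub (W : lmodType K) (l : E -> W) (D D' : set E) :
  D `<=` D' -> coord_space l D `<=` coord_space l D'.
Proof.
move=> DD'; apply: span_min; first exact: span_subspace.
by move=> _ [e /DD' De <-]; apply: mem_span; exists e.
Qed.

Lemma coord_flagP l s F : coord_flag l s F <-> exists D : set E,
  (exists a, D = [set e | s e < a]%O \/ D = [set e | s e <= a]%O) /\
  F = coord_space l D.
Proof.
split=> [[] [a _ <-]|[_ [[a [->|->]] ->]]].
- by exists [set e | s e < a]%O; split=> //; exists a; left.
- by exists [set e | s e <= a]%O; split=> //; exists a; right.
- by left; exists a.
- by right; exists a.
Qed.

Lemma coord_flag_chain l s F F' : coord_flag l s F -> coord_flag l s F' ->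
  F `<=` F' \/ F' `<=` F.
Proof.
move=> /coord_flagP[D [Da ->]] /coord_flagP[D' [Da' ->]].
by case: (below_chain Da Da') => [DD'|D'D]; [left|right]; exact: coord_space_sub.
Qed.

Lemma coord_space_inj l (D D' : set E) : injective (lin l) ->
  coord_space l D `<=` coord_space l D' -> D `<=` D'.
Proof.
move=> li DD' e De; have /DD' : coord_space l D (l e) by apply: mem_span; exists e.
rewrite (coord_space_lin l) => -[w /coord_spaceP wD].
rewrite -(lin_basis l) => /li E0; apply: wD.
by rewrite E0 coef_basis eqxx oner_neq0.
Qed.

Lemma coord_flag_generalized l s : bijective (lin l) ->
  (forall a, exists e, s e = a) -> generalized_flag (coord_flag l s).
Proof.
move=> lb ssurj; have li := bij_inj lb.
have cons a : consecutive (coord_flag l s) (flag_lo l s a) (flag_hi l s a).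
  split.
  - by left; exists a.
  - by right; exists a.
  - split; first by apply: coord_space_sub => e /ltW.
    move=> /(coord_space_inj li) hl; have [e ea] := ssurj a.
    by have := hl e; rewrite /= ea ltxx lexx => /(_ isT).
  - move=> _ /coord_flagP[D [Da ->]] /(coord_space_inj li) lD /(coord_space_inj li) Dh.
    have [[e De ea]|no] := pselect (exists2 e, D e & s e = a).
      right; congr coord_space; apply/seteqP; split=> // f fa.
      case: Da De lD Dh => c [] -> /=; rewrite ea.
        by move=> ac _ _; exact: le_lt_trans ac.
      by move=> ac _ _; exact: le_trans ac.
    left; congr coord_space; apply/seteqP; split=> // f Df.
    rewrite /= lt_neqAle (Dh f Df) andbT; apply/eqP => fa.
    by apply: no; exists f.
split.
- by move=> F /coord_flagP[D [_ ->]]; exact: span_subspace.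
- exact: coord_flag_chain.
- move=> F [] [a _ <-]; first by exists (flag_hi l s a); left.
  by exists (flag_lo l s a); right.
- move=> v v0; have [h hK Kh] := lb; pose w := h v.
  have [|||m mS mP] := @seq_min A (fun x y => y <= x)%O [seq s e | e <- supp w].
  + by move=> x y; exact: le_total.
  + by move=> y x z xy yz; exact: le_trans xy.
  + apply: contraNneq v0 => /(congr1 size); rewrite size_map => /size0nil w0.
    by rewrite -(Kh v) /lin -/w w0 big_nil.
  exists (flag_lo l s m), (flag_hi l s m); split; first exact: cons.
  rewrite /flag_lo /flag_hi !(coord_space_lin l); split.
    exists w; last exact: Kh.
    by apply/coord_spaceP => e we; apply: mP; apply: map_f; rewrite mem_supp.
  move=> [u /coord_spaceP um]; rewrite -(Kh v) -/w => /li uw; rewrite uw in um.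
  by case/mapP: mS => e; rewrite mem_supp => /um /= /[swap] ->; rewrite ltxx.
Qed.

Lemma coord_flag_isotropic l s : Gom omega b (lin l) ->
  (forall e, s (iE e) = iA (s e)) -> isotropic_flag omega (coord_flag l s).
Proof.
move=> Gl siE F FF; have [gb go] := (G_bij Gl, G_isom Gl).
have lo_ a : perp omega (flag_hi l s a) = flag_lo l s (iA a).
  by rewrite /flag_hi perp_coord_below.
have hi_ a : perp omega (flag_lo l s a) = flag_hi l s (iA a).
  rewrite /flag_lo /flag_hi (coord_space_lin l) perp_image // perp_coord.
  rewrite [RHS](coord_space_lin l); congr (_ @` coord_space _ _).
  apply/seteqP; split=> e /=; rewrite siE -iA_ge leNgt; first by move/negP.
  by move=> /negP.
case: FF => -[a _ <-]; rewrite ?lo_ ?hi_ ?lo_ ?hi_ iA_inv; split=> //.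
  by right; exists (iA a).
by left; exists (iA a).
Qed.

Lemma wtype_widen m n s : (m <= n)%N -> wtype (En m) s -> wtype (En n) s.
Proof.
move=> mn [siE s0 sc]; have mnP := fsubsetP (En_mono mn).
have s0n e : e \notin En n -> s e = sigma0 e.
  by move=> eI; apply: s0; apply: contraNN eI => /mnP.
split=> // a; rewrite (count_widen _ (En_mono mn)) sc.
rewrite [RHS](count_widen _ (En_mono mn)); congr (_ + _)%N; apply: eq_count => e.
by case: (boolP (e \in En m)) => eI; rewrite ?andbF // /below s0.
Qed.

Lemma utri_widen I J R l : (I `<=` J)%fset -> utri I R l -> utri J R l.
Proof.
move=> /fsubsetP IJ lu e; have [l1 lP] := lu e; split=> // j je /(lP _ je)[*].
by split=> //; exact: IJ.
Qed.

Lemma iflag_flag n H : iflag (En n) H -> exists s l, [/\ wtype (En n) s,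
  reduced (En n) s l, Gom omega b (lin l), H = hi_ l s & flag_from H = coord_flag l s].
Proof.
move=> /iflag_normal_form[s [l [sw lr li HE]]]; exists s, l.
have Gl := isom_G (utri_local lr) li.
have HE' : H = hi_ l s by apply/funext.
by split=> //; rewrite HE' coord_flagE //; case: sw.
Qed.

(* A member of a flag is determined by its behaviour outside E_n and its
   dimension in <E_n>. *)
Lemma flag_from_hi n m H F a : iflag (En n) H -> flag_from H F ->
  std (En m) (below sigma0 a) F -> F = H a.
Proof.
move=> Hf HF Fs; have [s [l [_ _ _ HE HE']]] := iflag_flag Hf.
have [Hs _ _] := Hf; have Fs' := std_widen (En_mono (leq_maxr n m)) Fs.
have Hs' := std_widen (En_mono (leq_maxl n m)) (Hs a).
have Ha : flag_from H (H a) by right; exists a.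
rewrite HE' in HF Ha; case: (coord_flag_chain HF Ha).
  exact: (std_sub_eq Fs' Hs').
by move=> HF'; apply/esym; exact: (std_sub_eq Hs' Fs').
Qed.

Definition sbelow s (a : A) : pred E := fun e => (s e < a)%O.

Lemma iflag_lo n H a : iflag (En n) H ->
  std (En n) (sbelow sigma0 a) (perp omega (H (iA a))).
Proof.
move=> Hf; have [s [l [sw lr Gl -> _]]] := iflag_flag Hf; have [siE s0 _] := sw.
rewrite perp_coord_below // iA_inv; apply: (@std_coord _ _ (sbelow s a)).
- exact: utri_local lr.
- exact: tri_inj (utri_tri lr).
- by move=> e eI; rewrite /sbelow s0.
- exact: wtype_count_lt.
Qed.

Lemma flag_from_inj n m H H' : iflag (En n) H -> iflag (En m) H' ->
  flag_from H = flag_from H' -> H = H'.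
Proof.
move=> Hf H'f HH'; apply/funext => a; have [Hs _ _] := Hf.
by apply: (flag_from_hi H'f _ (Hs a)); rewrite -HH'; right; exists a.
Qed.

Lemma hitP U e : U `&` borel_hi leB b e <> U `&` borel_lo leB b e <-> hit U e.
Proof.
have lo_hi : borel_lo leB b e `<=` borel_hi leB b e.
  by apply: coord_space_sub => f /ltBW.
split=> [ne|[v Uv [ve vmax]] E0]; last first.
  have : (U `&` borel_hi leB b e) v by split=> //; apply/coord_spaceP.
  by rewrite E0 => -[_ /coord_spaceP/(_ _ ve)]; rewrite /= ltB_irr.
apply: contrapT => no; apply: ne; apply/seteqP; split=> v [Uv ev]; split=> //.
  move/coord_spaceP: ev => ev; apply/coord_spaceP => f vf.
  have := ev f vf; rewrite /= leB_eqVlt => /predU1P[fe|//].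
  by case: no; exists v; rewrite // /leads -fe; split=> // j /ev; rewrite fe.
exact: lo_hi.
Qed.

Lemma rel_positionP H s : relative_position leB b H s <->
  forall e, hit (H (s e)) e /\ forall c, hit (H c) e -> (s e <= c)%O.
Proof.
split=> Hs e; have [H1 H2] := Hs e; split; do ?by apply/hitP.
- by move=> c /hitP; exact: H2.
- by move=> c /hitP; exact: H2.
Qed.

Lemma rel_position_uniq H s s' :
  relative_position leB b H s -> relative_position leB b H s' -> s = s'.
Proof.
move=> /rel_positionP Hs /rel_positionP Hs'; apply/funext => e.
have [[h1 m1] [h2 m2]] := (Hs e, Hs' e).
by apply/eqP; rewrite eq_le m1 // m2.
Qed.

Lemma tri_rel_position l s : tri l -> relative_position leB b (hi_ l s) s.
Proof.
move=> lt_; apply/rel_positionP => e; split; first by apply/hit_coord => /=.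
by move=> c /(hit_coord _ _ lt_).
Qed.

(** An element of B preserves F'_{0,e} and F''_{0,e}. A zero diagonal entry would put g (b e) into
    F'_{0,e}, the image of F'_{0,e}, against injectivity. *)
Lemma borel_tri g : B g -> tri (g \o b).
Proof.
move=> [Gg gF] e; have hiE : g @` borel_hi leB b e = borel_hi leB b e.
  by apply: gF; right; exists e.
have loE : g @` borel_lo leB b e = borel_lo leB b e by apply: gF; left; exists e.
have : borel_hi leB b e (g (b e)).
  by rewrite -hiE; exists (b e) => //; apply: mem_span; exists e => //=; exact: leB_refl.
move=> /coord_spaceP ghi; split=> //; apply/eqP => g0.
have : borel_lo leB b e (g (b e)).
  apply/coord_spaceP => j gj; rewrite /= /ltB ghi // andbT.
  by apply: contraNneq gj => ->; rewrite g0.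
rewrite -loE => -[v + /(bij_inj (G_bij Gg)) ve]; rewrite ve.
by move/coord_spaceP/(_ e); rewrite coef_basis eqxx oner_neq0 /= ltB_irr => /(_ isT).
Qed.

Lemma utri_borel I R l : utri I R l -> isom l -> B (lin l).
Proof.
move=> lu li; split; first exact: isom_G (utri_local lu) li.
move=> _ [] [e _ <-]; rewrite -coord_space_lin (utri_image lu) // => f g.
- by move=> /= fe gf; exact: ltB_trans fe.
- by move=> /= fe gf; apply: ltBW; exact: ltB_leB_trans fe.
Qed.

Lemma borel_G g : B g -> Gom omega b g. Proof. by case. Qed.

Lemma borel_iflag g k s : B g -> wtype (En k) s ->
  exists n, iflag (En n) (hi_ (g \o b) s) /\
            act g (coord_flag b s) = flag_from (hi_ (g \o b) s).
Proof.
move=> /borel_G Gg sw; have [m gm] := G_local Gg.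
exists (maxn k m); split.
  apply: wtype_iflag.
  - exact: wtype_widen (leq_maxl k m) sw.
  - exact: local_widen (En_mono (leq_maxr k m)) gm.
  - by move=> e f; exact: G_isom.
have gE : Gom omega b (lin (g \o b)) by rewrite -G_lin.
by rewrite act_coord_flag ?coord_flagE //; [case: sw|exact: G_linear].
Qed.

Lemma orbitP n k H s : iflag (En n) H -> wtype (En k) s ->
  orbit B (coord_flag b s) (flag_from H) <-> relative_position leB b H s.
Proof.
move=> Hf sw; split=> [[g Bg gE]|Hs].
  have [m [mf gE']] := borel_iflag Bg sw.
  have -> : H = hi_ (g \o b) s.
    by apply: (flag_from_inj Hf mf); rewrite -gE' -gE.
  exact/tri_rel_position/borel_tri.
have [t [l [tw lr Gl HE HE']]] := iflag_flag Hf.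
have ts : t = s.
  by apply: (rel_position_uniq _ Hs); rewrite HE; exact/tri_rel_position/utri_tri/lr.
exists (lin l); last by rewrite act_lin_coord_flag HE' ts.
by apply: utri_borel lr _ => e f; rewrite -[l e]lin_basis -[l f]lin_basis; exact: G_isom.
Qed.

(** * Commensurable flags *)

Local Notation FF := (coord_flag b sigma0).
Local Notation X := (Fl b omega FF).

Lemma En_ex2 I J : exists n, (I `<=` En n)%fset /\ (J `<=` En n)%fset.
Proof.
have [n] := En_cover (I `|` J)%fset; rewrite fsubUset => /andP[? ?].
by exists n.
Qed.

Lemma wtype_refl I : wtype I sigma0.
Proof. by []. Qed.

Lemma lin_basis_id : lin b = id.
Proof. by apply/funext => v; rewrite /lin -expand. Qed.

Lemma G_id : Gom omega b id.
Proof.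
split=> //; first by exists id.
by rewrite (_ : [set e | _] = set0) //; apply/seteqP; split=> // e /=.
Qed.

(** The finitely many b e missing from [l] lie in the span of the l j for j in a finite set s. If j
    is outside s and l j is no b e, then every b e is some other l k or lies in the span of s, so l
    j would be a combination of other members of [l]. *)
Lemma almost_basis_local (J : choiceType) (l : J -> V) : basis_of setT l ->
  finite_set [set e | ~ range l (b e)] ->
  exists I, forall j, fspan b I (l j) \/ exists e, l j = b e.
Proof.
move=> lb fE.
have [s sP] : exists s : {fset J}, forall e, ~ range l (b e) ->
    span (l @` [set` s]) (b e).
  have [r rE] := (finite_seqP _).1 fE.
  suff [s sP] : exists s : {fset J}, forall e, e \in r -> span (l @` [set` s]) (b e).
    by exists s => e le; apply: sP; have : [set` r] e by rewrite -rE.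
  elim: r {rE} => [|e r [s sr]]; first by exists fset0.
  have mono (s1 s2 : {fset J}) : (s1 `<=` s2)%fset ->
      span (l @` [set` s1]) `<=` span (l @` [set` s2]).
    move=> /fsubsetP s12; apply: span_min; first exact: span_subspace.
    by move=> _ [j /= js <-]; apply: mem_span; exists j => //=; exact: s12.
  have [s' s'e] : exists s' : {fset J}, span (l @` [set` s']) (b e).
    have : span (range l) (b e) by rewrite lb.1.
    apply: (span_ind (U := [set v | exists s' : {fset J}, span (l @` [set` s']) v])).
      split; first by exists fset0; exact: (span_subspace _).1.
      move=> a u v [s1 us1] [s2 vs2]; exists (s1 `|` s2)%fset.
      apply: (span_subspace _).2; first exact: mono (fsubsetUl _ _) _ us1.
      exact: mono (fsubsetUr _ _) _ vs2.
    move=> _ [j _ <-]; exists [fset j]%fset; apply: mem_span; exists j => //=.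
    by rewrite inE.
  exists (s `|` s')%fset => f; rewrite inE => /predU1P[->|/sr].
    exact: mono (fsubsetUr _ _) _ s'e.
  exact: mono (fsubsetUl _ _) _.
exists (\bigcup_(j <- s) supp (l j))%fset => j.
have [[e _ be]|nb] := pselect (range b (l j)); first by right; exists e.
left; have [js|js] := boolP (j \in s).
  apply/mem_fspan => e le; apply/bigfcupP; exists j; rewrite ?js //.
  by rewrite mem_supp.
case: (basis_notin_span (j := j) lb).
have : span (range b) (l j) by rewrite b_basis.1.
apply: (span_ind (span_subspace _)) => _ [e _ <-].
have [[k _ lk]|/sP] := pselect (range l (b e)).
  apply: mem_span; exists k => //= kj; apply: nb; exists e => //.
  by rewrite -lk kj.
apply: span_min; first exact: span_subspace.
move=> _ [k /= ks <-]; apply: mem_span; exists k => //= kj.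
by rewrite -kj ks in js.
Qed.

Lemma omega_off I u v : (forall e, e \in I -> iE e \in I) ->
  fspan b I v -> (forall e, coef u e != 0 -> e \notin I) -> omega u v = 0.
Proof.
move=> Ist /mem_fspan vI uI; rewrite omega_expand big1_seq // => e /andP[_].
rewrite mem_supp => /uI eI; have [->|/vI/Ist] := eqVneq (coef v (iE e)) 0.
  by rewrite mul0r mulr0.
by rewrite iE_inv (negPf eI).
Qed.

(** Rank and nullity: the part of a vector of [U] outside the stable set E_n is orthogonal to <E_n>,
    so orthogonality to [U] imposes at most dim (U ∩ <E_n>) conditions on <E_n>. *)
Lemma dim_perp n P U : std (En n) P U ->
  (size (En n) <= \dim (vs (En n) (perp omega U)) + count P (En n))%N.
Proof.
move=> Us; have [sU _ UP dU] := Us.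
have sUI : subspace (U `&` fspan b (En n)) by exact/subspaceI/fspan_subspace.
have [l0 l0b] : has_dim (U `&` fspan b (En n)) (count P (En n)).
  apply/(has_dimP (I := En n) _ sUI) => [v []//|].
  by rewrite -dU; congr (\dim _); apply: eq_vs => //; rewrite -setIA setIid.
have [_ l0U _] := (basis_ofP l0 sUI).1 l0b.
pose f (r : 'rV[K]_(size (En n))) : 'rV[K]_(count P (En n)) :=
  \row_i omega (l0 i) (vec r).
have lf : linear f.
  move=> a u v; apply/rowP => i; rewrite !mxE vec_linear linearDr omegaZr.
  by [].
pose fl : {linear 'rV[K]_(size (En n)) -> 'rV[K]_(count P (En n))} :=
  HB.pack f (GRing.isLinear.Build _ _ _ _ f lf).
have := limg_ker_dim (linfun fl) fullv.
rewrite capfv dimvf dim_matrix -[X in _ = X]/(1 * size (En n))%N mul1n => dE.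
rewrite -[X in (X <= _)%N]dE; apply: leq_add; last first.
  apply: leq_trans (dimvS (subvf _)) _; rewrite dimvf dim_matrix.
  by rewrite -[X in (X <= _)%N]/(1 * count P (En n))%N mul1n.
apply/dimvS/subvP => r; rewrite memv_ker lfunE /= => /eqP fr.
apply/mem_vs; first exact: perp_subspace.
move=> u Uu; rewrite -[u](subrK (restr (En n) u)) linearDl /=.
rewrite (omega_off (I := En n)) ?add0r; last 3 first.
- exact: En_stable.
- exact: vec_fspan.
- move=> e; rewrite coefB coef_restr; case: ifPn => //.
  by rewrite subrr eqxx.
have [c ->] : exists c, restr (En n) u = \sum_i c i *: l0 i.
  apply: l0U; split; last exact: restr_fspan.
  by apply: (mem_restr Us _).1 => // e; exact: UP.
rewrite omega_suml big1 // => i _; rewrite omegaZl.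
by move/rowP: fr => /(_ i); rewrite !mxE => ->; rewrite mulr0.
Qed.

(** The index n is chosen so that <E_n> contains [U] and every l j that is not some b e. If b e,
    with e outside E_n, lies in F but is not one of the l j spanning phi F, then the coordinate e
    vanishes on phi F + U = F + U, which contains b e. *)
Lemma commensurable_std GG phi : weakly_compatible b GG ->
  commensurable_via phi FF GG -> exists n, forall P,
    FF (coord_space b [set e | P e]) ->
    std (En n) P (phi (coord_space b [set e | P e])).
Proof.
move=> [J [l [lb fE [d' [A' [s' [_ GGE]]]]]]] [bij mono [U [[k Uk] phiU]]].
have [I Il] := almost_basis_local lb fE.
have [I' UI'] := has_dim_fspan Uk; have sU := has_dim_subspace Uk.
have [n [/fsubsetP In /fsubsetP I'n]] := En_ex2 I I'.
have UI : U `<=` fspan b (En n) by move=> v /UI'/mem_fspan vI; apply/mem_fspan => e /vI/I'n.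
have lI j : fspan b (En n) (l j) \/ exists e, l j = b e.
  case: (Il j) => [/mem_fspan lj|]; last by right.
  by left; apply/mem_fspan => e /lj/In.
have U0 u e : U u -> e \notin En n -> coef u e = 0.
  by move=> /UI/mem_fspan uI eI; apply/eqP; apply: contraNT eI => /uI.
exists n => P FP; set F := coord_space b _ in FP *.
have [addE dimE] := phiU _ FP.
have sF : subspace F by exact: span_subspace.
have [Q phiE] : exists Q : set J, phi F = coord_space l Q.
  have [phiG _ _] := bij; have := phiG _ FP; rewrite GGE.
  by case=> -[a _ <-]; [exists [set j | s' j < a]%O|exists [set j | s' j <= a]%O].
have sphi : subspace (phi F) by rewrite phiE; exact: span_subspace.
split=> //.
- move=> e eI Pe.
  have : addsp (phi F) U (b e).
    rewrite addE; exists (b e); first by apply: mem_span; exists e.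
    by exists 0; [exact: sU.1|rewrite addr0].
  move=> [v phiv [u Uu vu]].
  have [[k' Qk' lk]|no] := pselect (exists2 k, Q k & l k = b e).
    by rewrite phiE; apply: mem_span; exists k'.
  suff v0 : coef v e = 0.
    move/(congr1 (coef^~ e))/eqP: vu; rewrite coefD v0 (U0 u e) // addr0.
    by rewrite coef_basis eqxx eq_sym oner_eq0.
  move: phiv; rewrite phiE; apply: (span_ind (U := [set v | coef v e = 0])).
    split=> [|a x y /= x0 y0]; first exact: coef0.
    by rewrite coefB_lin x0 y0 mulr0 addr0.
  move=> _ [j Qj <-] /=; case: (lI j) => [/mem_fspan lj|[f lf]].
    by apply/eqP; apply: contraNT eI => /lj.
  rewrite lf coef_basis; case: eqVneq => // ef.
  by case: no; exists j; rewrite // lf ef.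
- move=> v e phiv eI ve.
  have : addsp F U v.
    rewrite -addE; exists v => //.
    by exists 0; [exact: sU.1|rewrite addr0].
  move=> [f /coord_spaceP fP [u Uu fu]]; apply: fP.
  by rewrite -fu coefD (U0 u e) // addr0 in ve.
- have sI := fspan_subspace (En n).
  have sphiI := subspaceI sphi sI; have sFI := subspaceI sF sI.
  (* As [U] lies in <E_n>, the traces of phi F and F have the same sum with [U]. Their intersections
     with [U] have equal dimensions by commensurability, hence so do the traces. *)
  have E1 : addsp (phi F `&` fspan b (En n)) U = addsp (F `&` fspan b (En n)) U.
    have half F1 F2 : addsp F1 U `<=` addsp F2 U ->
        addsp (F1 `&` fspan b (En n)) U `<=` addsp (F2 `&` fspan b (En n)) U.
      move=> F12 _ [v [Fv vI] [u Uu <-]].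
      have [v' Fv' [u' Uu' E0]] : addsp F2 U (v + u) by apply: F12; exists v => //; exists u.
      exists v'; last by exists u'.
      split=> //; have -> : v' = v + u - u' by rewrite -E0 addrK.
      apply: (subspaceB sI); last exact: UI.
      by apply: (subspaceD sI) => //; exact: UI.
    by apply/seteqP; split; apply: half; rewrite addE.
  have := congr1 (fun S => \dim (vs (En n) S)) E1.
  rewrite /= !vsD //; do ?by move=> v [].
  have c1 : vs (En n) (phi F `&` fspan b (En n)) = vs (En n) (phi F).
    by apply: eq_vs => //; rewrite -setIA setIid.
  have c2 : vs (En n) (F `&` fspan b (En n)) = vs (En n) F.
    by apply: eq_vs => //; rewrite -setIA setIid.
  rewrite c1 c2 => E2.
  have E3 : \dim (vs (En n) (phi F) :&: vs (En n) U) = \dim (vs (En n) F :&: vs (En n) U).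
    rewrite -!vsI //; have [k' k1 k2] := dimE.
    have s1 : phi F `&` U `<=` fspan b (En n) by move=> v [_ /UI].
    have s2 : F `&` U `<=` fspan b (En n) by move=> v [_ /UI].
    rewrite ((has_dimP _ (subspaceI sphi sU) s1).1 k1).
    by rewrite ((has_dimP _ (subspaceI sF sU) s2).1 k2).
  have := dimv_sum_cap (vs (En n) (phi F)) (vs (En n) U).
  rewrite E2 E3 dimv_sum_cap => /addIn <-.
  exact: dim_vs_coord.
Qed.

Lemma commensurable_iflag GG phi : X GG -> commensurable_via phi FF GG ->
  exists n, iflag (En n) (phi \o flag_hi b sigma0) /\
            GG = flag_from (phi \o flag_hi b sigma0).
Proof.
move=> [[Gsub Gchain _ _] Giso [_ wG _]] via.
have [n stdn] := commensurable_std wG via; have [bij mono _] := via.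
have FFhi a : FF (flag_hi b sigma0 a) by right; exists a.
have FFlo a : FF (flag_lo b sigma0 a) by left; exists a.
have [phiG _ phisur] := bij.
have Ghi a : GG (phi (flag_hi b sigma0 a)) by exact: phiG.
have Hs a : std (En n) (below sigma0 a) (phi (flag_hi b sigma0 a)).
  by apply: (stdn (below sigma0 a)); exact: FFhi.
have Ls a : std (En n) (sbelow sigma0 a) (phi (flag_lo b sigma0 a)).
  by apply: (stdn (sbelow sigma0 a)); exact: FFlo.
exists n; suff Hf : iflag (En n) (phi \o flag_hi b sigma0).
  split=> //.
  have loE a : phi (flag_lo b sigma0 a) =
      perp omega ((phi \o flag_hi b sigma0) (iA a)).
    have Gp : GG (perp omega (phi (flag_hi b sigma0 (iA a)))).
      by case: (Giso _ (Ghi (iA a))).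
    have Ps := iflag_lo a Hf.
    case: (Gchain _ _ (phiG _ (FFlo a)) Gp) => sub.
      exact: (std_sub_eq (Ls a) Ps).
    by apply/esym; exact: (std_sub_eq Ps (Ls a)).
  apply/seteqP; split=> F.
    move=> /phisur[F' [] [a _ <-] <-]; last by right; exists a.
    by left; exists a; rewrite ?loE.
  by case=> -[a _ <-]; rewrite -?loE; exact: phiG.
split=> // [a c ac|a c u v ca Hu Hv].
  apply/(mono _ _ (FFhi a) (FFhi c)); exact: coord_space_mono.
have [Gp _] := Giso _ (Ghi a).
(* In a chain, H c lies in the orthogonal of H a or contains it. In the second case [dim_perp]
   forces the traces on <E_n> to agree, and outside E_n the supports cannot pair because c < iA
   a. *)
case: (Gchain _ _ (Ghi c) Gp) => [|pH]; first by move=> /(_ v Hv); apply.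
have [sH _ HP dH] := Hs c; have [_ _ HPa _] := Hs a.
have /eqP E0 : vs (En n) (perp omega (phi (flag_hi b sigma0 a))) ==
               vs (En n) (phi (flag_hi b sigma0 c)).
  rewrite eqEdim; apply/andP; split.
    by apply/sub_vs => // [|w [/pH]//]; exact: perp_subspace.
  have := dim_perp (Hs a); rewrite dH addnC -leq_subLR; apply: leq_trans.
  rewrite -(count_predC (below sigma0 a)) addKn.
  apply: leq_trans (_ : count (sbelow sigma0 (iA a)) (En n) <= _)%N.
    by apply: leq_count_in => e _ /= ec; exact: le_lt_trans ca.
  rewrite -count_iE; apply: leq_count_in => e _.
  by rewrite /sbelow sigma0_iso iA_lt /= /below ltNge.
rewrite -[v](subrK (restr (En n) v)) linearDr /=.
have -> : omega u (v - restr (En n) v) = 0.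
  rewrite omega_expand big1_seq // => e /andP[_]; rewrite mem_supp => ue.
  have [->|] := eqVneq (coef (v - restr (En n) v) (iE e)) 0.
    by rewrite mul0r mulr0.
  rewrite coefB coef_restr; case: ifPn => ei; first by rewrite subrr eqxx.
  rewrite subr0 => vi; have := HP _ _ Hv ei vi.
  rewrite En_iE in ei; have := HPa _ _ Hu ei ue.
  rewrite /below sigma0_iso -iA_anti => h1 /(le_trans h1).
  by rewrite leNgt ca.
rewrite add0r.
suff : perp omega (phi (flag_hi b sigma0 a)) (restr (En n) v) by apply.
have := (sub_vs (En n) sH (perp_subspace (phi (flag_hi b sigma0 a)))).2.
rewrite E0; apply=> //; split; last exact: restr_fspan.
by apply: (mem_restr (Hs c) _).1 => // e; exact: HP.
Qed.

(** * The Weyl group and the decomposition into orbits *)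

Lemma basis_of_image (g : V -> V) : linear g -> bijective g ->
  basis_of setT (g \o b).
Proof.
move=> lg gb; split.
  have -> : range (g \o b) = g @` range b by rewrite image_comp.
  rewrite -(image_span _ lg) b_basis.1.
  by have [h gK hK] := gb; apply/seteqP; split=> // v _; exists (h v).
move=> s c c0; apply: b_basis.2; apply: (bij_inj gb).
rewrite [RHS](linear_apply0 lg) -[RHS]c0 linear_apply_sum //.
by apply: eq_bigr => e _; rewrite linear_applyZ.
Qed.

Lemma coord_flag_std F : FF F -> exists P, F = coord_space b [set e | P e].
Proof.
by case=> -[a _ <-]; [exists (sbelow sigma0 a)|exists (below sigma0 a)].
Qed.

Lemma act_commensurable_via g : Gom omega b g ->
  commensurable_via (image^~ g) FF (act g FF).
Proof.
move=> Gg; have [lg gi] := (G_linear Gg, bij_inj (G_bij Gg)); split.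
- split=> [F FF_|F F' _ _ E0|_ [F FF_ <-]]; [by exists F| |by exists F].
  by apply/seteqP; split=> v Fv;
    [have : (g @` F') (g v) by rewrite -E0; exists v
    |have : (g @` F) (g v) by rewrite E0; exists v]; case=> u Fu /gi <-.
- move=> F F' _ _; split=> [FF' _ [v Fv <-]|gFF' v Fv].
    by exists v => //; exact: FF'.
  have [|u Fu /gi <-//] := gFF' (g v).
  by exists v.
have [n gn] := G_local Gg; have sI := fspan_subspace (En n).
exists (fspan b (En n)); split.
  by exists (size (En n)); exact: has_dim_fspanP.
(* The finite-dimensional space required by commensurability is <E_n>, because g is the identity
   modulo <E_n>. *)
have gI v : fspan b (En n) (g v - v).
  apply/mem_fspan => e; apply: contraR => eI; rewrite coefB.
  by rewrite (G_lin Gg) (local_coef _ gn) // subrr.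
have gV u v : fspan b (En n) u -> fspan b (En n) (g v - v + u).
  by move=> uI; exact: (subspaceD sI).
move=> F /coord_flag_std[P ->]; split.
  apply/seteqP; split=> _ [v Fv [u Iu <-]].
    case: Fv => w Fw <-; exists w => //; exists (g w - w + u); first exact: gV.
    by rewrite addrA addrCA subrr addr0.
  exists (g v); first by exists v.
  exists (- (g v - v) + u); last by rewrite addrA opprB addrCA subrr addr0.
  by apply: (subspaceD sI) => //; rewrite -scaleN1r; exact: (subspaceZ _ sI).
exists (count P (En n)); last exact: has_dim_coord.
rewrite (_ : _ `&` _ = g @` (coord_space b [set e | P e] `&` fspan b (En n))).
  by apply: has_dim_image => //; exact: has_dim_coord.
rewrite (G_lin Gg); apply/seteqP; split=> [_ [[v Pv <-] vI]|_ [v [Pv vI] <-]].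
  by exists v => //; split=> //; exact: local_fspan_eq vI.
by split; [exists v|exact: local_fspan].
Qed.

Lemma G_flag g : Gom omega b g -> X (act g FF).
Proof.
move=> Gg; have lg := G_linear Gg.
have gE : Gom omega b (lin (g \o b)) by rewrite -G_lin.
split.
- rewrite act_coord_flag //; apply: coord_flag_generalized; last exact: sigma0_surj.
  exact: G_bij gE.
- by rewrite act_coord_flag //; exact: coord_flag_isotropic.
split; last by exists (image^~ g); exact: act_commensurable_via.
  exists E, b; split=> //; last by exists d, A, sigma0.
  by rewrite (_ : [set e | _] = set0) //; apply/seteqP; split=> // e /= []; exists e.
exists E, (g \o b); split.
- exact: (basis_of_image lg (G_bij Gg)).
- case: Gg => _ _ _; apply: sub_finite_set => e /= ng ge; apply: ng; exists e => //.
- by rewrite act_coord_flag //; exists d, A, sigma0.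
Qed.

Lemma transp_omE e f x : e <> f -> iE e <> e -> iE f <> f ->
  transp_om iE e f x = if x == e then f else if x == f then e else
    if x == iE e then iE f else if x == iE f then iE e else x.
Proof.
move=> /eqP ef /eqP ee /eqP ff; rewrite /transp_om /transp.
have [->|fe] := eqVneq f (iE e); rewrite /= ?iE_inv.
  by case: eqP => // _; case: eqP.
have fe' : iE f != e by apply: contraNneq fe => <-; rewrite iE_inv.
have [->|xe] := eqVneq x (iE e).
  by rewrite (negPf fe') (negPf ff) (negPf ee) [iE e == f]eq_sym (negPf fe).
have [E1|xf] := eqVneq x (iE f); last by [].
by rewrite E1 (negPf fe') (negPf ff) (negPf ee) [iE e == f]eq_sym (negPf fe).
Qed.

Lemma transp_om4 e f : e <> f -> iE e <> e -> iE f <> f -> f <> iE e ->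
  uniq [:: e; f; iE e; iE f].
Proof.
move=> /eqP ef /eqP ee /eqP ff /eqP fe; rewrite /= !inE !negb_or.
rewrite ef [e == iE e]eq_sym ee fe [f == iE f]eq_sym ff.
rewrite (inj_eq (inv_inj iE_inv)) ef !andbT.
by apply: contraNneq fe => ->; rewrite iE_inv.
Qed.

Lemma transp_omK e f : e <> f -> iE e <> e -> iE f <> f ->
  involutive (transp_om iE e f).
Proof.
move=> ef ee ff x; have [fe|/eqP fe] := eqVneq f (iE e).
  rewrite /transp_om fe eqxx /transp; have [->|xe] := eqVneq x e.
    by rewrite (negPf (introN eqP ee)) eqxx.
  by have [->|xf] := eqVneq x (iE e); rewrite ?eqxx // (negPf xe) (negPf xf).
have := transp_om4 ef ee ff fe; rewrite /= !inE !negb_or !andbT.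
case/and3P=> /and3P[n1 n2 n3] /andP[n4 n5] n6; rewrite !transp_omE //.
have [->|xe] := eqVneq x e; first by rewrite [f == e]eq_sym (negPf n1) eqxx.
have [->|xf] := eqVneq x f; first by rewrite eqxx.
have [->|x1] := eqVneq x (iE e).
  by rewrite ![iE f == _]eq_sym (negPf n3) (negPf n5) (negPf n6) eqxx.
have [->|x2] := eqVneq x (iE f).
  by rewrite ![iE e == _]eq_sym (negPf n2) (negPf n4) eqxx.
by rewrite (negPf xe) (negPf xf) (negPf x1) (negPf x2).
Qed.

Lemma transp_om_iE e f x : e <> f -> iE e <> e -> iE f <> f ->
  transp_om iE e f (iE x) = iE (transp_om iE e f x).
Proof.
move=> ef ee ff; rewrite !transp_omE // !(inj_eq (inv_inj iE_inv)).
have iEq y z : (iE y == z) = (y == iE z) by rewrite -(inj_eq (inv_inj iE_inv)) iE_inv.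
rewrite !iEq; have [fe|/eqP fe] := eqVneq f (iE e).
  rewrite fe !iE_inv; have [->|xe] := eqVneq x e.
    by rewrite iE_inv [e == _]eq_sym (negPf (introN eqP ee)).
  by have [E0|xf] := eqVneq x (iE e); rewrite ?iE_inv // !if_same.
have := transp_om4 ef ee ff fe; rewrite /= !inE !negb_or !andbT.
case/and3P=> /and3P[n1 n2 n3] /andP[n4 n5] n6.
have [->|xe] := eqVneq x e; first by rewrite (negPf n2) (negPf n3).
have [->|xf] := eqVneq x f; first by rewrite (negPf n4) (negPf n5).
by have [E1|x1] := eqVneq x (iE e); have [E2|x2] := eqVneq x (iE f); rewrite ?iE_inv.
Qed.

Lemma transp_om_out e f x n : e <> f -> iE e <> e -> iE f <> f ->
  e \in En n -> f \in En n -> x \notin En n -> transp_om iE e f x = x.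
Proof.
move=> ef ee ff en fn xn; rewrite transp_omE //.
have nx y : y \in En n -> (x == y) = false by move=> yn; apply/eqP => E0; rewrite E0 yn in xn.
by rewrite !nx ?En_iE.
Qed.

Lemma transp_om_En e f x n : e <> f -> iE e <> e -> iE f <> f ->
  e \in En n -> f \in En n -> (transp_om iE e f x \in En n) = (x \in En n).
Proof.
move=> ef ee ff en fn; have [xn|xn] := boolP (x \in En n); last first.
  by rewrite (transp_om_out (n := n)) // (negPf xn).
rewrite transp_omE //; do ?case: ifP => _; by rewrite ?En_iE.
Qed.

Lemma count_transp e f n P : e <> f -> iE e <> e -> iE f <> f ->
  e \in En n -> f \in En n ->
  count (fun x => P (transp_om iE e f x)) (En n) = count P (En n).
Proof.
move=> ef ee ff en fn; rewrite -(count_map (transp_om iE e f) P).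
apply/permP/uniq_perm.
- by rewrite map_inj_uniq ?fset_uniq //; exact/inv_inj/transp_omK.
- exact: fset_uniq.
move=> x; apply/mapP/idP => [[y yn ->]|xn]; first by rewrite transp_om_En.
by exists (transp_om iE e f x); rewrite ?transp_omK ?transp_om_En.
Qed.

Lemma wtype_transp e f n s : wtype (En n) s -> e <> f -> iE e <> e -> iE f <> f ->
  e \in En n -> f \in En n -> wtype (En n) (s \o transp_om iE e f).
Proof.
move=> [siE s0 sc] ef ee ff en fn; split=> [x|x xn|a].
- by rewrite /= transp_om_iE.
- by rewrite /= (transp_om_out ef ee ff en fn xn) s0.
- by rewrite -sc; exact: (count_transp (below s a) ef ee ff en fn).
Qed.

Lemma weyl_transp e f : e <> f -> iE e <> e -> iE f <> f ->
  weyl iE (transp_om iE e f).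
Proof.
move=> ef ee ff; split.
- by exists (transp_om iE e f); exact: transp_omK.
- have [n nP] := En_cover_seq [:: e; f].
  apply: (@sub_finite_set _ _ [set` En n]); last exact: finite_fset.
  move=> x /= tx; apply: contraT => xn; case: tx.
  by apply: (transp_om_out (n := n)) => //; apply: nP; rewrite !inE eqxx ?orbT.
- by move=> x; exact: transp_om_iE.
Qed.

Lemma winvP w : weyl iE w -> cancel (winv w) w /\ cancel w (winv w).
Proof.
move=> [wb _ _]; have [h wK hK] := wb.
have K1 : cancel (winv w) w.
  move=> e; rewrite /winv; apply: (xgetPex e (P := [set f | w f = e])).
  by exists (h e); rewrite /= hK.
by split=> // e; apply: (bij_inj wb); rewrite K1.
Qed.

Lemma winv_uniq w h : weyl iE w -> cancel h w -> winv w = h.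
Proof.
move=> ww hK; apply/funext => e; have [wK _] := winvP ww.
by have [wb _ _] := ww; apply: (bij_inj wb); rewrite wK hK.
Qed.

Lemma weyl_comp w w' : weyl iE w -> weyl iE w' -> weyl iE (w \o w').
Proof.
move=> [wb wf wi] [w'b w'f w'i]; split.
- exact: bij_comp.
- apply: (@sub_finite_set _ _ ([set e | w e <> e] `|` [set e | w' e <> e])).
    move=> e /= we; have [e0|] := pselect (w' e = e); last by right.
    by left=> /= we0; apply: we; rewrite e0.
  by rewrite finite_setU.
- by move=> e /=; rewrite w'i wi.
Qed.

Lemma weyl_winv w : weyl iE w -> weyl iE (winv w).
Proof.
move=> ww; have [K1 K2] := winvP ww; have [wb wf wi] := ww; split.
- by exists w.
- apply: sub_finite_set wf => e /= we we0; apply: we.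
  by rewrite -{1}we0 K2.
- by move=> e; apply: (bij_inj wb); rewrite wi !K1.
Qed.

Lemma weyl_id : weyl iE id.
Proof.
split=> //; first by exists id.
by rewrite (_ : [set e | _] = set0) //; apply/seteqP; split=> // e /=.
Qed.

Lemma winv_id : winv (@id E) = id.
Proof. exact: (winv_uniq weyl_id). Qed.

Lemma count_value I s s' a : (forall c, count (below s c) I = count (below s' c) I) ->
  count (fun e => s e == a) I = count (fun e => s' e == a) I.
Proof.
have split_below r : (count (below r a) I = count (fun e => r e < a)%O I +
    count (fun e => r e == a) I)%N.
  rewrite -count_predUI [X in (_ + X)%N](@eq_count _ _ pred0) ?count_pred0 ?addn0.
    by apply: eq_count => e; rewrite /= /below le_eqVlt orbC.
  by move=> e /=; case: ltgtP.
move=> ss'; apply/eqP; rewrite -(eqn_add2l (count (fun e => s e < a)%O I)).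
by rewrite -split_below (count_lt a ss') -split_below ss'.
Qed.

Lemma iA_fixed_uniq a c : iA a = a -> iA c = c -> a = c.
Proof.
have half x y : iA x = x -> iA y = y -> (x <= y)%O -> x = y.
  move=> xx yy xy; apply/eqP; rewrite eq_le xy /=.
  by have := xy; rewrite -{1}xx -{1}yy iA_anti.
move=> aa cc; have [ac|/ltW ca] := leP a c; first exact: half.
by apply/esym; exact: half.
Qed.

Lemma wtype_fixed n n' s t e : wtype (En n) s -> wtype (En n') t ->
  iE e = e -> s e = t e.
Proof.
by move=> [siE _ _] [tiE _ _] ee; apply: iA_fixed_uniq; rewrite -?siE -?tiE ee.
Qed.

(* A transposition moves a prescribed value to a prescribed place. *)
Lemma wtype_weyl n s t : wtype (En n) s -> wtype (En n) t ->
  exists2 w, weyl iE w & t = s \o winv w.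
Proof.
move=> sw tw; have [m] := ubnP (count (fun e => s e != t e) (En n)).
elim: m s sw => // m IHm s sw; rewrite ltnS => sm.
have [siE s0 sc] := sw; have [tiE t0 tc] := tw.
have [[e en st]|no] := pselect (exists2 e, e \in En n & s e != t e); last first.
  exists id; first exact: weyl_id.
  rewrite winv_id.
  apply/funext => e; have [en|en] := boolP (e \in En n); last by rewrite /= s0 // t0.
  by apply/esym/eqP; apply: contrapT => /negP st; apply: no; exists e.
have nofix x : s x != t x -> iE x <> x.
  by move=> sx xx; rewrite (wtype_fixed sw tw xx) eqxx in sx.
(* The maps s and t take the value t e equally often on E_n. If every place where s has this value
   were correct, all places where t has it would be exhausted, e among them. *)
have [f fn [fa ft]] : exists2 f, f \in En n & s f = t e /\ s f != t f.
  apply: contrapT => no; move/negP: st; apply.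
  apply: (@count_sub_eq _ (En n) (fun x => s x == t e) (fun x => t x == t e)) => //.
    move=> x xn /eqP xe; apply: contraT => tx; case: no; exists x => //.
    by rewrite xe eq_sym.
  by rewrite (@count_value _ s t) // => c; rewrite sc tc.
have [ee ff] := (nofix _ st, nofix _ ft).
have ef : e <> f by move=> E0; rewrite -E0 in fa; rewrite fa eqxx in st.
have sw' := wtype_transp sw ef ee ff en fn.
have [|w ww tE] := IHm _ sw'.
  apply: leq_trans sm; apply: (@ltn_count_in _ _ _ _ e) => //; last first.
    by rewrite /= transp_omE // eqxx fa eqxx.
  move=> x xn; rewrite /= transp_omE //.
  have [->|xe] := eqVneq x e; first by rewrite fa eqxx.
  have [->|xf] := eqVneq x f; first by move=> _.
  have [->|x1] := eqVneq x (iE e); first by rewrite siE tiE fa eqxx.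
  have [->|//] := eqVneq x (iE f).
  by move=> _; rewrite siE tiE (inj_eq (inv_inj iA_inv)).
have wt := weyl_transp ef ee ff; have tK := transp_omK ef ee ff.
exists (w \o transp_om iE e f); first exact: weyl_comp.
rewrite tE; have -> : winv (w \o transp_om iE e f) = transp_om iE e f \o winv w.
  apply: winv_uniq; first exact: weyl_comp.
  by move=> x /=; rewrite tK (winvP ww).1.
by [].
Qed.

Lemma weyl_orbitP s : weyl_orbit iE sigma0 s <-> exists n, wtype (En n) s.
Proof.
split=> [[w ww <-]|[n sw]]; last first.
  by have [w ww ->] := wtype_weyl (wtype_refl (En n)) sw; exists w.
have [K1 K2] := winvP ww; have [wb wf wi] := weyl_winv ww.
have [n nP] := En_cover (fset_set [set e | winv w e <> e]).
have nw e : e \notin En n -> winv w e = e.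
  move=> en; apply: contrapT => we; move/negP: en; apply; apply: (fsubsetP nP).
  by rewrite in_fset_set // inE.
have mw e : (winv w e \in En n) = (e \in En n).
  apply/idP/idP => [|en].
    by apply: contraLR => en; rewrite nw.
  apply: contraLR en => wn; have := nw _ wn => /(bij_inj wb) E0.
  by rewrite -E0.
exists n; split=> [e|e /nw /= -> //|a]; first by rewrite /= wi sigma0_iso.
rewrite -(count_map (winv w) (below sigma0 a)); apply/permP/uniq_perm.
- by rewrite map_inj_uniq ?fset_uniq //; exact: bij_inj wb.
- exact: fset_uniq.
move=> x; apply/mapP/idP => [[y yn ->]|xn]; first by rewrite mw.
by exists (w x); rewrite ?K2 // -mw K2.
Qed.

Lemma weyl_lift w : weyl iE w -> exists2 g, Gom omega b g &
  forall e, exists2 c, c != 0 & g (b e) = c *: b (w e).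
Proof.
move=> ww; have [wb wf wi] := ww; have [sg sg1 sgE] := omega_sign.
pose c e := if lt e (iE e) then eps e / eps (w e) else 1.
have c0 e : c e != 0.
  by rewrite /c; case: ifP; rewrite ?oner_neq0 // mulf_neq0 ?invr_neq0 ?eps_neq0.
pose l e := c e *: b (w e).
have epsiE e : eps (iE e) = sg * eps e by rewrite /eps iE_inv sgE.
have sg0 : sg != 0.
  by apply: contra_eq_neq sg1 => ->; rewrite mul0r eq_sym oner_neq0.
have l_isom : isom l.
  move=> e f; rewrite /l omegaZl omegaZr; have [->|/eqP fe] := eqVneq f (iE e); last first.
    by rewrite !b_isotropic ?mulr0 // -wi => /(bij_inj wb).
  rewrite wi -/(eps (w e)) -/(eps e) mulrA /c iE_inv.
  have [le|ge] := boolP (lt e (iE e)).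
    rewrite ltBNge (ltBW le) mulr1 mulfVK //.
    exact: eps_neq0.
  have [ie|ie] := boolP (lt (iE e) e).
    rewrite mul1r wi !epsiE -mulf_div divff // mul1r mulfVK //.
    exact: eps_neq0.
  rewrite !mul1r; have ee : iE e = e.
    by rewrite !ltBNge !negbK in ge ie; apply: leB_anti; rewrite ge ie.
  case: omega_sym => [[_ [x [_ xP]]]|[_ /(_ e)]//].
  suff -> : w e = e by [].
  by transitivity x; [apply/esym|]; apply: xP => //; rewrite -wi ee.
have fl : finite_set [set e | l e <> b e].
  apply: sub_finite_set wf => e /= le we; apply: le.
  by rewrite /l /c we divff ?eps_neq0 // if_same scale1r.
have [n ln] := finite_local fl.
exists (lin l); first exact: isom_G ln l_isom.
by move=> e; exists (c e); rewrite ?lin_basis.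
Qed.

Lemma weyl_flag w : weyl iE w -> exists2 g, Gom omega b g &
  act g FF = coord_flag b (sigma0 \o winv w).
Proof.
move=> ww; have [g Gg gw] := weyl_lift ww; exists g => //.
have [K1 K2] := winvP ww.
rewrite act_coord_flag; last exact: G_linear.
have E1 (D : set E) : coord_space (g \o b) D = coord_space b [set e | D (winv w e)].
  apply/seteqP; split; apply: span_min; do ?exact: span_subspace.
    move=> _ [e De <-] /=; have [c _ ->] := gw e.
    apply: (subspaceZ _ (span_subspace _)); apply: mem_span; exists (w e) => //=.
    by rewrite K2.
  move=> _ [e De <-]; have [c c0 ge] := gw (winv w e).
  have -> : b e = c^-1 *: g (b (winv w e)) by rewrite ge scalerA mulVf // scale1r K1.
  apply: (subspaceZ _ (span_subspace _)); apply: mem_span.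
  by exists (winv w e).
by congr flag_of; apply/funext => a; rewrite /flag_lo /flag_hi E1.
Qed.

Lemma act_comp (g h : V -> V) (F : set (set V)) : act (g \o h) F = act g (act h F).
Proof. by rewrite /act image_comp; congr image; apply/funext => U; rewrite /= -image_comp. Qed.

Lemma orbit_Fl s GG : weyl_orbit iE sigma0 s -> orbit B (coord_flag b s) GG -> X GG.
Proof.
move=> [w ww <-] [g /borel_G Gg <-]; have [h Gh <-] := weyl_flag ww.
by rewrite -act_comp; apply: G_flag; exact: G_comp.
Qed.

Lemma Fl_iflag GG : X GG -> exists n H, iflag (En n) H /\ GG = flag_from H.
Proof.
move=> GX; have [_ _ [_ _ [phi via]]] := GX.
by have [n [Hf HE]] := commensurable_iflag GX via; exists n, (phi \o flag_hi b sigma0).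
Qed.

Lemma iflag_orbit n H : iflag (En n) H -> exists s, [/\ wtype (En n) s,
  weyl_orbit iE sigma0 s & orbit B (coord_flag b s) (flag_from H)].
Proof.
move=> Hf; have [s [l [sw lr Gl HE _]]] := iflag_flag Hf; exists s; split=> //.
  by apply/weyl_orbitP; exists n.
apply/(orbitP Hf sw); rewrite HE; exact/tri_rel_position/utri_tri/lr.
Qed.

Lemma iflag_Fl n H : iflag (En n) H -> X (flag_from H).
Proof. by move=> /iflag_orbit[s [_ sW]]; exact: orbit_Fl. Qed.

Lemma Fl_G_orbit : [set act g FF | g in Gom omega b] = X.
Proof.
apply/seteqP; split=> [_ [g Gg <-]|GG /Fl_iflag[n [H [Hf ->]]]]; first exact: G_flag.
have [s [_ [w ww ws] [g /borel_G Gg <-]]] := iflag_orbit Hf.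
have [h Gh hE] := weyl_flag ww; exists (g \o h); first exact: G_comp.
by rewrite act_comp hE ws.
Qed.

Lemma orbit_eq s t GG : weyl_orbit iE sigma0 s -> weyl_orbit iE sigma0 t ->
  orbit B (coord_flag b s) GG -> orbit B (coord_flag b t) GG -> s = t.
Proof.
move=> sW tW sG tG; have [n [H [Hf HE]]] := Fl_iflag (orbit_Fl sW sG).
have [[k sw] [m tw]] := ((weyl_orbitP s).1 sW, (weyl_orbitP t).1 tW).
rewrite HE in sG tG.
by apply: (rel_position_uniq ((orbitP Hf sw).1 sG)); exact/(orbitP Hf tw).
Qed.

(** An element may a priori permute the members of the flag. It fixes each of them, as the family
    (F''_a) is recovered from the set of members by [flag_from_inj]. *)
Lemma act_stab g : Gom omega b g -> act g FF = FF -> stab omega b FF g.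
Proof.
move=> Gg gF; split=> // F FF_; have lg := G_linear Gg.
have [n gn] := G_local Gg; have sw := wtype_refl (En n).
have gi : isom (g \o b) by move=> e f; exact: G_isom.
have Gg' : Gom omega b (lin (g \o b)) by rewrite -G_lin.
have Hf := wtype_iflag sw gn gi; have Hf0 : iflag (En n) (hi_ b sigma0).
  by apply: wtype_iflag => //; split=> // e en; apply: mem_span; exists e.
have Gb : Gom omega b (lin b) by rewrite lin_basis_id; exact: G_id.
have E0 : hi_ (g \o b) sigma0 = hi_ b sigma0.
  by apply: (flag_from_inj Hf Hf0); rewrite -!coord_flagE // -act_coord_flag.
have E1 a : coord_space (g \o b) [set e | (sigma0 e <= a)%O] =
            coord_space b [set e | (sigma0 e <= a)%O] by exact: (congr1 (@^~ a) E0).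
case: FF_ => -[a _ <-]; rewrite image_coord_space //.
have := congr1 (perp omega) (E1 (iA a)).
by rewrite !perp_coord_below // iA_inv.
Qed.

Lemma lcoset_stab g h : Gom omega b g -> Gom omega b h ->
  act g FF = act h FF <-> lcoset (stab omega b FF) g = lcoset (stab omega b FF) h.
Proof.
have stab_act k : stab omega b FF k -> act k FF = FF.
  move=> [Gk kF]; apply/seteqP; split=> [_ [F FF_ <-]|F FF_]; first by rewrite kF.
  by exists F => //; exact: kF.
have sub g' h' : Gom omega b g' -> Gom omega b h' -> act g' FF = act h' FF ->
    lcoset (stab omega b FF) g' `<=` lcoset (stab omega b FF) h'.
  move=> Gg Gh gh _ [k kS <-]; have [hi_ [Ghi hK Kh]] := G_inv Gh.
  exists (hi_ \o g' \o k); last by apply/funext => v; rewrite /= Kh.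
  apply: act_stab; first by apply: G_comp; [exact: G_comp|case: kS].
  rewrite act_comp (stab_act _ kS) act_comp gh -act_comp.
  rewrite (_ : hi_ \o h' = id); last by apply/funext => v; rewrite /= hK.
  by rewrite /act; under eq_imagel do rewrite image_id; rewrite image_id.
move=> Gg Gh; split=> [gh|gh].
  by apply/seteqP; split; apply: sub.
have : lcoset (stab omega b FF) g g.
  exists id => //; split; [exact: G_id|by move=> F _; rewrite image_id].
by rewrite gh => -[k kS <-]; rewrite act_comp (stab_act _ kS).
Qed.

Lemma lcoset_weyl w w' : weyl iE w -> weyl iE w' ->
  lcoset (weyl_stab iE sigma0) w = lcoset (weyl_stab iE sigma0) w' <->
  sigma0 \o winv w = sigma0 \o winv w'.
Proof.
have winv_comp u v : weyl iE u -> weyl iE v -> winv (u \o v) = winv v \o winv u.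
  move=> uu vv; apply: winv_uniq; first exact: weyl_comp.
  by move=> x /=; rewrite (winvP vv).1 (winvP uu).1.
have winvK u : weyl iE u -> winv (winv u) = u.
  by move=> uu; apply: winv_uniq; [exact: weyl_winv|exact: (winvP uu).2].
have sub u v : weyl iE u -> weyl iE v -> sigma0 \o winv u = sigma0 \o winv v ->
    lcoset (weyl_stab iE sigma0) u `<=` lcoset (weyl_stab iE sigma0) v.
  move=> uu vv uv _ [k [kw kS] <-].
  exists (winv v \o u \o k); last by apply/funext => x; rewrite /= (winvP vv).1.
  have uvw : weyl iE (winv v \o u) by apply: weyl_comp => //; exact: weyl_winv.
  split; first exact: weyl_comp.
  rewrite winv_comp // winv_comp ?winvK //; last exact: weyl_winv.
  rewrite compA kS; apply/funext => x /=.
  by have := congr1 (@^~ (v x)) uv; rewrite /= (winvP vv).2.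
move=> ww ww'; split=> [E0|E0]; last by apply/seteqP; split; exact: sub.
have : lcoset (weyl_stab iE sigma0) w w.
  exists id => //; split; first exact: weyl_id.
  by rewrite winv_id.
rewrite E0 => -[k [kw kS] <-]; rewrite winv_comp //.
by rewrite compA kS.
Qed.

(** * Homogeneous coordinates of flags *)

Local Notation Xind := (Fl_ind omega b iA sigma0 En).

Lemma omega_split n u v :
  (forall e, e \notin En n -> coef u e != 0 -> coef v (iE e) = 0) ->
  omega u v = omega (restr (En n) u) (restr (En n) v).
Proof.
move=> uv; have offE w e : coef (w - restr (En n) w) e != 0 -> e \notin En n.
  by rewrite coefB coef_restr; case: ifPn => //; rewrite subrr eqxx.
have off1 w z : omega (w - restr (En n) w) (restr (En n) z) = 0.
  apply: (omega_off (I := En n)); [exact: En_stable|exact: restr_fspan|].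
  exact: offE.
have bilin x y z t :
    omega (x + y) (z + t) = omega x z + omega x t + (omega y z + omega y t).
  by rewrite linearDl !linearDr.
rewrite -[u in LHS](subrK (restr (En n) u)) -[v in LHS](subrK (restr (En n) v)).
rewrite bilin off1 addr0 (omega_eq0C (off1 v u)) add0r.
rewrite omega_expand big1_seq ?add0r // => e /andP[_]; rewrite mem_supp => ue.
have eI := offE _ _ ue; move: ue; rewrite coefB coef_restr (negPf eI) subr0 => ue.
by rewrite coefB coef_restr En_iE (negPf eI) subr0 uv // mul0r mulr0.
Qed.

Definition off n (P : pred E) : set V :=
  coord_space b [set e | e \notin En n /\ P e].

Lemma addsp_off_std n P U : subspace U -> U `<=` fspan b (En n) ->
  has_dim U (count P (En n)) ->
  std (En n) P (addsp U (off n P)) /\ addsp U (off n P) `&` fspan b (En n) = U.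
Proof.
move=> sU UI dU; have soff : subspace (off n P) by exact: span_subspace.
have sA := addsp_subspace sU soff; have sI := fspan_subspace (En n).
have AI : addsp U (off n P) `&` fspan b (En n) = U.
  apply/seteqP; split=> [_ [[u Uu [w /coord_spaceP wo <-]] uwI]|u Uu]; last first.
    split; last exact: UI.
    by exists u => //; exists 0; [exact: soff.1|rewrite addr0].
  suff -> : w = 0 by rewrite addr0.
  have wI : fspan b (En n) w.
    by rewrite -[w](addKr u) addrC; apply: (subspaceB sI) => //; exact: UI.
  apply: coef_inj => e; rewrite coef0; apply/eqP; apply: contraT => we.
  by have [] := wo e we; move/mem_fspan: wI => /(_ e we)->.
split=> //; split=> //.
- move=> e eI Pe; exists 0; first exact: sU.1.
  by exists (b e); [apply: mem_span; exists e|rewrite add0r].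
- move=> _ e [u Uu [w /coord_spaceP wo <-]] eI; rewrite coefD.
  have -> : coef u e = 0.
    by apply/eqP; apply: contraNT eI => ue; move/UI/mem_fspan: Uu; apply.
  by rewrite add0r => /wo[].
rewrite -(@eq_vs (En n) (addsp U (off n P) `&` fspan b (En n))) ?AI //.
  exact/(has_dimP _ sU UI).
by rewrite -[in LHS]AI -setIA setIid.
Qed.

Definition frame_row n (x : A * bool * (nat * E) -> K) a t (j : nat) : V :=
  \sum_(e <- En n) x (a, t, (j, e)) *: b e.

(** Isotropy is given only inside <E_n>. It passes to the spaces completed by basis vectors outside
    E_n, since products split by [omega_split] and the outer supports cannot pair. *)
Lemma coords_iflag n GG x : @coords _ _ Xind n GG x -> exists H,
  [/\ iflag (En n) H, GG = flag_from H & forall a,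
   basis_of (H a `&` fspan b (En n))
     (fun j : 'I_(count (below sigma0 a) (En n)) => frame_row n x a true (val j))].
Proof.
move=> [lo [hi [[shl lt_hl dims perps] GGE frames]]].
have sI := fspan_subspace (En n).
have dim_of U P : subspace U -> U `<=` fspan b (En n) ->
    same_dim U (coord_space b [set e | P e] `&` fspan b (En n)) ->
    has_dim U (count P (En n)).
  move=> sU UI [k k1 k2].
  by rewrite (has_dim_uniq (has_dim_coord P (En n)) k2).
have hid a : has_dim (hi a) (count (below sigma0 a) (En n)).
  have [_ s2 _ hI] := shl a; have [_ d2] := dims a.
  exact: (dim_of _ (below sigma0 a)).
have lod a : has_dim (lo a) (count (sbelow sigma0 a) (En n)).
  have [s1 _ lh hI] := shl a; have [d1 _] := dims a.
  by apply: (dim_of _ (sbelow sigma0 a)) => //; exact: subset_trans hI.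
pose H a := addsp (hi a) (off n (below sigma0 a)).
pose L a := addsp (lo a) (off n (sbelow sigma0 a)).
have HP a : std (En n) (below sigma0 a) (H a) /\ H a `&` fspan b (En n) = hi a.
  by have [_ ? _ ?] := shl a; exact: addsp_off_std.
have LP a : std (En n) (sbelow sigma0 a) (L a) /\ L a `&` fspan b (En n) = lo a.
  have [? _ lh hI] := shl a; apply: addsp_off_std => //; exact: subset_trans hI.
have rH a u : H a u -> hi a (restr (En n) u).
  have [Hs HI] := HP a; move=> Hu; rewrite -HI; split; last exact: restr_fspan.
  by apply: (mem_restr Hs _).1 => // e; case: Hs => _ _ + _; apply.
have rL a u : L a u -> lo a (restr (En n) u).
  have [Ls LI] := LP a; move=> Lu; rewrite -LI; split; last exact: restr_fspan.
  by apply: (mem_restr Ls _).1 => // e; case: Ls => _ _ + _; apply.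
have lo_perp a u v : hi (iA a) u -> lo a v -> omega u v = 0.
  by have [E1 _] := perps (iA a); rewrite iA_inv in E1; rewrite -E1 => hu [pv _]; exact: pv.
have Hf : iflag (En n) H.
  split=> [a|a c|a c u v ca Hu Hv]; first by case: (HP a).
    rewrite le_eqVlt => /predU1P[->//|ac] _ [u hu [w wo <-]].
    exists u; first by have [_ _ + _] := shl c; apply; exact: lt_hl ac _ hu.
    exists w => //; move: wo; apply: coord_space_sub => e [eI ea].
    by split=> //; apply: le_trans ea _; exact: ltW.
  rewrite (omega_split (n := n)) => [|e eI ue].
    have := lt_hl _ _ ca _ (rH _ _ Hv) => /(lo_perp (iA a)); apply.
    by rewrite iA_inv; exact: rH.
  have [[_ _ HPa _] _] := HP a; have [[_ _ HPc _] _] := HP c.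
  apply/eqP; apply: contraTT ca => vi; rewrite -leNgt.
  have := HPa _ _ Hu eI ue; rewrite /below -iA_anti => /le_trans; apply.
  by rewrite -sigma0_iso; apply: HPc Hv _ vi; rewrite En_iE.
exists H; split=> // [|a].
  rewrite GGE; congr flag_of; apply/funext => a; rewrite -/(L a).
  apply: std_sub_eq (iflag_lo a Hf) _; first by case: (LP a).
  move=> v Lv u Hu; rewrite (omega_split (n := n)) => [|e eI ue].
    by apply: lo_perp (rL _ _ Lv); exact: rH.
  have [[_ _ HPa _] _] := HP (iA a); have [[_ _ LPa _] _] := LP a.
  apply/eqP; apply: contraT => vi; have := HPa _ _ Hu eI ue.
  have : (sigma0 (iE e) < a)%O by apply: LPa Lv _ vi; rewrite En_iE.
  by rewrite /below sigma0_iso -[a in (_ < a)%O]iA_inv iA_lt ltNge => /negPf->.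
have [_ [k kb]] := frames a.
(* The number of rows of a frame is left free in [frame]; the dimension fixes it. *)
have kE : k = count (below sigma0 a) (En n).
  by apply: (has_dim_uniq _ (hid a)); exists (fun j => frame_row n x a true (val j)).
by rewrite (HP a).2 -kE.
Qed.

(* The rows of the matrix of the a-th space are the [l f] with [s f < a] or
   [s f <= a], f in E_n. *)
Definition flag_coords n l s : A * bool * (nat * E) -> K := fun p =>
  let P f := if p.1.2 then (s f <= p.1.1)%O else (s f < p.1.1)%O in
  coef (l (nth p.2.2 [seq f <- En n | P f] p.2.1)) p.2.2.

Lemma frame_coord n l P : local (En n) l -> injective (lin l) ->
  basis_of (coord_space l [set e | P e] `&` fspan b (En n))
    (fun j : 'I_(size [seq f <- En n | P f]) => \sum_(e <- En n)
       coef (l (nth e [seq f <- En n | P f] (val j))) e *: b e).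
Proof.
move=> ll li; set T := [seq f <- En n | P f].
have uT : uniq T by rewrite filter_uniq // fset_uniq.
have TP (i : 'I_(size T)) : P (tnth (in_tuple T) i) && (tnth (in_tuple T) i \in En n).
  by have := mem_tnth i (in_tuple T); rewrite mem_filter.
have sC : subspace (coord_space l [set e | P e] `&` fspan b (En n)).
  by apply: subspaceI; exact: span_subspace.
have rowE (j : 'I_(size T)) : \sum_(e <- En n) coef (l (nth e T (val j))) e *: b e =
    l (tnth (in_tuple T) j).
  have /andP[_ jI] := TP j; have /mem_fspan lI := ll.2 _ jI.
  rewrite [RHS](expand_in lI); apply: eq_bigr => e _.
  by rewrite (tnth_nth e).
have -> : (fun j : 'I_(size T) => \sum_(e <- En n) coef (l (nth e T (val j))) e *: b e)
    = (fun j => l (tnth (in_tuple T) j)) by apply/funext.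
apply/basis_ofP => //; split.
- move=> i; have /andP[Pi iI] := TP i; split; last exact: ll.2.
  by apply: mem_span; exists (tnth (in_tuple T) i).
- move=> v []; rewrite (coord_space_lin l) => -[w /coord_spaceP wP <-] /(local_fspan_eq ll).
  move=> /mem_fspan wI; exists (fun i => coef w (tnth (in_tuple T) i)).
  rewrite (lin_in _ wI) -(big_tnth _ _ T xpredT (fun e => coef w e *: l e)).
  rewrite big_filter [RHS]big_mkcond; apply: eq_bigr => e _.
  by case: ifPn => // /negP Pe; have [->|/wP//] := eqVneq (coef w e) 0; rewrite scale0r.
- move=> c c0 i; pose w := \sum_j c j *: b (tnth (in_tuple T) j).
  have w0 : w = 0.
    apply: li; rewrite (linear_apply0 (lin_linear l)) -[RHS]c0.
    rewrite (linear_apply_sum _ _ _ (lin_linear l)); apply: eq_bigr => j _.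
    by rewrite (linear_applyZ _ _ (lin_linear l)) lin_basis.
  have := congr1 (coef^~ (tnth (in_tuple T) i)) w0.
  rewrite coef0 coef_sum (bigD1 i) //= coefZ coef_basis eqxx mulr1.
  rewrite big1 ?addr0 // => j ji; rewrite coefZ coef_basis.
  have inj : injective (tnth (in_tuple T)) by exact/(tuple_uniqP (in_tuple T)).
  by rewrite (inj_eq inj) eq_sym (negPf ji) mulr0.
Qed.

Lemma coords_flag n l s : wtype (En n) s -> local (En n) l -> isom l ->
  @coords _ _ Xind n (coord_flag l s) (flag_coords n l s).
Proof.
move=> sw ll li; have [siE s0 sc] := sw; have Gl := isom_G ll li.
have linj := isom_inj li; have sI := fspan_subspace (En n).
have sC D : subspace (coord_space l D) by exact: span_subspace.
have Cs P Q (PQ : forall e, e \notin En n -> P e = Q e)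
  (c : count P (En n) = count Q (En n)) := std_coord ll linj PQ c.
have Hs a : std (En n) (below sigma0 a) (coord_space l [set e | s e <= a]%O).
  by apply: (Cs (below s a)) => // e en; rewrite /below s0.
have Ls a : std (En n) (sbelow sigma0 a) (coord_space l [set e | s e < a]%O).
  apply: (Cs (sbelow s a)) => [e en|]; first by rewrite /sbelow s0.
  exact: wtype_count_lt.
exists (fun a => coord_space l [set e | s e < a]%O `&` fspan b (En n)).
exists (fun a => coord_space l [set e | s e <= a]%O `&` fspan b (En n)).
have perpI U P : std (En n) P U ->
    perp omega (U `&` fspan b (En n)) `&` fspan b (En n) = perp omega U `&` fspan b (En n).
  move=> [sU bU UP dU]; apply/seteqP; split=> v [Uv vI]; split=> // u; last by case=> ? _; apply: Uv.
  move=> Uu; rewrite (omega_split (n := n)) => [|e eI ue].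
    have -> : restr (En n) v = v by rewrite /restr -expand_in //; apply/mem_fspan.
    apply: Uv; split; last exact: restr_fspan.
    by apply: (mem_restr (And4 sU bU UP dU) _).1 => // e; exact: UP.
  apply/eqP; apply: contraNT eI => vi; rewrite -En_iE.
  by move/mem_fspan: vI; apply.
have dimI P Q (C := coord_space l [set e | P e]) : std (En n) Q C ->
    same_dim (C `&` fspan b (En n)) (coord_space b [set e | Q e] `&` fspan b (En n)).
  move=> [_ _ _ dC]; exists (count Q (En n)); last exact: has_dim_coord.
  have sCI : subspace (C `&` fspan b (En n)) by exact: (subspaceI (sC _) sI).
  have CI : C `&` fspan b (En n) `<=` fspan b (En n) by move=> v [].
  apply/(has_dimP _ sCI CI).
  by rewrite -dC; congr (\dim _); apply: eq_vs; [|exact: sC|rewrite -setIA setIid].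
have addI P U : std (En n) P U -> addsp (U `&` fspan b (En n)) (off n P) = U.
  move=> Us; have [sU bU UP dU] := Us; apply/seteqP; split=> [_ [u [Uu _] [w /coord_spaceP wP <-]]|u Uu].
    apply: subspaceD => //; rewrite (expand w) big_seq; apply: subspace_sum => // e.
    by rewrite mem_supp => /wP[eI Pe]; apply: subspaceZ => //; exact: bU.
  exists (restr (En n) u).
    split; last exact: restr_fspan.
    by apply: (mem_restr Us _).1 => // e; exact: UP.
  exists (u - restr (En n) u); last by rewrite addrC subrK.
  apply/coord_spaceP => e; rewrite coefB coef_restr; case: ifPn => eI.
    by rewrite subrr eqxx.
  by rewrite subr0 => ue; split=> //; exact: UP ue.
split; [split|..].
- move=> a; split; [exact: (subspaceI (sC _) sI)|exact: (subspaceI (sC _) sI)| |by move=> v []].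
  by move=> v [lv vI]; split=> //; move: lv; apply: coord_space_sub => e /ltW.
- move=> a c ac v [hv vI]; split=> //; move: hv; apply: coord_space_sub => e ea.
  exact: le_lt_trans ac.
- move=> a; split; first exact: (dimI (sbelow s a) (sbelow sigma0 a)).
  exact: (dimI (below s a) (below sigma0 a)).
- move=> a; rewrite (perpI _ _ (Hs a)) (perpI _ _ (Ls a)).
  rewrite perp_coord_below //; split=> //; congr (_ `&` _).
  have := coord_flag_isotropic Gl siE (F := coord_space l [set e | s e <= iA a]%O).
  case; first by right; exists (iA a).
  by rewrite perp_coord_below // iA_inv.
- congr flag_of; apply/funext => a.
    by rewrite -[LHS](addI _ _ (Ls a)).
  by rewrite -[LHS](addI _ _ (Hs a)).
- move=> a; split; [exists (size [seq f <- En n | sbelow s a f])|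
                    exists (size [seq f <- En n | below s a f])].
    exact: (frame_coord (sbelow s a)).
  exact: (frame_coord (below s a)).
Qed.

(** * Minors *)

(* The projection of U onto the coordinates in S is bijective. *)
Definition transv U (S : set E) :=
  (forall v, U v -> (forall e, S e -> coef v e = 0) -> v = 0) /\
  (forall e, S e -> exists v, [/\ U v, coef v e = 1 &
     forall j, S j -> j != e -> coef v j = 0]).

Lemma transv_off I P U S e : std I P U -> transv U S -> e \notin I -> S e <-> P e.
Proof.
move=> [_ bU UP _] [inj sur] eI; split=> [/sur[v [Uv v1 _]]|Pe].
  by apply: (UP v) => //; rewrite v1 oner_neq0.
apply: contrapT => Se; have b0 : b e = 0.
  apply: inj => [|j Sj]; first exact: bU.
  by rewrite coef_basis; case: eqVneq => // je; case: Se; rewrite -je.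
by have := coef_basis e e; rewrite b0 coef0 eqxx => /eqP; rewrite eq_sym oner_eq0.
Qed.

Definition sel (S : set E) n : seq E := [seq e <- En n | `[< S e >]].

Lemma sel_uniq S n : uniq (sel S n).
Proof. by rewrite filter_uniq // fset_uniq. Qed.

Lemma mem_sel S n e : (e \in sel S n) = `[< S e >] && (e \in En n).
Proof. by rewrite mem_filter. Qed.

Definition minor_mx a (T : seq E) (x : A * bool * (nat * E) -> K) :=
  \matrix_(i < size T, j < size T) x (a, true, (val i, tnth (in_tuple T) j)).

Lemma coef_frame_row n x a j e : e \in En n ->
  coef (frame_row n x a true j) e = x (a, true, (j, e)).
Proof. by move=> eI; rewrite coef_mk eI. Qed.

Lemma transv_frame n x a P U S : std (En n) P U ->
  basis_of (U `&` fspan b (En n))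
    (fun j : 'I_(count P (En n)) => frame_row n x a true (val j)) ->
  transv U S <-> [/\ forall e, e \notin En n -> S e <-> P e,
    size (sel S n) = count P (En n) & minor_mx a (sel S n) x \in unitmx].
Proof.
move=> Us; have [sU bU UP _] := Us; set T := sel S n.
have sUI : subspace (U `&` fspan b (En n)) by exact/subspaceI/fspan_subspace.
have TS (i : 'I_(size T)) : S (tnth (in_tuple T) i) /\ tnth (in_tuple T) i \in En n.
  have := mem_tnth i (in_tuple T); rewrite mem_sel => /andP[/asboolP Si iI].
  by [].
have Tinj : injective (tnth (in_tuple T)) by exact/(tuple_uniqP (in_tuple T))/sel_uniq.
have ST e : S e -> e \in En n -> exists j : 'I_(size T), e = tnth (in_tuple T) j.
  move=> Se eI; have : e \in in_tuple T by rewrite mem_sel eI andbT; apply/asboolP.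
  by move=> /tnthP[j ->]; exists j.
(* The number of rows becomes a variable, so that it can be replaced by the number of columns once
   the matrix is known to be square. *)
have [k kE] : exists k, k = count P (En n) by exists (count P (En n)).
rewrite -kE => /(basis_ofP _ sUI)[Ur rU indr].
pose r (j : 'I_k) := frame_row n x a true (val j).
pose M := \matrix_(i < k, j < size T) x (a, true, (val i, tnth (in_tuple T) j)).
have coefM (c : 'I_k -> K) j : coef (\sum_i c i *: r i) (tnth (in_tuple T) j) =
    ((\row_i c i) *m M) 0 j.
  rewrite coef_sum mxE; apply: eq_bigr => i _.
  by rewrite coefZ !mxE coef_frame_row //; case: (TS j).
split=> [Ut|[SP szT]].
  have SP e : e \notin En n -> S e <-> P e by exact: transv_off Us Ut.
  have [inj sur] := Ut; have freeM : row_free M.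
    apply/row_freeP; apply: contrapT => no.
    suff : \rank M == k by move=> /row_freeP.
    rewrite -[_ == _]/(row_free M) -kermx_eq0; apply/eqP/row_matrixP => i.
    rewrite row0; set u := row i _.
    have uM : u *m M = 0 by apply/sub_kermxP; exact: row_sub.
    suff c0 : \sum_i u 0 i *: r i = 0.
      by apply/rowP => j; rewrite [RHS]mxE; exact: (indr (fun j => u 0 j) c0 j).
    apply: inj => [|e Se].
      by apply: subspace_sum => // j _; apply: subspaceZ => //; case: (Ur j).
    have [eI|eI] := boolP (e \in En n).
      have [j ->] := ST e Se eI; rewrite coefM.
      suff -> : (\row_j0 u 0 j0) = u by rewrite uM mxE.
      by apply/rowP => j0; rewrite mxE.
    apply/eqP; apply: contraNT eI => ue.
    suff : fspan b (En n) (\sum_j u 0 j *: r j) by move=> /mem_fspan; apply.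
    apply: (subspace_sum _ (fspan_subspace _)) => j _.
    by apply: (subspaceZ _ (fspan_subspace _)); case: (Ur j).
  have [c cM] : exists c : 'I_(size T) -> 'rV[K]_k, forall j, c j *m M = delta_mx 0 j.
    suff ex j : exists u : 'rV[K]_k, u *m M = delta_mx 0 j.
      by have [c cP] := choice ex; exists c.
    have [Sj jI] := TS j; have [v [Uv v1 v0]] := sur _ Sj.
    have [|g gE] := rU (restr (En n) v).
      split; last exact: restr_fspan.
      by apply: (mem_restr Us _).1 => // e; exact: UP.
    exists (\row_i g i); apply/rowP => j'; rewrite -coefM -gE coef_restr.
    have [Sj' ->] := TS j'; rewrite mxE eqxx /=.
    have [->|jj'] := eqVneq j' j; first by rewrite v1.
    by rewrite v0 // (inj_eq Tinj).
  have CM : (\matrix_j c j) *m M = 1%:M.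
    by apply/row_matrixP => j; rewrite row_mul rowK cM row1.
  have kT : k = size T.
    apply/eqP; rewrite eqn_leq; apply/andP; split.
      by rewrite -(eqP freeM); exact: rank_leq_col.
    rewrite -[X in (X <= _)%N](mxrank1 K (size T)) -CM.
    by apply: leq_trans (mxrankM_maxr _ _) _; exact: rank_leq_row.
  split=> //.
  by clear kE; subst k; have [] := mulmx1_unit CM.
move=> uM; clear kE; subst k.
split=> [v Uv v0|e Se].
  have vI : fspan b (En n) v.
    apply/mem_fspan => e; apply: contraR => eI; apply/eqP; apply: contrapT => ve.
    by apply/ve/v0/SP => //; exact/(UP _ _ Uv eI)/eqP.
  have [c vE] := rU v (conj Uv vI).
  have cM : (\row_i c i) *m M = 0.
    by apply/rowP => j; rewrite -coefM -vE mxE v0 //; case: (TS j).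
  have c0 : \row_i c i = 0 by rewrite -[LHS](mulmxK uM) cM mul0mx.
  rewrite vE big1 // => i _; have := congr1 (fun u : 'rV_ _ => u 0 i) c0.
  by rewrite !mxE => ->; rewrite scale0r.
have [eI|eI] := boolP (e \in En n); last first.
  exists (b e); split; first by apply: bU => //; exact/SP.
    by rewrite coef_basis eqxx.
  by move=> j _ /negPf je; rewrite coef_basis je.
have [j ->] := ST e Se eI; pose u := row j (invmx M).
have uM' : u *m M = delta_mx 0 j by rewrite -row_mul mulVmx // row1.
have uE : \row_i u 0 i = u by apply/rowP => i; rewrite mxE.
have fI : fspan b (En n) (\sum_i u 0 i *: r i).
  apply: (subspace_sum _ (fspan_subspace _)) => i _.
  by apply: (subspaceZ _ (fspan_subspace _)); case: (Ur i).
exists (\sum_i u 0 i *: r i); split.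
- by apply: subspace_sum => // i _; apply: subspaceZ => //; case: (Ur i).
- by rewrite coefM uE uM' mxE !eqxx.
- move=> f Sf fj; have [fI'|fI'] := boolP (f \in En n); last first.
    by apply/eqP; apply: contraNT fI' => ff; move/mem_fspan: fI; apply.
  have [i fE] := ST f Sf fI'; rewrite fE coefM uE uM' mxE eqxx /=.
  by rewrite fE (inj_eq Tinj) in fj; rewrite (negPf fj).
Qed.

Lemma polyfun_minor a T : polyfun (fun x => \det (minor_mx a T x)).
Proof.
by apply: polyfun_det => i j; exact: (polyfun_var _ (a, true, (val i, tnth (in_tuple T) j))).
Qed.

(** A vector vanishing on the columns s e <= a would have its leading place among them. For the
    second half, b e is expanded in the mixed basis made of l j for s j <= a and b j otherwise: the
    terms of the second kind do not touch these columns, so the terms of the first kind have the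
    required coordinates. *)
Lemma tri_transv I R l s a : utri I R l ->
  transv (coord_space l [set e | s e <= a]%O) [set e | s e <= a]%O.
Proof.
move=> lu; have lt_ := utri_tri lu; split.
  move=> v lv v0; apply/eqP; apply: contraT => /ex_leads[e ve].
  have : hit (coord_space l [set e | s e <= a]%O) e by exists v.
  by move=> /(hit_coord _ _ lt_) /v0 ve0; case: ve; rewrite ve0 eqxx.
move=> e /= ea; pose m j := if (s j <= a)%O then l j else b j.
have mu : utri I R m.
  move=> j; rewrite /m; case: ifP => _; first exact: lu.
  by rewrite coef_basis eqxx; split=> // k kj; rewrite coef_basis (negPf kj) eqxx.
have [z bE] : exists z, b e = lin m z.
  have : coord_space m setT (b e) by rewrite (utri_image mu) //; apply/coord_spaceP.
  by rewrite (coord_space_lin m) => -[z _ <-]; exists z.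
pose part (R' : pred E) := \sum_(j <- supp z | R' j) coef z j *: m j.
have bE' : b e = part (below s a) + part (predC (below s a)).
  by rewrite bE /lin (bigID (below s a)).
have pE j : (s j <= a)%O -> coef (part (predC (below s a))) j = 0.
  move=> ja; rewrite coef_sum big1 // => i; rewrite /= /below /m => ia.
  rewrite (negPf ia) coefZ coef_basis; case: eqVneq => [ji|]; last by rewrite mulr0.
  by rewrite -ji ja in ia.
have coefp j : (s j <= a)%O -> coef (part (below s a)) j = (j == e)%:R.
  by move=> ja; rewrite -coef_basis bE' coefD (pE j ja) addr0.
exists (part (below s a)); split.
- apply: (subspace_sum _ (span_subspace _)) => j ja.
  apply: (subspaceZ _ (span_subspace _)); rewrite /m (ja : (s j <= a)%O).
  by apply: mem_span; exists j.
- by rewrite coefp // eqxx.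
- by move=> j ja je; rewrite coefp // (negPf je).
Qed.

Definition lower (D : pred E) := forall e j, lt j e -> D e -> D j.

Definition count_set (S : set E) (D : pred E) n :=
  count (fun e => `[< S e >] && D e) (En n).

(** The vectors l e with e in D and s e <= a are supported in D. The projection onto the coordinates
    in S is injective on their span, hence so is the projection onto those in both S and D. *)
Lemma transv_count n l s a S D : utri (En n) (fun _ _ => True) l ->
  lower D -> transv (coord_space l [set e | s e <= a]%O) S ->
  (count (fun e => below s a e && D e) (En n) <= count_set S D n)%N.
Proof.
move=> lu Dl [inj _]; rewrite /count_set -!size_filter.
set P := filter _ _; set Q := filter _ _.
have uP : uniq P by rewrite filter_uniq // fset_uniq.
have PP (i : 'I_(size P)) : [/\ below s a (tnth (in_tuple P) i),
    D (tnth (in_tuple P) i) & tnth (in_tuple P) i \in En n].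
  by have := mem_tnth i (in_tuple P); rewrite mem_filter -andbA => /and3P[].
pose N := \matrix_(i < size P, j < size Q)
  coef (l (tnth (in_tuple P) i)) (tnth (in_tuple Q) j).
suff /eqP <- : row_free N by exact: rank_leq_col.
rewrite -kermx_eq0; apply/eqP/row_matrixP => i; rewrite row0; set u := row i _.
have uN : u *m N = 0 by apply/sub_kermxP; exact: row_sub.
pose w := \sum_j u 0 j *: b (tnth (in_tuple P) j).
have lwE : lin l w = \sum_j u 0 j *: l (tnth (in_tuple P) j).
  rewrite (linear_apply_sum _ _ _ (lin_linear l)); apply: eq_bigr => j _.
  by rewrite (linear_applyZ _ _ (lin_linear l)) lin_basis.
suff lw0 : lin l w = 0.
  have w0 : w = 0.
    by apply: (tri_inj (utri_tri lu)); rewrite lw0 (linear_apply0 (lin_linear l)).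
  apply/rowP => j; rewrite [RHS]mxE.
  have := congr1 (coef^~ (tnth (in_tuple P) j)) w0.
  rewrite coef0 coef_sum (bigD1 j) //= coefZ coef_basis eqxx mulr1.
  rewrite big1 ?addr0 // => k kj; rewrite coefZ coef_basis.
  have Pinj : injective (tnth (in_tuple P)) by exact/(tuple_uniqP (in_tuple P)).
  by rewrite (inj_eq Pinj) eq_sym (negPf kj) mulr0.
apply: inj => [|e Se].
  rewrite lwE; apply: (subspace_sum _ (span_subspace _)) => j _.
  apply: (subspaceZ _ (span_subspace _)); apply: mem_span.
  by exists (tnth (in_tuple P) j) => //; case: (PP j).
rewrite lwE coef_sum; have [eI|eI] := boolP (e \in En n); last first.
  rewrite big1 // => j _; rewrite coefZ; apply/eqP; rewrite mulf_eq0; apply/orP; right.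
  apply: contraNT eI => le; have [_ _ jI] := PP j.
  by move/mem_fspan: ((utri_local lu).2 _ jI); apply.
have [De|De] := boolP (D e); last first.
  rewrite big1 // => j _; rewrite coefZ; apply/eqP; rewrite mulf_eq0; apply/orP; right.
  apply: contraNT De => le; have [_ Dj jI] := PP j.
  have := (utri_tri lu (tnth (in_tuple P) j)).2 _ le.
  by rewrite leB_eqVlt => /predU1P[->//|ej]; exact: Dl ej Dj.
have /tnthP[j ->] : e \in in_tuple Q.
  by rewrite mem_filter eI De !andbT; apply/asboolP.
have := congr1 (fun v : 'rV_ _ => v 0 j) uN; rewrite !mxE => uN0; rewrite -[RHS]uN0.
by apply: eq_bigr => k _; rewrite coefZ !mxE.
Qed.

(** * Schubert conditions *)

(** The sets may be infinite, so they are compared through their intersections with E_m for m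
    large. *)
Definition dominates (S : set E) t a D := exists m0, forall m, (m0 <= m)%N ->
  (count (fun e => below t a e && D e) (En m) <= count_set S D m)%N.

(* The closure of the orbit of [t], cut out by the vanishing of the minors on
   the columns [S] which do not dominate the set {e | t e <= a}. *)
Definition schubert t : set (set (set V)) := [set GG | X GG /\
  forall n H, iflag (En n) H -> GG = flag_from H ->
  forall a S D, lower D -> transv (H a) S -> dominates S t a D].

(** On the n-th piece a transverse set S is prescribed outside E_n. The condition then says that the
    minors on the columns S ∩ E_n vanish for every such S, of the right size, that does not
    dominate. *)
Lemma schubert_closed t : ind_closed Xind (schubert t).
Proof.
move=> n; pose bad a (T : seq E) := exists S D, [/\ lower D,
  forall e, e \notin En n -> S e <-> below sigma0 a e,
  size T = count (below sigma0 a) (En n), T = sel S n & ~ dominates S t a D].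
exists [set p | exists a T, bad a T /\ p = fun x => \det (minor_mx a T x)].
  by move=> _ [a [T [_ ->]]]; exact: polyfun_minor.
move=> GG x /coords_iflag[H [Hf GGE Hb]].
have Hs a : std (En n) (below sigma0 a) (H a) by case: Hf.
split=> [[_ Ct] _ [a [T [[S [D [Dl SP szT TE Sbad]]] ->]]]|Sp].
  apply/eqP; apply: contra_notT Sbad => detN0; apply: (Ct _ _ Hf GGE) => //.
  by apply/(transv_frame _ (Hs a) (Hb a)); rewrite -TE unitmxE unitfE.
split=> [|m H' H'f GGE' a S D Dl]; first by rewrite GGE; exact: iflag_Fl Hf.
have <- : H = H' by apply: (flag_from_inj Hf H'f); rewrite -GGE.
move=> /(transv_frame _ (Hs a) (Hb a))[SP szT uM]; apply: contrapT => Sbad.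
move: uM; rewrite unitmxE unitfE => /negP; apply; apply/eqP.
apply: (Sp (fun x => \det (minor_mx a (sel S n) x))).
by exists a, (sel S n); split=> //; exists S, D.
Qed.

Lemma utri_weaken I (R R' : E -> E -> Prop) l : (forall e j, R e j -> R' e j) ->
  utri I R l -> utri I R' l.
Proof.
move=> RR' lu e; have [l1 lP] := lu e; split=> // j je /(lP _ je)[? ? ? ?].
by split=> //; exact: RR'.
Qed.

Lemma orbit_iflag n H s : iflag (En n) H -> weyl_orbit iE sigma0 s ->
  orbit B (coord_flag b s) (flag_from H) ->
  exists l, [/\ wtype (En n) s, reduced (En n) s l, isom l & H = hi_ l s].
Proof.
move=> Hf /weyl_orbitP[m sw] sO.
have [t [l [tw lr li HE]]] := iflag_normal_form Hf; exists l.
have HE' : H = hi_ l t by apply/funext.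
suff <- : t = s by [].
apply: (rel_position_uniq _ ((orbitP Hf sw).1 sO)); rewrite HE'.
exact/tri_rel_position/utri_tri/lr.
Qed.

Lemma orbit_schubert s : weyl_orbit iE sigma0 s ->
  orbit B (coord_flag b s) `<=` schubert s.
Proof.
move=> sW GG sO; split=> [|n H Hf GGE a S D Dl St]; first exact: orbit_Fl sO.
rewrite GGE in sO; have [l [sw lr _ HE]] := orbit_iflag Hf sW sO.
exists n => m nm; rewrite HE in St; apply: transv_count Dl St.
apply: utri_widen (En_mono nm) _.
by apply: utri_weaken lr.
Qed.

Definition opposite s : set (set (set V)) := [set GG |
  forall n H, iflag (En n) H -> GG = flag_from H ->
  forall a, transv (H a) [set e | s e <= a]%O].

Lemma orbit_opposite s : weyl_orbit iE sigma0 s ->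
  orbit B (coord_flag b s) `<=` opposite s.
Proof.
move=> sW GG sO n H Hf GGE a; rewrite GGE in sO.
by have [l [_ lr _ ->]] := orbit_iflag Hf sW sO; exact: tri_transv lr.
Qed.

Lemma wtype_narrow n m s : wtype (En m) s ->
  (forall e, e \notin En n -> s e = sigma0 e) -> wtype (En n) s.
Proof.
move=> sw s0n; have := wtype_widen (leq_maxr n m) sw => -[siE _ sc]; split=> // a.
have nm := En_mono (leq_maxl n m).
have := sc a; rewrite (count_widen _ nm) [RHS](count_widen _ nm).
rewrite (@eq_count _ (fun e => below s a e && (e \notin En n))
  (fun e => below sigma0 a e && (e \notin En n))); first exact: addIn.
by move=> e; case: (boolP (e \in En n)) => eI; rewrite ?andbF // /below s0n.
Qed.

Lemma sel_below s a n : sel [set e | s e <= a]%O n = [seq e <- En n | below s a e].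
Proof. by apply: eq_filter => e; rewrite asboolb. Qed.

(** A may be infinite, but openness needs finitely many minors. For general a the trace of H a is
    that of H (sigma0 j), where sigma0 j is the largest value <= a on E_n, or it is zero if there is
    no such value. *)
Lemma opposite_finite n H s : iflag (En n) H -> wtype (En n) s ->
  (forall j, j \in En n -> transv (H (sigma0 j)) [set e | s e <= sigma0 j]%O) ->
  forall a, transv (H a) [set e | s e <= a]%O.
Proof.
move=> Hf sw Hj a; have [Hs Hmono _] := Hf; have [siE s0 sc] := sw.
have [sH bH HP dH] := Hs a.
have vI v : H a v -> (forall e, (s e <= a)%O -> coef v e = 0) -> fspan b (En n) v.
  move=> Hv v0; apply/mem_fspan => e ve; apply: contraT => eI.
  by have := HP _ _ Hv eI ve; rewrite /below -s0 // => /v0 E0; rewrite E0 eqxx in ve.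
have outP e : e \notin En n -> (s e <= a)%O -> exists v, [/\ H a v, coef v e = 1 &
    forall j, (s j <= a)%O -> j != e -> coef v j = 0].
  move=> eI ea; exists (b e); split; first by apply: bH; rewrite // /below -s0.
    by rewrite coef_basis eqxx.
  by move=> j _ /negPf je; rewrite coef_basis je.
have [[j [jI ja jmax]]|no] := pselect (exists j, [/\ j \in En n, (sigma0 j <= a)%O &
    forall k, k \in En n -> (sigma0 k <= a)%O -> (sigma0 k <= sigma0 j)%O]).
  have [inj sur] := Hj j jI; have [sHj _ HPj _] := Hs (sigma0 j).
  have sj e : e \in En n -> (s e <= a)%O -> (s e <= sigma0 j)%O.
    apply: (@count_sub_eq _ (En n) (below s (sigma0 j)) (below s a)).
      by move=> x _ /le_trans; apply.
    rewrite !sc; apply: leq_count_in => x xI xa; exact: jmax.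
  split=> [v Hv v0|e /= ea].
    have vn := vI v Hv v0; apply: inj => [|e /= ej]; last by apply: v0; exact: le_trans ja.
    apply: (std_eq_in (Hs a) (Hs (sigma0 j)) _ _ Hv vn); last exact: Hmono.
    move=> k kI; apply/idP/idP; first exact: jmax.
    by move/le_trans; apply.
  have [eI|eI] := boolP (e \in En n); last exact: outP.
  have [v [Hv v1 v0]] := sur e (sj e eI ea); exists (restr (En n) v); split.
  - apply: (Hmono _ _ ja); apply: (mem_restr (Hs _) _).1 => // k.
    exact: HPj.
  - by rewrite coef_restr eI.
  - move=> k ka ke; rewrite coef_restr; case: ifP => // kI.
    by apply: v0 => //; exact: sj.
have none k : k \in En n -> ~~ (sigma0 k <= a)%O.
  move=> kI; apply: contra_notN no => ka.
  have [||| m] := @seq_min A (fun x y => y <= x)%O [seq sigma0 j | j <- En n & below sigma0 a j].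
  - by move=> x y; exact: le_total.
  - by move=> y x z xy yz; exact: le_trans xy.
  - apply: contraTneq isT => S0.
    have : sigma0 k \in [seq sigma0 j | j <- En n & below sigma0 a j].
      by apply: map_f; rewrite mem_filter kI andbT.
    by rewrite S0.
  move=> /mapP[j]; rewrite mem_filter => /andP[ja jI] -> jmax; exists j; split=> //.
  by move=> i iI ia; apply: jmax; apply: map_f; rewrite mem_filter iI andbT.
have noS e : e \in En n -> (s e <= a)%O = false.
  move=> eI; apply/negP => ea; have := sc a.
  rewrite [RHS](@eq_in_count _ _ pred0) => [|x xI]; last first.
    by rewrite /= /below (negPf (none x xI)).
  by rewrite count_pred0 => /eqP; rewrite -leqn0 leqNgt -has_count => /negP; apply; apply/hasP; exists e.
split=> [v Hv v0|e /= ea]; last first.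
  by apply: outP => //; apply/negP => eI; rewrite noS in ea.
have vn := vI v Hv v0.
have : row_of (En n) v \in vs (En n) (H a) by apply/mem_vs; rewrite ?row_ofK.
have -> : vs (En n) (H a) = 0%VS.
  apply/eqP; rewrite -dimv_eq0 dH (@eq_in_count _ _ pred0) ?count_pred0 // => x xI.
  by rewrite /= /below (negPf (none x xI)).
rewrite memv0 => /eqP r0.
by rewrite -(row_ofK vn) r0 (linear_apply0 (@vec_linear (En n))).
Qed.

Lemma opposite_open s : weyl_orbit iE sigma0 s -> ind_open Xind (opposite s).
Proof.
move=> /weyl_orbitP[m sw] n.
have [s0n|s0n] := pselect (forall e, e \notin En n -> s e = sigma0 e); last first.
  (* Without equations the complement is the whole n-th piece: transversality outside E_n would
     force s to agree with sigma0 there. *)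
  exists set0 => // GG x /coords_iflag[H [Hf GGE Hb]]; split=> // _ GGo.
  apply: s0n => e eI; have [Hs _ _] := Hf.
  have St a := GGo _ _ Hf GGE a.
  apply/eqP; rewrite eq_le; apply/andP; split.
    by apply/(transv_off (Hs (sigma0 e)) (St (sigma0 e)) eI); rewrite /below.
  by apply/(transv_off (Hs (s e)) (St (s e)) eI) => /=.
have swn := wtype_narrow sw s0n; have [siE _ sc] := swn.
pose P x := \prod_(j <- En n)
  \det (minor_mx (sigma0 j) [seq e <- En n | below s (sigma0 j) e] x).
exists [set P].
  by move=> _ ->; apply: polyfun_prod => j; exact: polyfun_minor.
move=> GG x /coords_iflag[H [Hf GGE Hb]].
have Hs a : std (En n) (below sigma0 a) (H a) by case: Hf.
have tP a : transv (H a) [set e | s e <= a]%O <->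
    \det (minor_mx a [seq e <- En n | below s a e] x) != 0.
  rewrite (transv_frame _ (Hs a) (Hb a)) sel_below unitmxE unitfE.
  split=> [[]//|dN0]; split=> // [e eI|]; first by rewrite /= /below s0n.
  by rewrite size_filter sc.
split=> [GGo _ ->|/(_ P erefl) Px0 GGo]; last first.
  move/eqP: Px0; apply/negP; rewrite prodf_seq_neq0; apply/allP => j jI /=.
  exact/tP/(GGo _ _ Hf GGE).
apply/eqP; apply: contra_notT GGo; rewrite prodf_seq_neq0 => /allP Px k H' H'f GGE' a.
have <- : H = H' by apply: (flag_from_inj Hf H'f); rewrite -GGE.
by apply: (opposite_finite Hf swn) => j jI; apply/tP; exact: Px.
Qed.

(** Let t be the relative position of a flag in the intersection. The flag is transverse to the
    column sets of both s and t and satisfies the rank conditions of both, so s and t dominate each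
    other and are equal. *)
Lemma orbit_locally_closed s : weyl_orbit iE sigma0 s ->
  ind_locally_closed Xind (orbit B (coord_flag b s)).
Proof.
move=> sW; exists (opposite s), (schubert s).
split; [exact: opposite_open|exact: schubert_closed|].
apply/seteqP; split=> [GG sO|GG [GGo [GX GGc]]].
  by split; [exact: orbit_opposite|exact: orbit_schubert].
have [n [H [Hf GGE]]] := Fl_iflag GX.
have [t [tw tW tO]] := iflag_orbit Hf; rewrite GGE.
suff -> : s = t by [].
have cnt a D : lower D -> exists m0, forall m, (m0 <= m)%N ->
    count (fun e => below s a e && D e) (En m) = count (fun e => below t a e && D e) (En m).
  move=> Dl.
  have countE r m : count_set [set e | r e <= a]%O D m =
      count (fun e => below r a e && D e) (En m).
    by apply: eq_count => e; rewrite asboolb.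
  have [m1 m1P] := GGc _ _ Hf GGE a _ D Dl (orbit_opposite tW tO Hf erefl a).
  have [_ ttc] := orbit_schubert tW tO.
  have [m2 m2P] := ttc _ _ Hf erefl a _ D Dl (GGo _ _ Hf GGE a).
  exists (maxn m1 m2) => m; rewrite geq_max => /andP[/m1P le1 /m2P le2].
  by apply/eqP; rewrite -(countE s) -(countE t) eqn_leq; apply/andP; split;
     [rewrite countE in le1 *|rewrite countE in le2 *]; rewrite ?countE.
apply/funext => e.
have half a : (s e <= a)%O = (t e <= a)%O.
  (* The counts over the lower sets {j <= e} and {j < e} differ by the place e alone, which recovers
     the truth value of s e <= a. *)
  have [|m1 m1P] := cnt a (leB^~ e); first by move=> x y /ltBW xy; exact: leB_trans.
  have [|m2 m2P] := cnt a (lt^~ e); first by move=> x y xy; exact: ltB_trans.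
  have [m3 em3] := En_exhaust e; pose m := maxn m1 (maxn m2 m3).
  have em : e \in En m.
    by apply: (fsubsetP (En_mono _)) em3; rewrite /m !leq_max leqnn !orbT.
  have := m1P m (leq_maxl _ _).
  have split_le r : count (fun j => below r a j && leB j e) (En m) =
      (count (fun j => below r a j && lt j e) (En m) + below r a e)%N.
    have -> : (below r a e : nat) = count (fun j => (j == e) && below r a e) (En m).
      case: (below r a e); last by rewrite -[LHS](count_pred0 (En m)); apply: eq_count => j; rewrite andbF.
      rewrite -[LHS](_ : count_mem e (En m) = _); last by rewrite count_uniq_mem ?fset_uniq ?em.
      by apply: eq_count => j; rewrite andbT.
    rewrite -count_predUI [X in (_ = _ + X)%N](@eq_count _ _ pred0) ?count_pred0 ?addn0.
      apply: eq_count => j /=; rewrite leB_eqVlt; have [->|_] := eqVneq j e.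
        by rewrite ltB_irr andbF andbT.
      by rewrite orbF.
    by move=> j /=; have [->|] := eqVneq j e; rewrite ?ltB_irr ?andbF.
  rewrite !split_le m2P; last by rewrite /m !leq_max leqnn !orbT.
  by move/addnI; rewrite /below; case: (s e <= a)%O; case: (t e <= a)%O.
by apply/eqP; rewrite eq_le half lexx -half lexx.
Qed.

Lemma closure_dominates s t : weyl_orbit iE sigma0 s -> weyl_orbit iE sigma0 t ->
  ind_closure Xind (orbit B (coord_flag b t)) (coord_flag b s) ->
  forall a D, lower D -> exists m0, forall m, (m0 <= m)%N ->
    (count (fun e => below t a e && D e) (En m) <=
     count (fun e => below s a e && D e) (En m))%N.
Proof.
move=> sW tW st a D Dl; have [n sw] := (weyl_orbitP s).1 sW.
have : schubert t (coord_flag b s).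
  by apply: st; split; [exact: schubert_closed|exact: orbit_schubert].
move=> [_ st']; have Gb : Gom omega b (lin b) by rewrite lin_basis_id; exact: G_id.
have bu : utri (En n) (fun _ _ => True) b.
  by move=> e; rewrite coef_basis eqxx; split=> // j je; rewrite coef_basis (negPf je) eqxx.
have bE := @coord_flagE b s Gb (let: And3 siE _ _ := sw in siE).
have Hf : iflag (En n) (hi_ b s) by apply: wtype_iflag => //; exact: utri_local bu.
have [m0 m0P] := st' _ _ Hf bE a _ D Dl (tri_transv s a bu).
exists m0 => m /m0P; rewrite /count_set; congr (_ <= _)%N.
by apply: eq_count => e; rewrite asboolb.
Qed.

(** * The dominance order and the Bruhat order *)

Definition lowerA (L : pred A) := forall x y, (x <= y)%O -> L y -> L x.

Section TableauCriterion.
Variables (n : nat) (t : E -> A).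
Hypothesis tw : wtype (En n) t.

Let cnt s (L : pred A) (D : pred E) := count (fun j => L (s j) && D j) (En n).

Lemma lowerA_max (S : seq A) (L : pred A) : lowerA L -> (exists2 x, x \in S & L x) ->
  exists c, {in S, forall x, L x = (x <= c)%O}.
Proof.
move=> Ll [x xS Lx].
have [||| m] := @seq_min A (fun x y => y <= x)%O [seq x <- S | L x].
- by move=> u v; exact: le_total.
- by move=> v u w uv vw; exact: le_trans uv.
- apply: contraTneq isT => S0; have : x \in [seq x <- S | L x] by rewrite mem_filter Lx.
  by rewrite S0.
rewrite mem_filter => /andP[Lm mS] mP; exists m => y yS.
by apply/idP/idP => [Ly|/Ll]; [apply: mP; rewrite mem_filter Ly|exact].
Qed.

(** Among the finitely many values taken on E_n, a lower set is empty or principal. The relation [R]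
    covers both equality and inequality of counts. *)
Lemma cnt_lowerA s L (R : nat -> nat -> Prop) : lowerA L -> R 0%N 0%N ->
  forall D, (forall a, R (cnt t (fun x => x <= a)%O D) (cnt s (fun x => x <= a)%O D)) ->
  R (cnt t L D) (cnt s L D).
Proof.
move=> Ll R0 D RD; pose S := [seq s j | j <- En n] ++ [seq t j | j <- En n].
have sS j : j \in En n -> s j \in S by move=> jn; rewrite mem_cat map_f.
have tS j : j \in En n -> t j \in S by move=> jn; rewrite mem_cat (map_f t) ?orbT.
have [ex|no] := pselect (exists2 x, x \in S & L x); last first.
  have z r : (forall j, j \in En n -> r j \in S) -> cnt r L D = 0%N.
    move=> rS; rewrite -(count_pred0 (En n)); apply: eq_in_count => j jn /=.
    by case: (boolP (L (r j))) => //= Lr; case: no; exists (r j) => //; exact: rS.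
  by rewrite !z.
have [c cP] := lowerA_max Ll ex.
have z r : (forall j, j \in En n -> r j \in S) -> cnt r L D = cnt r (fun x => x <= c)%O D.
  by move=> rS; apply: eq_in_count => j jn /=; rewrite cP // rS.
by rewrite !z.
Qed.

Lemma cnt_total s L : wtype (En n) s -> lowerA L -> cnt t L predT = cnt s L predT.
Proof.
move=> [_ _ sc] Ll; apply: (cnt_lowerA (R := eq)) => // a.
have E0 r : cnt r (fun x => x <= a)%O predT = count (below r a) (En n).
  by apply: eq_count => j; rewrite andbT.
by rewrite !E0 sc; case: tw.
Qed.

Definition dom s := forall L D, lowerA L -> lower D -> (cnt t L D <= cnt s L D)%N.

(* Reflection by i_A and i_E exchanges a pair of lower sets and the pair of
   their reflected complements. *)
Lemma cnt_reflect s L D : wtype (En n) s -> lowerA L -> lower D ->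
  let L' x := ~~ L (iA x) in let D' j := ~~ D (iE j) in
  (cnt s L D + cnt t L' D' = cnt t L D + cnt s L' D')%N.
Proof.
move=> sw Ll Dl L' D'.
have L'l : lowerA L' by move=> x y xy; apply: contraNN; apply: Ll; rewrite iA_anti.
have E0 r : (forall e, r (iE e) = iA (r e)) ->
    (cnt r L D + cnt r L' predT + count D' (En n) = size (En n) + cnt r L' D')%N.
  move=> riE; rewrite /cnt -(count_iE n (fun j => L (r j) && D j)).
  rewrite -(count_predC (predU (fun j => L' (r j)) D') (En n)).
  rewrite -!addnA [RHS]addnCA; congr (_ + _)%N.
    by apply: eq_count => j /=; rewrite /L' /D' riE negb_or !negbK.
  rewrite -[X in _ = (_ + X)%N]/(count (predI (fun j => L' (r j)) D') (En n)).
  rewrite count_predUI; congr (_ + _)%N.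
  by apply: eq_count => j; rewrite /= andbT.
have [siE _ _] := sw; have [tiE _ _] := tw.
by have := E0 s siE; have := E0 t tiE; rewrite (cnt_total sw L'l); lia.
Qed.

Section Step.
Variable s : E -> A.
Hypothesis sw : wtype (En n) s.
Hypothesis sdom : dom s.
Variable e : E.
Hypothesis en : e \in En n.
Hypothesis se : s e != t e.
Hypothesis emin : forall j, j \in En n -> s j != t j -> leB e j.

Let siE x : s (iE x) = iA (s x). Proof. by case: sw. Qed.
Let tiE x : t (iE x) = iA (t x). Proof. by case: tw. Qed.

Lemma first_lt : (s e < t e)%O.
Proof.
rewrite ltNge; apply/negP => te; have te' : (t e < s e)%O by rewrite lt_neqAle eq_sym se.
have := @sdom (fun x => x <= t e)%O (leB^~ e).
move=> /(_ (fun x y xy => le_trans xy) (fun x y xy => leB_trans (ltBW xy))).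
rewrite leqNgt => /negP; apply; apply: (@ltn_count_in _ _ _ _ e) => //.
- move=> j jn /andP[/= sj]; rewrite leB_eqVlt => /predU1P[je|je].
    by rewrite je leNgt te' in sj.
  rewrite je orbT andbT; suff -> : t j = s j by [].
  by apply/esym/eqP; apply: contraTT je => /(emin jn); rewrite ltBNge negbK.
- by rewrite lexx leB_refl.
- by rewrite leNgt te'.
Qed.

Lemma first_nonfixed : iE e <> e.
Proof. by move=> ee; move/eqP: se; apply; exact: wtype_fixed sw tw ee. Qed.

Lemma first_lt_iE : lt e (iE e).
Proof.
rewrite /ltB eq_sym; apply/andP; split; first exact/eqP/first_nonfixed.
by apply: emin; rewrite ?En_iE // siE tiE (inj_eq (inv_inj iA_inv)).
Qed.

Definition swap_cand f := [&& f \in En n, iE f != f, lt e f, (s e < s f)%O & (s f <= t e)%O].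

Lemma ex_swap_cand : exists2 f, swap_cand f & forall j, swap_cand j -> leB f j.
Proof.
have [j cj] : exists j, swap_cand j.
  apply: contrapT => no.
  have : (count (fun x => s x == t e) (En n) < count (fun x => t x == t e) (En n))%N.
    apply: (@ltn_count_in _ _ _ _ e) => // j jn /eqP sj.
    apply: contraT => tj; case: no; exists j.
    have sjt : s j != t j by rewrite sj eq_sym.
    rewrite /swap_cand jn sj lexx first_lt /= andbT.
    apply/andP; split; first by apply/eqP => /(wtype_fixed sw tw)/eqP; rewrite (negPf sjt).
    rewrite /ltB emin // andbT; by apply: contraNneq tj => ->.
  have [_ _ sc] := sw; have [_ _ tc] := tw.
  by rewrite (@count_value _ s t) ?ltnn // => c; rewrite sc tc.
have [||| f] := @seq_min E leB [seq j <- En n | swap_cand j].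
- by move=> x y; exact: leB_total.
- by move=> y x z; exact: leB_trans.
- apply: contraTneq isT => S0; have : j \in [seq j <- En n | swap_cand j].
    by rewrite mem_filter cj; case/and5P: cj.
  by rewrite S0.
rewrite mem_filter => /andP[cf _] fP; exists f => // k ck.
by apply: fP; rewrite mem_filter ck; case/and5P: ck.
Qed.

Variable f : E.
Hypothesis fc : swap_cand f.
Hypothesis fmin : forall j, swap_cand j -> leB f j.

(** L is enlarged to L', the values <= t e. A place of D whose value under s lies in L' but not in L
    is unmoved: otherwise it would be a candidate, so f would precede it and lie in D. But t also
    has its value at e in this range, so t counts strictly more there; dominance for L' leaves a
    strict inequality for L. *)
Lemma cnt_rect L D : lowerA L -> lower D -> D e -> ~~ D f -> L (s e) -> ~~ L (s f) ->
  (cnt t L D < cnt s L D)%N.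
Proof.
move=> Ll Dl De Df Le Lf; have /and5P[fn ff ef sef sft] := fc.
pose L' x := (x <= t e)%O.
have LL' x : L x -> L' x.
  move=> Lx; rewrite /L' leNgt; apply: contraNN Lf => tx; apply: Ll Lx.
  exact: le_trans sft (ltW tx).
have split_cnt r : cnt r L' D = (cnt r L D +
    count (fun j => [&& ~~ L (r j), L' (r j) & D j]) (En n))%N.
  rewrite /cnt -count_predUI [X in (_ + X)%N](@eq_count _ _ pred0).
    rewrite count_pred0 addn0; apply: eq_count => j /=.
    by case: (boolP (L (r j))) => //= /LL' ->; rewrite orbF.
  by move=> j /=; case: (L (r j)); rewrite ?andbF.
have L'l : lowerA L' by move=> x y; exact: le_trans.
have := sdom L'l Dl; rewrite !split_cnt => /ltn_of_leq_add; apply.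
apply: (@ltn_count_in _ _ _ _ e) => //.
- move=> j jn /and3P[Lj L'j Dj]; suff <- : s j = t j by rewrite Lj L'j.
  apply/eqP; apply: contraT => sj; have ej := emin jn sj.
  have [je|je] := eqVneq e j; first by rewrite -je Le in Lj.
  have : swap_cand j.
    rewrite /swap_cand jn (L'j : (s j <= t e)%O) andbT /ltB je ej /=; apply/andP; split.
      by apply/eqP => /(wtype_fixed sw tw)/eqP; rewrite (negPf sj).
    by rewrite ltNge; apply: contraNN Lj => /Ll; apply.
  move/fmin => fj; case/negP: Df.
  by move: fj; rewrite leB_eqVlt => /predU1P[->//|fj]; exact: Dl fj Dj.
- rewrite /L' lexx De !andbT; apply: contraNN Lf => Lt; apply: Ll Lt; exact: sft.
- by rewrite Le.
Qed.

(** Mirror image of [cnt_rect]: by [cnt_reflect] the lower sets are replaced by their reflected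
    complements, which place e and f as required. *)
Lemma cnt_rect_iE L D : lowerA L -> lower D -> D (iE f) -> ~~ D (iE e) ->
  L (s (iE f)) -> ~~ L (s (iE e)) -> (cnt t L D < cnt s L D)%N.
Proof.
move=> Ll Dl Df De Lf Le; have := cnt_reflect sw Ll Dl => /=.
have := @cnt_rect (fun x => ~~ L (iA x)) (fun j => ~~ D (iE j)).
rewrite -!siE Df De Lf Le /= => /(_ _ _ isT isT isT isT) c.
suff : (cnt t (fun x => ~~ L (iA x)) (fun j => ~~ D (iE j)) <
        cnt s (fun x => ~~ L (iA x)) (fun j => ~~ D (iE j)))%N by lia.
apply: c => [x y xy|j k jk]; apply: contraNN.
  by apply: Ll; rewrite iA_anti.
by apply: Dl; rewrite ltB_iE.
Qed.

Let rect e' f' (L : pred A) (D : pred E) := [&& D e', ~~ D f', L (s e') & ~~ L (s f')].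

(** Reindexing by the transposition moves the condition on places and leaves the values of s alone;
    outside the two exchanged places nothing changes, and there [swap_rect] applies. *)
Lemma cnt_swap_iE g L D : g \in En n -> lt g (iE g) -> (s g < s (iE g))%O ->
  lowerA L -> lower D ->
  (cnt (s \o transp_om iE g (iE g)) L D + rect g (iE g) L D = cnt s L D)%N.
Proof.
move=> gn gg sg Ll Dl; have g_ig : g <> iE g by apply/eqP; exact: ltB_neq.
have igg : iE g <> g by move=> E0; rewrite E0 in g_ig.
have iigg : iE (iE g) <> iE g by rewrite iE_inv.
have ign : iE g \in En n by rewrite En_iE.
have tK := transp_omK g_ig igg iigg.
rewrite /cnt -(count_transp (fun j => L ((s \o transp_om iE g (iE g)) j) && D j)
  g_ig igg iigg gn ign) /=.
have -> : count (fun x => L (s (transp_om iE g (iE g) (transp_om iE g (iE g) x))) &&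
    D (transp_om iE g (iE g) x)) (En n) =
    count (fun x => L (s x) && D (transp_om iE g (iE g) x)) (En n).
  by apply: eq_count => x; rewrite tK.
have un : uniq (En n) by exact: fset_uniq.
rewrite (count_D1 _ un gn) [RHS](count_D1 _ un gn).
rewrite (count_D1 _ un ign) [X in _ = (_ + X)%N](count_D1 _ un ign).
have -> : count (fun y => (L (s y) && D (transp_om iE g (iE g) y) && (y != g)) && (y != iE g)) (En n) =
    count (fun y => (L (s y) && D y && (y != g)) && (y != iE g)) (En n).
  apply: eq_count => y; rewrite transp_omE // iE_inv.
  by case: (eqVneq y g) => //= _; rewrite ?andbF //; case: (eqVneq y (iE g)); rewrite /= ?andbF.
rewrite !transp_omE // !eqxx (introF eqP igg) /= ?(introF eqP g_ig) /rect.
have DD : D (iE g) -> D g by exact: Dl.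
have LL : L (s (iE g)) -> L (s g) by apply: Ll; exact: ltW.
rewrite !andbT addnA addnAC [RHS]addnA; congr (_ + _)%N.
exact: swap_rect.
Qed.

Lemma cnt_swap g h L D : g \in En n -> h \in En n -> h <> iE g ->
  iE g <> g -> iE h <> h -> lt g h -> (s g < s h)%O -> lowerA L -> lower D ->
  (cnt (s \o transp_om iE g h) L D + rect g h L D + rect (iE h) (iE g) L D
   = cnt s L D)%N.
Proof.
move=> gn hn hg gg hh gh sgh Ll Dl; have g_h : g <> h by apply/eqP; exact: ltB_neq.
have tK := transp_omK g_h gg hh.
rewrite /cnt -(count_transp (fun j => L ((s \o transp_om iE g h) j) && D j)
  g_h gg hh gn hn) /=.
have -> : count (fun x => L (s (transp_om iE g h (transp_om iE g h x))) &&
    D (transp_om iE g h x)) (En n) =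
    count (fun x => L (s x) && D (transp_om iE g h x)) (En n).
  by apply: eq_count => x; rewrite tK.
have un : uniq (En n) by exact: fset_uniq.
have ign : iE g \in En n by rewrite En_iE.
have ihn : iE h \in En n by rewrite En_iE.
have := transp_om4 g_h gg hh hg; rewrite /= !inE !negb_or !andbT.
case/and3P=> /and3P[n1 n2 n3] /andP[n4 n5] n6.
have out P : count P (En n) = (P g + P h + P (iE g) + P (iE h) +
    count (fun y => P y && (y \notin [:: g; h; iE g; iE h])) (En n))%N.
  rewrite (count_D1 P un gn) (count_D1 _ un hn) (count_D1 _ un ign) (count_D1 _ un ihn).
  rewrite [h == g]eq_sym n1 [iE g == g]eq_sym n2 [iE h == g]eq_sym n3.
  rewrite [iE g == h]eq_sym n4 [iE h == h]eq_sym n5 [iE h == iE g]eq_sym n6 !andbT !addnA.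
  congr (_ + _)%N; apply: eq_count => y; rewrite !inE !negb_or.
  by rewrite -!andbA.
rewrite out [RHS]out.
have -> : count (fun y => L (s y) && D (transp_om iE g h y) && (y \notin [:: g; h; iE g; iE h])) (En n) =
    count (fun y => L (s y) && D y && (y \notin [:: g; h; iE g; iE h])) (En n).
  apply: eq_count => y; case: (boolP (y \in _)); rewrite ?andbF // !inE !negb_or => /and4P[y1 y2 y3 y4].
  by rewrite transp_omE // (negPf y1) (negPf y2) (negPf y3) (negPf y4).
have neq (x y : E) : x != y -> (y == x) = false by rewrite eq_sym => /negPf.
rewrite !transp_omE // !eqxx (neq _ _ n1) (neq _ _ n2) (neq _ _ n3) (neq _ _ n4).
rewrite (neq _ _ n5) (neq _ _ n6) /rect.
have D1 : D h -> D g by exact: Dl.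
have L1 : L (s h) -> L (s g) by apply: Ll; exact: ltW.
have D2 : D (iE g) -> D (iE h) by apply: Dl; rewrite ltB_iE.
have L2 : L (s (iE g)) -> L (s (iE h)) by apply: Ll; rewrite !siE iA_anti; exact: ltW.
by apply: addn_swap2; exact: swap_rect.
Qed.

(** If iE e < f, then [cnt_rect] gives a strict inequality between the counts of values <= s e at
    places <= iE e. Beyond iE e the maps s and t agree, by the minimality of e and the symmetry, and
    the total counts are equal: a contradiction. *)
Lemma le_swap_cand_iE : leB f (iE e).
Proof.
have /and5P[fn ff ef sef sft] := fc; apply: contraT; rewrite -ltBNge => ief.
have := @cnt_rect (fun x => x <= s e)%O (leB^~ (iE e)).
move=> /(_ (fun x y xy => le_trans xy) (fun x y xy => leB_trans (ltBW xy))).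
rewrite (ltBW first_lt_iE) -ltBNge ief lexx -ltNge sef => /(_ isT isT isT isT).
have Ll : lowerA (fun x => x <= s e)%O by move=> x y; exact: le_trans.
have split_cnt r : cnt r (fun x => x <= s e)%O predT =
    (cnt r (fun x => x <= s e)%O (leB^~ (iE e)) +
     cnt r (fun x => x <= s e)%O (lt (iE e)))%N.
  rewrite /cnt (eq_count (a2 := fun j => r j <= s e)%O) => [|j]; last by rewrite andbT.
  rewrite -[LHS]size_filter -(count_predC (leB^~ (iE e))) !count_filter.
  by congr (_ + _)%N; apply: eq_count => j; rewrite /= ?ltBNge andbC.
have := cnt_total sw Ll; rewrite !split_cnt.
have -> : cnt s (fun x => x <= s e)%O (lt (iE e)) = cnt t (fun x => x <= s e)%O (lt (iE e)).
  apply: eq_in_count => j jn; case: (boolP (lt (iE e) j)); rewrite ?andbF // !andbT => ij.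
  suff -> : s j = t j by [].
  apply/eqP; apply: contraT => sj; have := emin (j := iE j).
  rewrite En_iE siE tiE (inj_eq (inv_inj iA_inv)) => /(_ jn sj).
  by rewrite -leB_iE iE_inv -[leB _ _]negbK -ltBNge ij.
by move=> /addIn ->; rewrite ltnn.
Qed.

(* The dominance order is generated by reflections: exchange the first place
   [e] where [s] and [t] differ with the next place [f] whose value lies in
   ]s e, t e]; if the two rectangles involved meet, exchange [e] and [i_E e]. *)
Lemma dom_step : exists s', [/\ lt_om_step iE leB s s', wtype (En n) s', dom s',
  forall L D, lowerA L -> lower D -> (cnt s' L D <= cnt s L D)%N &
  (cnt s' (fun x => x <= s e)%O (leB^~ e) < cnt s (fun x => x <= s e)%O (leB^~ e))%N].
Proof.
have /and5P[fn /eqP ff ef sef sft] := fc; have ee := first_nonfixed.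
have e_f : e <> f by apply/eqP; exact: ltB_neq.
have Ll : lowerA (fun x => x <= s e)%O by move=> x y; exact: le_trans.
have Dl : lower (leB^~ e) by move=> x y xy; exact: leB_trans (ltBW xy).
have single g : g = iE e -> (s e < s g)%O ->
    (forall L D, lowerA L -> lower D -> rect e g L D -> (cnt t L D < cnt s L D)%N) ->
    exists s', [/\ lt_om_step iE leB s s', wtype (En n) s', dom s',
      forall L D, lowerA L -> lower D -> (cnt s' L D <= cnt s L D)%N &
      (cnt s' (fun x => x <= s e)%O (leB^~ e) < cnt s (fun x => x <= s e)%O (leB^~ e))%N].
  move=> gE sg dR; have e_g : e <> g by rewrite gE => /esym.
  have gg : iE g <> g by rewrite gE iE_inv => /esym.
  have gn : g \in En n by rewrite gE En_iE.
  exists (s \o transp_om iE e g); rewrite gE in sg dR *.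
  have cE L D := @cnt_swap_iE e L D en first_lt_iE sg.
  split.
  - exists e, (iE e); split=> //; [by rewrite -gE|by rewrite -gE; split=> // /esym|].
    exact: first_lt_iE.
  - by rewrite -gE; exact: wtype_transp.
  - move=> L D LL DD; have := cE L D LL DD; case: (boolP (rect e (iE e) L D)) => R /=.
      by have := dR L D LL DD R; rewrite addn1 => h1 h2; rewrite -ltnS h2.
    by rewrite addn0 => ->; exact: sdom.
  - by move=> L D LL DD; rewrite -(cE L D LL DD) leq_addr.
  - rewrite -(cE _ _ Ll Dl) /rect leB_refl lexx -ltNge sg -ltBNge first_lt_iE addn1.
    exact: ltnSn.
have [fie|/eqP fie] := eqVneq f (iE e).
  apply: (single f) => // L D LL DD /and4P[*]; exact: cnt_rect.
have [/and3P[iff sif sie]|far] := boolP [&& lt (iE f) f, (s (iE f) < s f)%O & (s e < s (iE e))%O].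
  apply: (single (iE e)) => // L D LL DD /and4P[De Die Le Lie].
  (* The place iE f precedes f, so it is no candidate, which bounds its value. A rectangle met by
     the exchange of e and iE e is then covered by the mirror rectangle of e and f if f lies in D,
     and by the rectangle of e and f itself otherwise. *)
  have sife : (s (iE f) <= s e)%O.
    rewrite leNgt; apply/negP => esf; have : swap_cand (iE f).
      rewrite /swap_cand En_iE fn iE_inv eq_sym (introN eqP ff) esf /=.
      rewrite (le_trans (ltW sif) sft) andbT -[e]iE_inv ltB_iE /ltB le_swap_cand_iE.
      by rewrite andbT; apply/eqP.
    by move/fmin; rewrite -[leB _ _]negbK -ltBNge iff.
  have sief : (s (iE e) <= s f)%O by rewrite -[f]iE_inv !siE iA_anti -siE.
  have [Df|Df] := boolP (D f).
    apply: cnt_rect_iE => //; first exact: DD iff Df.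
    exact: LL sife Le.
  by apply: cnt_rect => //; apply: contraNN Lie; exact: LL.
have cE L D := @cnt_swap e f L D en fn fie ee ff ef sef.
exists (s \o transp_om iE e f); split.
- by exists e, f.
- exact: wtype_transp.
- move=> L D LL DD; have := cE L D LL DD.
  case: (boolP (rect e f L D)) => [/and4P[De Df Le Lf]|_].
    (* The strictness of [cnt_rect] and [cnt_rect_iE] makes up for a loss of one, not of two: the
       rectangle and its mirror image must not be met together, which is what [far] excludes. *)
    have -> : rect (iE f) (iE e) L D = false.
      apply: contraNF far => /and4P[Dif Die Lif Lie]; apply/and3P; split.
      + by rewrite ltBNge leB_eqVlt; apply/norP; split;
          [apply: contraNneq Df => ->|apply: contraNN Df => /DD; exact].
      + by rewrite ltNge; apply: contraNN Lf => /LL; exact.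
      + by rewrite ltNge; apply: contraNN Lie => /LL; exact.
    have := cnt_rect LL DD De Df Le Lf.
    by rewrite /= addn1 addn0 => h1 h2; rewrite -ltnS h2.
  rewrite /= addn0; case: (boolP (rect (iE f) (iE e) L D)) => [/and4P[Dif Die Lif Lie]|_].
    have := cnt_rect_iE LL DD Dif Die Lif Lie.
    by rewrite /= addn1 => h1 h2; rewrite -ltnS h2.
  by rewrite addn0 => ->; exact: sdom.
- by move=> L D LL DD; rewrite -(cE L D LL DD) -addnA leq_addr.
- rewrite -(cE _ _ Ll Dl) /rect leB_refl lexx -ltNge sef -ltBNge ef addn1 addSn.
  by rewrite ltnS leq_addr.
Qed.

End Step.

(** Induction on the sum of the counts over all principal pairs of lower sets given by values and
    places of E_n. A step of [dom_step] raises none of them and lowers the one at (s e, e). *)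
Theorem dom_le_om s : wtype (En n) s -> dom s -> le_om iE leB s t.
Proof.
pose F s (z : E * E) := cnt s (fun x => x <= sigma0 z.1)%O (leB^~ z.2).
pose Z := [seq (q, p) | q <- En n, p <- En n].
have [m] := ubnP (\sum_(z <- Z) F s z); elim: m s => // m IHm s.
rewrite ltnS => sm sw sdom.
have [[x xn sx]|no] := pselect (exists2 x, x \in En n & s x != t x); last first.
  right; apply/funext => x; have [xn|xn] := boolP (x \in En n).
    by apply/eqP; apply: contraT => sx; case: no; exists x.
  by have [[_ s0 _] [_ t0 _]] := (sw, tw); rewrite s0 // t0.
have [||| e] := @seq_min E leB [seq x <- En n | s x != t x].
- by move=> y z; exact: leB_total.
- by move=> y z w; exact: leB_trans.
- apply: contraTneq isT => S0; have : x \in [seq x <- En n | s x != t x].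
    by rewrite mem_filter sx.
  by rewrite S0.
rewrite mem_filter => /andP[se en] eP.
have emin j : j \in En n -> s j != t j -> leB e j.
  by move=> jn sj; apply: eP; rewrite mem_filter sj.
have [f fc fmin] := ex_swap_cand sw sdom en se emin.
have [s' [st s'w s'dom le_s' lt_s']] := dom_step sw sdom en se emin fc fmin.
have les' : le_om iE leB s' t.
  apply: IHm => //; apply: leq_trans sm.
  have [q qn qE] : exists2 q, q \in En n & sigma0 q = s e.
    have : has (fun q => sigma0 q == s e) (En n).
      have [_ _ sc] := sw; rewrite has_count -(@count_value _ s sigma0) //.
      by rewrite -has_count; apply/hasP; exists e.
    by move=> /hasP[q qn /eqP qE]; exists q.
  apply: (@ltn_sum_seq _ _ _ _ (q, e)).
  - by apply/allpairsP; exists (q, e).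
  - move=> z; apply: le_s'; first by move=> u v; exact: le_trans.
    by move=> u v uv; exact: leB_trans (ltBW uv).
  - by rewrite /F /= qE.
left; case: les' => [les'|<-]; last exact: t_step.
by apply: t_trans les'; exact: t_step.
Qed.

End TableauCriterion.

(** * Closures of orbits *)

Lemma polyfun_curve (Y : Type) (p : (Y -> K) -> K) (c : K -> Y -> K) : polyfun p ->
  (forall y, exists q : {poly K}, forall z, c z y = q.[z]) ->
  exists Q : {poly K}, forall z, p (c z) = Q.[z].
Proof.
move=> [k [P [y ->]]] cq.
have [q qE] : exists q : 'I_k -> {poly K}, forall i z, c z (y i) = (q i).[z].
  by have [q qP] := choice (fun i => cq (y i)); exists q.
exists (\sum_(m <- msupp P) P@_m *: \prod_i q i ^+ m i) => z.
rewrite mevalE horner_sum; apply: eq_bigr => m _; rewrite hornerZ horner_prod.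
by congr (_ * _); apply: eq_bigr => i _; rewrite horner_exp /= qE.
Qed.

Lemma natr_eq0 k : (k%:R == 0 :> K) = (k == 0)%N.
Proof. exact: (pcharf0P K).1 charK k. Qed.

Lemma two_neq0 : 2%:R != 0 :> K.
Proof. by rewrite natr_eq0. Qed.

(** In characteristic zero 1, 2, 3, ... are distinct nonzero roots, more than the degree allows. *)
Lemma poly_eq0_punctured (Q : {poly K}) : (forall z, z != 0 -> Q.[z] = 0) -> Q.[0] = 0.
Proof.
move=> Q0; suff -> : Q = 0 by rewrite horner0.
apply: (@roots_geq_poly_eq0 _ _ [seq (i.+1)%:R | i <- iota 0 (size Q)]).
- by apply/allP => _ /mapP[i _ ->]; apply/eqP/Q0; rewrite natr_eq0.
- rewrite map_inj_uniq ?iota_uniq // => i j /eqP.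
  wlog ij : i j / (i <= j)%N.
    by move=> H; case: (leqP i j) => [/H//|/ltnW/H h]; rewrite eq_sym => /h.
  rewrite eq_sym -subr_eq0 -natrB // natr_eq0 subSS subn_eq0 => ji.
  by apply/eqP; rewrite eqn_leq ij.
- by rewrite size_map size_iota.
Qed.

(** Along a curve polynomial in z, each equation of the closed set becomes a polynomial in one
    variable. *)
Lemma closed_curve n s (l : K -> E -> V) C : wtype (En n) s ->
  (forall z, local (En n) (l z)) -> (forall z, isom (l z)) ->
  (forall e f, exists q : {poly K}, forall z, coef (l z e) f = q.[z]) ->
  ind_closed Xind C -> (forall z, z != 0 -> C (coord_flag (l z) s)) ->
  C (coord_flag (l 0) s).
Proof.
move=> sw ll li lq /(_ n)[S Spoly SC] Cz; apply/(SC _ _ (coords_flag sw (ll 0) (li 0))).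
move=> p Sp; have [Q QE] := polyfun_curve (c := fun z => flag_coords n (l z) s)
  (Spoly _ Sp) (fun y => lq _ _).
rewrite QE; apply: poly_eq0_punctured => z z0; rewrite -QE.
exact: (SC _ _ (coords_flag sw (ll z) (li z))).1 (Cz z z0) p Sp.
Qed.

Lemma B_comp g h : B g -> B h -> B (g \o h).
Proof.
move=> [Gg gF] [Gh hF]; split; first exact: G_comp.
by move=> F FF_; rewrite -image_comp hF // gF.
Qed.

Lemma orbit_act g s GG : B g -> orbit B (coord_flag b s) GG ->
  orbit B (coord_flag b s) (act g GG).
Proof.
by move=> Bg [h Bh <-]; exists (g \o h); [exact: B_comp|rewrite act_comp].
Qed.

(* The unipotent isometries exp(z N), N v = omega(u,v) w - omega(v,w) u, for u
   isotropic and orthogonal to w. *)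
Definition transvection (u w : V) (z : K) (v : V) : V :=
  v + (z * omega u v) *: w -
  (z * omega v w + z ^+ 2 / 2%:R * omega w w * omega u v) *: u.

Lemma omega_expand3 u w p r p' r' v v' : omega u u = 0 -> omega u w = 0 ->
  omega (v + p *: w - r *: u) (v' + p' *: w - r' *: u) = omega v v' +
    (p' * omega v w - r' * omega v u + p * omega w v' + p * (p' * omega w w)
     - r * omega u v').
Proof.
move=> uu uw; have wu := omega_eq0C uw.
have addl x y t : omega (x + y) t = omega x t + omega y t by rewrite linearDl.
have addr x y t : omega t (x + y) = omega t x + omega t y by rewrite linearDr.
rewrite -!scaleNr !addl !addr !omegaZl !omegaZr uu uw wu !mulr0 !addr0 !mulNr.
by rewrite !addrA.
Qed.

(** The defect of isometry of a transvection: a, a' stand for the products of u with v, v', then c,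
    c' for those of v, v' with w, q for omega w w, h for half of z squared, and sg for the sign of
    the form. The quadratic term of the exponential is what cancels q. *)
Lemma transvection_scalar (z h sg q a a' c c' : K) : q = sg * q -> h + h = z * z ->
  z * a' * c - (z * c' + h * q * a') * (sg * a) + z * a * (sg * c') +
  z * a * (z * a' * q) - (z * c + h * q * a) * a' = 0.
Proof.
move=> qE hh; rewrite !mulrDl.
have -> : z * a * (sg * c') = z * c' * (sg * a).
  by rewrite [LHS](AC (2*2) (1*4*(3*2))).
have -> : h * q * a' * (sg * a) = h * q * a * a'.
  by rewrite [LHS](AC (3*2) (1*(4*2)*5*3)) /= -qE.
have -> : z * a * (z * a' * q) = h * q * a * a' + h * q * a * a'.
  by rewrite [LHS](AC (2*3) (1*3*5*2*4)) /= -hh !mulrDl.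
have -> : z * a' * c = z * c * a' by rewrite [LHS](ACl (1*3*2)).
set X1 := z * c * a'; set X2 := z * c' * _; set X3 := h * q * a * a'.
rewrite !opprD !addrA [X1 - X2 - X3 + X2](ACl (1*2*4*3)) /= subrK subrK.
by rewrite [X1 + X3]addrC addrK subrr.
Qed.

Lemma transvection_isom u w z v v' : omega u u = 0 -> omega u w = 0 ->
  omega (transvection u w z v) (transvection u w z v') = omega v v'.
Proof.
move=> uu uw; have [sg sg1 sgE] := omega_sign.
rewrite /transvection omega_expand3 // -[RHS]addr0; congr (_ + _).
have hh : z ^+ 2 / 2%:R + z ^+ 2 / 2%:R = z * z.
  by rewrite -mulr2n -[LHS]mulr_natr mulfVK ?two_neq0 // expr2.
by rewrite (sgE v u) (sgE w v'); apply: transvection_scalar hh; exact: sgE.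
Qed.

Lemma transvection_local n u w z j : fspan b (En n) u -> fspan b (En n) w ->
  (j \notin En n -> transvection u w z (b j) = b j) /\
  (j \in En n -> fspan b (En n) (transvection u w z (b j))).
Proof.
move=> uI wI; have sI := fspan_subspace (En n); split=> jI; last first.
  apply: (subspaceB sI); last exact: (subspaceZ _ sI).
  by apply: (subspaceD sI); [apply: mem_span; exists j|exact: (subspaceZ _ sI)].
have z0 v : fspan b (En n) v -> omega (b j) v = 0.
  move=> /mem_fspan vI; rewrite omega_expandr.
  have [->|/vI] := eqVneq (coef v (iE j)) 0; first by rewrite mul0r.
  by rewrite En_iE (negPf jI).
rewrite /transvection (omega_eq0C (z0 _ uI)) (z0 _ wI) !mulr0 addr0 !scale0r.
by rewrite addr0 subr0.
Qed.

(** The position is read off a triangular basis of the same flag; only one inclusion has to be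
    checked, dimensions giving the other. *)
Lemma rel_position_tri n s t l l' : wtype (En n) s -> wtype (En n) t ->
  local (En n) l -> isom l -> local (En n) l' -> tri l' ->
  (forall j, coord_space l' [set e | t e <= s j]%O (l j)) ->
  relative_position leB b (hi_ l s) t.
Proof.
move=> sw tw ll li ll' lt' lj.
suff -> : hi_ l s = hi_ l' t by exact: tri_rel_position.
have [_ s0 sc] := sw; have [_ t0 tc] := tw; apply/funext => a.
apply: (@std_sub_eq (En n) (below sigma0 a)).
- apply: (@std_coord _ _ (below s a)) => //; first exact: isom_inj.
  by move=> e eI; rewrite /below s0.
- apply: (@std_coord _ _ (below t a)) => //; first exact: tri_inj.
  by move=> e eI; rewrite /below t0.
apply: span_min; first exact: span_subspace.
by move=> _ [j ja <-]; exact: (coord_space_mono ja (lj j)).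
Qed.

(** For g in B, the curve sending z to the image of F_s under g composed with the transvection lies
    in the orbit of t for z nonzero and passes through g F_s at z = 0. The orbit is thus treated
    point by point. *)
Lemma transvection_closure n s t u w : wtype (En n) s -> weyl_orbit iE sigma0 t ->
  fspan b (En n) u -> fspan b (En n) w -> omega u u = 0 -> omega u w = 0 ->
  (forall z, z != 0 ->
     relative_position leB b (hi_ (fun j => transvection u w z (b j)) s) t) ->
  orbit B (coord_flag b s) `<=` ind_closure Xind (orbit B (coord_flag b t)).
Proof.
move=> sw tW uI wI uu uw relt _ [g Bg <-] C [Ccl CO].
have Gg := borel_G Bg; have lg := G_linear Gg.
have [m gm] := G_local Gg; pose k := maxn n m.
have [nk mk] : (En n `<=` En k)%fset /\ (En m `<=` En k)%fset.
  by split; apply: En_mono; rewrite leq_max leqnn ?orbT.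
have swk : wtype (En k) s by apply: wtype_widen sw; rewrite leq_max leqnn.
have gk := local_widen mk gm.
have widen v : fspan b (En n) v -> fspan b (En k) v.
  by move=> /mem_fspan vI; apply/mem_fspan => e /vI; exact: (fsubsetP nk).
pose y z j := transvection u w z (b j).
have yk z : local (En k) (y z).
  by split=> j; have [out inn] := transvection_local z j (widen _ uI) (widen _ wI);
    [exact: out|exact: inn].
have yi z : isom (y z) by move=> i j; exact: transvection_isom.
have y0 : y 0 = b.
  apply/funext => j; rewrite /y /transvection !mul0r expr2 mul0r.
  by rewrite !mul0r addr0 !scale0r addr0 subr0.
rewrite act_coord_flag // -[b in g \o b]y0.
have [t' tw'] := (weyl_orbitP t).1 tW.
apply: (@closed_curve k s (fun z => g \o y z) C) => //.
- move=> z; split=> j jI /=; first by rewrite (yk z).1 // -[LHS]/((g \o b) j) gk.1.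
  by rewrite (G_lin Gg); apply: (local_fspan gk); exact: (yk z).2.
- by move=> z i j /=; rewrite G_isom //; exact: yi.
- move=> i j; rewrite /y /transvection.
  exists ((coef (g (b i)) j)%:P + ('X * (omega u (b i))%:P) * (coef (g w) j)%:P
    - ('X * (omega (b i) w)%:P + 'X^2 * (2%:R^-1)%:P * (omega w w)%:P * (omega u (b i))%:P)
      * (coef (g u) j)%:P) => z.
  rewrite /= (linear_applyB _ _ lg) (linear_applyD _ _ lg) !(linear_applyZ _ _ lg).
  by rewrite coefB coefD !coefZ !hornerE.
move=> z z0; apply: CO; have Gy := isom_G (yk z) (yi z).
have -> : coord_flag (g \o y z) s = act g (coord_flag (y z) s) by rewrite act_coord_flag.
apply: orbit_act => //; have [siE _ _] := sw.
rewrite (coord_flagE Gy siE).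
by apply/(orbitP (wtype_iflag swk (yk z) (yi z)) tw'); exact: relt.
Qed.

Lemma transvection_basis u w z j : transvection u w z (b j) =
  b j + (z * omega u (b j)) *: w -
  (z * omega (b j) w + z ^+ 2 / 2%:R * omega w w * omega u (b j)) *: u.
Proof. by []. Qed.

Lemma leads_add2 e f a c : lt e f -> c != 0 -> leads (a *: b e + c *: b f) f.
Proof.
move=> ef c0; have fe : f != e by rewrite eq_sym (ltB_neq ef).
split=> [|j]; rewrite coefD !coefZ !coef_basis ?eqxx.
  by rewrite (negPf fe) mulr0 add0r mulr1.
have [->|je] := eqVneq j e; first by rewrite (ltBW ef).
by have [->|jf] := eqVneq j f; rewrite ?leB_refl // !mulr0 addr0 eqxx.
Qed.

(** The transvection adds a nonzero multiple of b f to b e, so the value s e passes to the leading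
    place f, and s f falls to e because b e is a combination of the images of b e and b f. The same
    happens to the pair iE f, iE e. *)
Lemma step_relative_position n s e f (z : K) : wtype (En n) s -> e <> f ->
  iE e <> e -> iE f <> f -> lt e f -> (s e < s f)%O -> e \in En n -> f \in En n ->
  (forall x, iE x = x -> f <> iE e) -> z != 0 ->
  relative_position leB b (hi_ (fun j => transvection (b (iE e)) (b f) z (b j)) s)
    (s \o transp_om iE e f).
Proof.
move=> sw e_f ee ff ef sef en fn nofix z0; have [siE _ _] := sw.
pose T j := transvection (b (iE e)) (b f) z (b j); set t := s \o _.
have uu : omega (b (iE e)) (b (iE e)) = 0 by apply: b_isotropic; rewrite iE_inv.
have uw : omega (b (iE e)) (b f) = 0 by apply: b_isotropic; rewrite iE_inv => /esym.
have ww : omega (b f) (b f) = 0 by apply: b_isotropic => /esym.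
have TE j : T j = b j + (z * omega (b (iE e)) (b j)) *: b f - (z * omega (b j) (b f)) *: b (iE e).
  by rewrite /T transvection_basis ww mulr0 mul0r addr0.
have inE' x : x \in En n -> fspan b (En n) (b x) by move=> xn; apply: mem_span; exists x.
have ien : iE e \in En n by rewrite En_iE.
have ifn : iE f \in En n by rewrite En_iE.
have Tl : local (En n) T.
  by split=> j; have [out inn] := transvection_local z j (inE' _ ien) (inE' _ fn);
    [exact: out|exact: inn].
have Ti : isom T by move=> i j; exact: transvection_isom.
have tw : wtype (En n) t by exact: wtype_transp.
have tE x : t x = s (if x == e then f else if x == f then e else
    if x == iE e then iE f else if x == iE f then iE e else x).
  by rewrite /t /= transp_omE.
have fe : (f == e) = false by apply/eqP => /esym.
have te : t e = s f by rewrite tE eqxx.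
have tf : t f = s e by rewrite tE eqxx fe.
have eps_e : omega (b (iE e)) (b e) != 0 by rewrite -{2}[e]iE_inv eps_neq0.
have eps_f : omega (b (iE f)) (b f) != 0 by rewrite -{2}[f]iE_inv eps_neq0.
have [mu mu0 Te] : exists2 mu, mu != 0 & T e = b e + mu *: b f.
  have [fie|/eqP fie] := eqVneq f (iE e); last first.
    exists (z * omega (b (iE e)) (b e)); first by rewrite mulf_neq0.
    by rewrite TE [omega (b e) _]b_isotropic // mulr0 scale0r subr0.
  (* When f = iE e both vectors of the transvection are b (iE e). Its two linear terms add up for a
     skew form; for a symmetric form they would cancel, a case excluded by [nofix]. *)
  exists (2%:R * (z * omega (b (iE e)) (b e))); first by rewrite !mulf_neq0 ?two_neq0.
  rewrite TE -fie; case: omega_sym => [[_ [x [xx _]]]|[sk _]].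
    by case: (nofix x xx fie).
  rewrite [omega (b e) _]sk mulrN scaleNr opprK -addrA -scalerDl.
  by rewrite -mulr2n mulr_natl.
have Tf : T f = b f by rewrite TE uw ww !mulr0 !scale0r addr0 subr0.
have T0 j : j != e -> j != iE f -> T j = b j.
  move=> /eqP je /eqP jf; rewrite TE !b_isotropic ?mulr0 ?scale0r ?addr0 ?subr0 //.
    by move=> fj; apply: jf; rewrite fj iE_inv.
  by rewrite iE_inv.
have Tif : f <> iE e -> exists2 nu, nu != 0 & T (iE f) = b (iE f) + nu *: b (iE e).
  move=> fie; exists (- (z * omega (b (iE f)) (b f))).
    by rewrite oppr_eq0 mulf_neq0.
  rewrite TE [omega (b (iE e)) _]b_isotropic ?mulr0 ?scale0r ?addr0 ?scaleNr //.
  by rewrite iE_inv => fe'; apply: fie; rewrite -fe' iE_inv.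
(* The images are relabelled by their leading places. If f = iE e, the two exceptional places
   coincide and the first clause is the right one. *)
pose l' j := if j == f then T e else if j == iE e then T (iE f) else b j.
have l'e : l' e = b e by rewrite /l' eq_sym fe [e == iE e]eq_sym (introF eqP ee).
have l'f : l' f = T e by rewrite /l' eqxx.
have l'tri : tri l'.
  move=> j; rewrite /l'; have [->|jf] := eqVneq j f.
    by rewrite Te -[b e]scale1r; exact: leads_add2.
  have [je|je] := eqVneq j (iE e); last exact: leads_basis.
  have [|nu nu0 ->] := Tif; first by move=> fie; rewrite je fie eqxx in jf.
  by rewrite je -[b (iE f)]scale1r; apply: leads_add2; rewrite ?ltB_iE.
have l'l : local (En n) l'.
  split=> j jI; rewrite /l'.
    have [jf|_] := eqVneq j f; first by rewrite jf fn in jI.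
    have [je|//] := eqVneq j (iE e); first by rewrite je ien in jI.
  by case: ifP => _; [exact: Tl.2|case: ifP => _; [exact: Tl.2|exact: inE']].
apply: (rel_position_tri sw tw Tl Ti l'l l'tri) => j.
have sC D : subspace (coord_space l' D) by exact: span_subspace.
have mem a k : (t k <= a)%O -> coord_space l' [set x | t x <= a]%O (l' k).
  by move=> ka; apply: mem_span; exists k.
have [->|je] := eqVneq j e; first by rewrite -l'f; apply: mem; rewrite tf.
have [->|jf] := eqVneq j f.
  rewrite Tf (_ : b f = mu^-1 *: (l' f - l' e)).
    apply: (subspaceZ _ (sC _)); apply: (subspaceB (sC _)); apply: mem; rewrite ?te ?tf //.
    exact: ltW.
  by rewrite l'f l'e Te addrC addKr scalerA mulVf // scale1r.
have [fie|/eqP fie] := eqVneq f (iE e).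
  rewrite T0 //; last by rewrite fie iE_inv.
  have -> : b j = l' j by rewrite /l' (negPf jf) -fie (negPf jf).
  apply: mem; rewrite tE (negPf je) (negPf jf) -fie (negPf jf) fie iE_inv.
  by rewrite (negPf je).
have [nu nu0 TifE] := Tif fie.
have := transp_om4 e_f ee ff fie; rewrite /= !inE !negb_or !andbT.
case/and3P=> /and3P[n1 n2 n3] /andP[n4 n5] n6.
have neq (x y : E) : x != y -> (y == x) = false by rewrite eq_sym => /negPf.
have tie : t (iE e) = s (iE f) by rewrite tE (neq _ _ n2) (neq _ _ n4) eqxx.
have tif : t (iE f) = s (iE e) by rewrite tE (neq _ _ n3) (neq _ _ n5) (neq _ _ n6) eqxx.
have l'ie : l' (iE e) = T (iE f) by rewrite /l' (neq _ _ n4) eqxx.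
have l'if : l' (iE f) = b (iE f) by rewrite /l' (neq _ _ n5) (neq _ _ n6).
have [->|jif] := eqVneq j (iE f); first by rewrite -l'ie; apply: mem; rewrite tie.
rewrite T0 //; have [jie|jie] := eqVneq j (iE e).
  rewrite {}jie (_ : b (iE e) = nu^-1 *: (l' (iE e) - l' (iE f))).
    apply: (subspaceZ _ (sC _)); apply: (subspaceB (sC _)); apply: mem; rewrite ?tie ?tif //.
    by rewrite !siE iA_anti; exact: ltW.
  by rewrite l'ie l'if TifE addrC addKr scalerA mulVf // scale1r.
have -> : b j = l' j by rewrite /l' (negPf jf) (negPf jie).
by apply: mem; rewrite tE (negPf je) (negPf jf) (negPf jie) (negPf jif).
Qed.

(** For a symmetric form the linear terms cannot link e and iE e. With w = b o the quadratic term of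
    the transvection produces b (iE e) with the coefficient - c, while the value of the place o
    stays in the middle. *)
Lemma step_relative_position_fixed n s e o (z : K) : wtype (En n) s -> iE o = o ->
  iE e <> e -> lt e (iE e) -> (s e < s (iE e))%O -> e \in En n -> z != 0 ->
  relative_position leB b (hi_ (fun j => transvection (b (iE e)) (b o) z (b j)) s)
    (s \o transp_om iE e (iE e)).
Proof.
move=> sw o_fix ee ei se en z0; have [siE _ _] := sw.
pose T j := transvection (b (iE e)) (b o) z (b j); set t := s \o _.
have oe : o <> e by move=> oe; rewrite -oe o_fix in ee.
have oie : o <> iE e by move=> oe'; apply: oe; rewrite -[e]iE_inv -oe' o_fix.
have ien : iE e \in En n by rewrite En_iE.
have on : o \in En n by exact: En_fixed.
have uu : omega (b (iE e)) (b (iE e)) = 0 by apply: b_isotropic; rewrite iE_inv.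
have uw : omega (b (iE e)) (b o) = 0 by apply: b_isotropic; rewrite iE_inv.
pose q := omega (b o) (b o); have q0 : q != 0 by rewrite /q -{2}o_fix eps_neq0.
pose k := omega (b (iE e)) (b e).
have k0 : k != 0 by rewrite /k -{2}[e]iE_inv eps_neq0.
have inE' x : x \in En n -> fspan b (En n) (b x) by move=> xn; apply: mem_span; exists x.
have Tl : local (En n) T.
  by split=> j; have [out inn] := transvection_local z j (inE' _ ien) (inE' _ on);
    [exact: out|exact: inn].
have Ti : isom T by move=> i j; exact: transvection_isom.
have e_ie : e <> iE e by move=> /esym.
have iee : iE (iE e) <> iE e by rewrite iE_inv.
have tw : wtype (En n) t by exact: wtype_transp.
have tE x : t x = s (if x == e then iE e else if x == iE e then e else x).
  by rewrite /t /= transp_omE // iE_inv; case: eqP => // _; case: eqP.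
have ne_ie : (iE e == e) = false by exact/eqP.
have te : t e = s (iE e) by rewrite tE eqxx.
have tie : t (iE e) = s e by rewrite tE eqxx ne_ie.
have to : t o = s o by rewrite tE (introF eqP oe) (introF eqP oie).
have eo : lt e o.
  rewrite ltBNge; apply/negP => oe'; have := leB_trans oe' (ltBW ei).
  rewrite -{1}o_fix leB_iE => eo; by apply: oe; apply: leB_anti; rewrite oe' eo.
have oi : lt o (iE e) by rewrite -o_fix ltB_iE.
have seo : (s e < s o)%O.
  rewrite ltNge; apply/negP => os; have := le_lt_trans os se.
  by rewrite siE -{1}o_fix siE iA_lt ltNge os.
have soi : (s o < s (iE e))%O by rewrite -o_fix !siE iA_lt.
(* The factor lam is chosen so that T o - lam *: T e has no component on b (iE e), that is lam * c =
   z * q. The coefficient of b o then becomes 1 - 2 = -1, and this vector, called p, has leading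
   place o. *)
pose c := z ^+ 2 / 2%:R * q * k; pose lam := 2%:R / (z * k).
have c0 : c != 0 by rewrite !mulf_neq0 ?invr_neq0 ?expf_neq0 ?two_neq0.
have zk0 : z * k != 0 by rewrite mulf_neq0.
have Te : T e = b e + (z * k) *: b o - c *: b (iE e).
  rewrite /T transvection_basis -/k -/q [omega (b e) (b o)]b_isotropic // mulr0 add0r.
  by [].
have To : T o = b o - (z * q) *: b (iE e).
  by rewrite /T transvection_basis uw -/q !mulr0 scale0r !addr0.
have T0 j : j <> e -> j <> o -> T j = b j.
  move=> je jo; rewrite /T transvection_basis [omega (b (iE e)) (b j)]b_isotropic ?iE_inv //.
  rewrite b_isotropic ?mulr0 ?addr0 ?scale0r ?subr0 ?addr0 // => oj.
  by apply: jo; rewrite -o_fix oj iE_inv.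
pose p := - b o - lam *: b e.
have pE : T o = p + lam *: T e.
  rewrite Te To /p scalerBr scalerDr !scalerA.
  have -> : lam * (z * k) = 2%:R by rewrite /lam mulfVK.
  have -> : lam * c = z * q.
    have -> : c = (z * k) * (z * q / 2%:R).
      by rewrite /c expr2 [LHS](AC (3*1*1) (1*5*(2*4*3))).
    by rewrite /lam [LHS]mulrA mulfVK // mulrC mulfVK // two_neq0.
  rewrite addrA; congr (_ - _); rewrite addrA subrK.
  by rewrite scaler_nat mulr2n addKr.
pose l' j := if j == iE e then T e else if j == o then p else b j.
have l'e : l' e = b e by rewrite /l' [e == _]eq_sym ne_ie [e == o]eq_sym (introF eqP oe).
have l'o : l' o = p by rewrite /l' (introF eqP oie) eqxx.
have l'ie : l' (iE e) = T e by rewrite /l' eqxx.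
have l'tri : tri l'.
  move=> j; rewrite /l'; have [->|jie] := eqVneq j (iE e).
    have -> : T e = b e + (z * k) *: b o + (- c) *: b (iE e) by rewrite Te scaleNr.
    split=> [|i]; rewrite !coefD !coefZ !coef_basis.
      rewrite ne_ie [iE e == o]eq_sym (introF eqP oie) eqxx mulr0 !add0r mulr1.
      by rewrite oppr_eq0.
    have [->|_] := eqVneq i e; first by rewrite (ltBW ei).
    have [->|_] := eqVneq i o; first by rewrite (ltBW oi).
    by have [->|_] := eqVneq i (iE e); rewrite ?leB_refl // !mulr0 !addr0 eqxx.
  have [->|jo] := eqVneq j o; last exact: leads_basis.
  have -> : p = (- lam) *: b e + (-1) *: b o by rewrite /p scaleN1r scaleNr addrC.
  by apply: leads_add2; rewrite // oppr_eq0 oner_neq0.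
have l'l : local (En n) l'.
  split=> j jI; rewrite /l'.
    have [jie|_] := eqVneq j (iE e); first by rewrite jie ien in jI.
    by have [jo|//] := eqVneq j o; first by rewrite jo on in jI.
  case: ifP => _; first exact: Tl.2.
  case: ifP => _; last exact: inE'.
  have sI := fspan_subspace (En n).
  apply: (subspaceB sI); last by apply: (subspaceZ _ sI); exact: inE'.
  by rewrite -scaleN1r; apply: (subspaceZ _ sI); exact: inE'.
apply: (rel_position_tri sw tw Tl Ti l'l l'tri) => j.
have sC D : subspace (coord_space l' D) by exact: span_subspace.
have mem a x : (t x <= a)%O -> coord_space l' [set x | t x <= a]%O (l' x).
  by move=> xa; apply: mem_span; exists x.
have [->|/eqP je] := eqVneq j e; first by rewrite -/(T e) -l'ie; apply: mem; rewrite tie.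
have [->|/eqP jo] := eqVneq j o.
  rewrite -/(T o) pE -l'o -l'ie; apply: (subspaceD (sC _)); first by apply: mem; rewrite to.
  by apply: (subspaceZ _ (sC _)); apply: mem; rewrite tie ltW.
rewrite -/(T j) T0 //; have [->|jie] := eqVneq j (iE e); last first.
  have -> : b j = l' j by rewrite /l' (negPf jie) (introF eqP jo).
  by apply: mem; rewrite tE (introF eqP je) (negPf jie).
have Me : coord_space l' [set x | t x <= s (iE e)]%O (b e).
  by rewrite -l'e; apply: mem; rewrite te.
have Mo : coord_space l' [set x | t x <= s (iE e)]%O (b o).
  have -> : b o = (-1) *: (l' o + lam *: b e).
    by rewrite l'o /p subrK scaleN1r opprK.
  apply: (subspaceZ _ (sC _)); apply: (subspaceD (sC _)); last exact: (subspaceZ _ (sC _)).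
  by apply: mem; rewrite to ltW.
have -> : b (iE e) = c^-1 *: (b e + (z * k) *: b o - l' (iE e)).
  by rewrite l'ie Te opprB addrC subrK scalerA mulVf // scale1r.
apply: (subspaceZ _ (sC _)); apply: (subspaceB (sC _)); last by apply: mem; rewrite tie ltW.
by apply: (subspaceD (sC _)) => //; exact: (subspaceZ _ (sC _)).
Qed.

Theorem lt_om_step_closure s t : weyl_orbit iE sigma0 s -> lt_om_step iE leB s t ->
  weyl_orbit iE sigma0 t /\
  orbit B (coord_flag b s) `<=` ind_closure Xind (orbit B (coord_flag b t)).
Proof.
move=> /weyl_orbitP[m sw0] [e [f [e_f [ee ff] ef sef ->]]].
have [k kP] := En_cover_seq [:: e; f].
pose n := maxn m k; have sw : wtype (En n) s by apply: wtype_widen sw0; exact: leq_maxl.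
have kn := fsubsetP (En_mono (leq_maxr m k)).
have en : e \in En n by apply/kn/kP; rewrite !inE eqxx.
have fn : f \in En n by apply/kn/kP; rewrite !inE eqxx orbT.
have tW : weyl_orbit iE sigma0 (s \o transp_om iE e f).
  by apply/weyl_orbitP; exists n; exact: wtype_transp.
split=> //; have inE' x : x \in En n -> fspan b (En n) (b x).
  by move=> xn; apply: mem_span; exists x.
have ien : iE e \in En n by rewrite En_iE.
have uu : omega (b (iE e)) (b (iE e)) = 0 by apply: b_isotropic; rewrite iE_inv.
have [[o [o_fix fie]]|no] := pselect (exists o, iE o = o /\ f = iE e).
  have on : o \in En n by exact: En_fixed.
  have uw : omega (b (iE e)) (b o) = 0.
    by apply: b_isotropic; rewrite iE_inv => oe; rewrite -oe o_fix in ee.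
  apply: (transvection_closure sw tW (inE' _ ien) (inE' _ on) uu uw) => z z0.
  by rewrite fie; apply: (step_relative_position_fixed sw o_fix ee); rewrite // -fie.
have uw : omega (b (iE e)) (b f) = 0 by apply: b_isotropic; rewrite iE_inv => /esym.
apply: (transvection_closure sw tW (inE' _ ien) (inE' _ fn) uu uw) => z z0.
apply: (step_relative_position sw) => // x xx fie.
by apply: no; exists x.
Qed.

Theorem closure_le_om s t : weyl_orbit iE sigma0 s -> weyl_orbit iE sigma0 t ->
  orbit B (coord_flag b s) `<=` ind_closure Xind (orbit B (coord_flag b t)) <->
  le_om iE leB s t.
Proof.
move=> sW tW; split=> [st|[]]; last first.
- by move=> -> GG sO C [_]; exact.
- have clos_sub S S' : S `<=` ind_closure Xind S' -> ind_closure Xind S `<=` ind_closure Xind S'.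
    by move=> SS' GG SG C [Cc S'C]; apply: SG; split=> // x /SS'; apply.
  have sub_clos S : S `<=` ind_closure Xind S by move=> GG SG C [_]; exact.
  suff : forall x y, lt_om iE leB x y -> weyl_orbit iE sigma0 x ->
      weyl_orbit iE sigma0 y /\
      orbit B (coord_flag b x) `<=` ind_closure Xind (orbit B (coord_flag b y)).
    by move=> H st; case: (H _ _ st sW).
  move=> x y; elim=> {x y} [x y xy xW|x y z _ IHx _ IHy xW]; first exact: lt_om_step_closure.
  have [yW xy] := IHx xW; have [zW yz] := IHy yW; split=> //.
  by apply: (subset_trans xy); exact: clos_sub.
have [[n1 sw1] [n2 tw2]] := ((weyl_orbitP s).1 sW, (weyl_orbitP t).1 tW).
pose n := maxn n1 n2; have sw : wtype (En n) s by apply: wtype_widen sw1; exact: leq_maxl.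
have tw : wtype (En n) t by apply: wtype_widen tw2; exact: leq_maxr.
apply: (dom_le_om tw sw) => L D Ll Dl.
have sclo : ind_closure Xind (orbit B (coord_flag b t)) (coord_flag b s).
  apply: st; have Gid := G_id; exists id.
    split=> // F _; exact: image_id.
  by rewrite /act; under eq_imagel do rewrite image_id; rewrite image_id.
apply: (cnt_lowerA (R := leq)) => // a.
have [m0 m0P] := closure_dominates sW tW sclo a Dl.
have nm : (En n `<=` En (maxn m0 n))%fset by apply: En_mono; exact: leq_maxr.
have := m0P _ (leq_maxl m0 n).
(* Outside E_n both maps equal sigma0, so the inequality valid for a large E_m descends to E_n. *)
rewrite (count_widen _ nm) [X in (_ <= X)%N](count_widen _ nm).
rewrite (@eq_count _ (fun e => below t a e && D e && (e \notin En n))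
  (fun e => below s a e && D e && (e \notin En n))); first by rewrite leq_add2r.
have [_ s0 _] := sw; have [_ t0 _] := tw.
by move=> e; case: (boolP (e \in En n)) => eI; rewrite ?andbF // /below s0 // t0.
Qed.

(** * The Cayley transform *)

(* Columns of strictly triangular matrices supported by the inversions of [s]
   in E_n. *)
Definition nilp n s (x : E -> V) := forall f e, coef (x f) e != 0 ->
  [/\ f \in En n, e \in En n, lt e f & (s f < s e)%O].

Definition antisym (x : E -> V) := forall f h, omega (x f) (b h) + omega (b f) (x h) = 0.

Definition linv l f : V := xget 0 [set w | lin l w = b f].

Definition shift (x : E -> V) (c : K) f : V := b f + c *: x f.

(* Cayley transform (1 + x) / (1 - x) and its inverse (l - 1) / (l + 1). *)
Definition cayley (x : E -> V) f : V := lin (shift x 1) (linv (shift x (-1)) f).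

Definition inv_cayley l f : V :=
  lin (fun f => l f - b f) (linv (fun f => l f + b f) f).

Lemma linvP l : bijective (lin l) -> forall f, lin l (linv l f) = b f.
Proof.
move=> [h _ hK] f; apply: (xgetPex 0 (P := [set w | lin l w = b f])).
by exists (h (b f)) => /=; rewrite hK.
Qed.

Lemma lin_linv (l l' : E -> V) v : bijective (lin l) ->
  lin (fun f => lin l' (linv l f)) (lin l v) = lin l' v.
Proof.
move=> bl; have [h lK hK] := bl.
have E1 : linv l =1 h \o b by move=> f; apply: (bij_inj bl); rewrite /= hK linvP.
have lh : linear h by move=> a u w; apply: (bij_inj bl); rewrite lin_linear !hK.
have E2 w : lin (fun f => lin l' (linv l f)) w = lin l' (h w).
  apply: (eq_linear (g := lin (fun f => lin l' (linv l f))) (h := fun w => lin l' (h w))).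
  - exact: lin_linear.
  - by move=> a u z; rewrite lh lin_linear.
  - by move=> f; rewrite lin_basis E1.
by rewrite E2 lK.
Qed.

Lemma lin_shift x c v : lin (shift x c) v = v + c *: lin x v.
Proof.
rewrite /lin [X in _ = X + _]expand scaler_sumr -big_split /=.
by apply: eq_bigr => e _; rewrite /shift scalerDr !scalerA mulrC.
Qed.

Lemma lin_sub_basis l v : lin (fun f => l f - b f) v = lin l v - v.
Proof.
rewrite {1 2}/lin [X in _ = _ - X]expand -sumrB.
by apply: eq_bigr => e _; rewrite scalerBr.
Qed.

Lemma lin_add_basis l v : lin (fun f => l f + b f) v = lin l v + v.
Proof.
rewrite {1 2}/lin [X in _ = _ + X]expand -big_split /=.
by apply: eq_bigr => e _; rewrite scalerDr.
Qed.

Lemma nilp_shift_utri n s x c : nilp n s x ->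
  utri (En n) (fun e j => s e < s j)%O (shift x c).
Proof.
move=> xn f; rewrite /shift coefD coef_basis eqxx coefZ.
have xff : coef (x f) f = 0.
  by apply/eqP; apply: contraT => /xn[_ _]; rewrite ltB_irr.
rewrite xff mulr0 addr0; split=> // j jf.
rewrite coefD coef_basis (negPf jf) add0r coefZ mulf_eq0 => /norP[_ /xn[*]].
by split.
Qed.

Lemma nilp_shift_bij n s x c : nilp n s x -> bijective (lin (shift x c)).
Proof.
move=> xn; have xu := nilp_shift_utri c xn.
exact: local_bij (utri_local xu) (tri_inj (utri_tri xu)).
Qed.

Lemma reduced_add_bij n s l : reduced (En n) s l ->
  bijective (lin (fun f => l f + b f)).
Proof.
move=> lr; have [lE lI] := utri_local lr; have li : injective (lin (fun f => l f + b f)).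
  apply: tri_inj => f; have [l1 lP] := lr f; split=> [|j]; rewrite coefD coef_basis.
    by rewrite l1 eqxx -mulr2n two_neq0.
  have [->|jf] := eqVneq j f; first by rewrite leB_refl.
  by rewrite addr0 => /(lP _ jf)[_ _ /ltBW].
(* Outside E_n the sum l + 1 is multiplication by 2; halving makes the family local, so that
   [local_bij] applies. *)
pose l' f := 2%:R^-1 *: (l f + b f).
have l'E v : lin (fun f => l f + b f) v = 2%:R *: lin l' v.
  rewrite /lin scaler_sumr; apply: eq_bigr => e _.
  by rewrite /l' scalerA scalerA mulrAC mulfV ?two_neq0 // mul1r.
have [h h1 h2] : bijective (lin l').
  apply: (@local_bij (En n)) => [|u v uv]; last by apply: li; rewrite !l'E uv.
  split=> f fI; rewrite /l'.
    by rewrite lE // -[b f + b f]mulr2n -scaler_nat scalerA mulVf ?two_neq0 // scale1r.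
  have sI := fspan_subspace (En n); apply: (subspaceZ _ sI).
  by apply: (subspaceD sI); [exact: lI|apply: mem_span; exists f].
exists (fun v => h (2%:R^-1 *: v)) => v.
  by rewrite l'E scalerA mulVf ?two_neq0 // scale1r h1.
by rewrite l'E h2 scalerA mulfV ?two_neq0 // scale1r.
Qed.

(** The identity C (1 - x) = 1 + x is solved as C = 1 + x + C x. As x is strictly triangular, this
    is a recursion along the order of E, used both for supports and for regularity. *)
Lemma cayleyE n s x v : nilp n s x ->
  lin (cayley x) v = v + lin x v + lin (cayley x) (lin x v).
Proof.
move=> xn; have := lin_linv (shift x 1) v (nilp_shift_bij (-1) xn).
rewrite -/(cayley x) !lin_shift scaleN1r scale1r.
rewrite (linear_applyB _ _ (lin_linear _)) => <-.
by rewrite -[lin (cayley x) (lin x v)]/(lin (cayley x) (lin x v)) subrK.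
Qed.

Lemma inv_cayleyE n s l v : reduced (En n) s l ->
  lin (inv_cayley l) (lin l v + v) = lin l v - v.
Proof.
move=> lr; have := lin_linv (fun f => l f - b f) v (reduced_add_bij lr).
by rewrite lin_add_basis lin_sub_basis.
Qed.

Lemma cayley_reduced n s x : nilp n s x -> reduced (En n) s (cayley x).
Proof.
move=> xn; elim/(@ltB_ind (En n)) => f IH.
have cE j : coef (cayley x f) j = (j == f)%:R + coef (x f) j +
    \sum_(g <- supp (x f)) coef (x f) g * coef (cayley x g) j.
  rewrite -[cayley x f]lin_basis (cayleyE _ xn) lin_basis coefD coefD coef_basis.
  by rewrite coef_lin.
have key j : \sum_(g <- supp (x f)) coef (x f) g * coef (cayley x g) j != 0 ->
    [/\ f \in En n, j \in En n, lt j f & (s f < s j)%O].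
  move=> sum0; have [g gx gj] : exists2 g, coef (x f) g != 0 & coef (cayley x g) j != 0.
    apply: contrapT => no; move/eqP: sum0; apply; rewrite big_seq big1 // => g.
    rewrite mem_supp => gx; apply/eqP; rewrite mulf_eq0 (negPf gx) /=.
    by apply: contraT => gj; case: no; exists g.
  have [fI gI gf sgf] := xn _ _ gx; have [_ cP] := IH g gI gf.
  have [->|jg] := eqVneq j g; first by split.
  have [_ jI jg' sgj] := cP j jg gj; split=> //; first exact: ltB_trans gf.
  exact: lt_trans sgj.
split.
  have xff : coef (x f) f = 0.
    by apply/eqP; apply: contraT => /xn[_ _]; rewrite ltB_irr.
  rewrite cE eqxx xff addr0 (_ : \sum_(g <- _) _ = 0) ?addr0 //.
  by apply/eqP; apply: contraT => /key[_ _]; rewrite ltB_irr.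
move=> j jf; rewrite cE (negPf jf) add0r; have [->|/xn[*]] := eqVneq (coef (x f) j) 0.
  by rewrite add0r => /key.
by split.
Qed.

(** The same recursion for the inverse: from Y (l + 1) = l - 1 and l + 1 = (l - 1) + 2 one gets 2 Y
    = (l - 1) - Y (l - 1), where l - 1 is strictly triangular. *)
Lemma inv_cayley_rec n s l f : reduced (En n) s l ->
  inv_cayley l f = 2%:R^-1 *: ((l f - b f) - lin (inv_cayley l) (l f - b f)).
Proof.
move=> lr; have := inv_cayleyE (b f) lr; rewrite lin_basis.
have -> : l f + b f = (l f - b f) + 2%:R *: b f.
  by rewrite scaler_nat mulr2n addrA subrK.
rewrite (linear_applyD _ _ (lin_linear _)) (linear_applyZ _ _ (lin_linear _)) lin_basis.
move=> E0; rewrite -{1}E0 addrC addKr scalerA mulVf ?two_neq0 // scale1r.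
by [].
Qed.

Lemma inv_cayley_nilp n s l : reduced (En n) s l -> nilp n s (inv_cayley l).
Proof.
move=> lr; elim/(@ltB_ind (En n)) => f IH e.
have yP g : coef (l f - b f) g != 0 -> [/\ f \in En n, g \in En n, lt g f & (s f < s g)%O].
  rewrite coefB coef_basis; have [->|gf] := eqVneq g f.
    by rewrite (lr f).1 subrr eqxx.
  by rewrite subr0 => /((lr f).2 _ gf).
rewrite (inv_cayley_rec f lr) coefZ mulf_eq0 coefB => /norP[_].
have [->|/yP//] := eqVneq (coef (l f - b f) e) 0; rewrite sub0r oppr_eq0 coef_lin => sum0.
have [g gy ge] : exists2 g, coef (l f - b f) g != 0 & coef (inv_cayley l g) e != 0.
  apply: contrapT => no; move/eqP: sum0; apply; rewrite big_seq big1 // => g.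
  rewrite mem_supp => gx; apply/eqP; rewrite mulf_eq0 (negPf gx) /=.
  by apply: contraT => gj; case: no; exists g.
have [fI gI gf sfg] := yP g gy; have [_ eI eg sge] := IH g gI gf e ge.
by split=> //; [exact: ltB_trans gf|exact: lt_trans sge].
Qed.

Lemma inv_cayleyK n s l : reduced (En n) s l -> cayley (inv_cayley l) = l.
Proof.
move=> lr; set x := inv_cayley l; have xn := inv_cayley_nilp lr.
have bl := reduced_add_bij lr.
(* This is (l + 1) x = l - 1, with the factors in the opposite order to the definition of x; it
   amounts to l (1 - x) = 1 + x. *)
have com v : lin l (lin x v) + lin x v = lin l v - v.
  have [h _ hK] := bl; rewrite -(hK v) lin_add_basis; move: (h v) => w.
  rewrite (inv_cayleyE _ lr) (linear_applyB _ _ (lin_linear l)).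
  by rewrite (linear_applyD _ _ (lin_linear l)) addrA subrK opprD addrA addrK.
apply/funext => f; have [h _ hK] := nilp_shift_bij (-1) xn.
rewrite -[cayley x f]lin_basis -[l f]lin_basis -(hK (b f)); move: (h (b f)) => w.
rewrite lin_shift scaleN1r !(linear_applyB _ _ (lin_linear _)).
have -> : lin (cayley x) w - lin (cayley x) (lin x w) = w + lin x w.
  by rewrite (cayleyE w xn) addrK.
have -> : lin l w = lin l (lin x w) + lin x w + w by rewrite com subrK.
by rewrite [RHS]addrC -addrA addKr addrC.
Qed.

Lemma cayleyK n s x : nilp n s x -> inv_cayley (cayley x) = x.
Proof.
move=> xn; have lr := cayley_reduced xn; set l := cayley x.
have com v : lin x (lin l v) = lin l v - v - lin x v.
  have [h _ hK] := nilp_shift_bij (-1) xn; rewrite -(hK v); move: (h v) => w.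
  have lE : lin l (lin (shift x (-1)) w) = w + lin x w.
    rewrite lin_shift scaleN1r (linear_applyB _ _ (lin_linear l)).
    by rewrite (cayleyE w xn) addrK.
  rewrite lE lin_shift scaleN1r (linear_applyB _ _ (lin_linear x)).
  rewrite (linear_applyD _ _ (lin_linear x)) !opprB.
  by rewrite [RHS](AC (2*2*2) ((2*5)*(1*4)*(3*6))) /= !subrr !addr0.
apply/funext => f; have [h _ hK] := reduced_add_bij lr.
rewrite -[LHS]lin_basis -[RHS]lin_basis -(hK (b f)); move: (h (b f)) => w.
rewrite lin_add_basis (inv_cayleyE _ lr) (linear_applyD _ _ (lin_linear x)) com.
by rewrite subrK.
Qed.

Lemma antisym_lin x u v : antisym x -> omega (lin x u) v = - omega u (lin x v).
Proof.
move=> xa; apply/eqP; rewrite -addr_eq0; apply/eqP.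
rewrite [in omega u _](expand u) [X in omega _ X + _](expand v) {1}/lin /lin.
rewrite !omega_suml -big_split /= big1 // => e _.
rewrite !omega_sumr -big_split /= big1 // => f _.
by rewrite !omegaZl !omegaZr -!mulrDr xa !mulr0.
Qed.

(** Tested on (1 - x) v and (1 - x) w, the claim compares the product of (1 + x) v and (1 + x) w
    with that of (1 - x) v and (1 - x) w; the cross terms cancel by antisymmetry. *)
Lemma cayley_isom n s x : nilp n s x -> antisym x -> isom (cayley x).
Proof.
move=> xn xa e f; have [h _ hK] := nilp_shift_bij (-1) xn.
rewrite -[cayley x e]lin_basis -[cayley x f]lin_basis -(hK (b e)) -(hK (b f)).
move: (h (b e)) (h (b f)) => v w.
have lE u : lin (cayley x) (lin (shift x (-1)) u) = u + lin x u.
  rewrite lin_shift scaleN1r (linear_applyB _ _ (lin_linear _)).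
  by rewrite (cayleyE u xn) addrK.
rewrite !lE !lin_shift !scaleN1r.
rewrite !linearDl !linearDr /= !linearNl !linearNr /= opprK.
rewrite (antisym_lin v w xa) -!addrA; congr (_ + _).
by rewrite opprK addrA subrr add0r addrA addNr add0r.
Qed.

Lemma inv_cayley_antisym n s l : reduced (En n) s l -> isom l ->
  antisym (inv_cayley l).
Proof.
move=> lr li f h; have [k _ kK] := reduced_add_bij lr.
have xb g : inv_cayley l g = lin (inv_cayley l) (b g) by rewrite lin_basis.
rewrite !xb -(kK (b f)) -(kK (b h)); move: (k (b f)) (k (b h)) => v w.
rewrite !lin_add_basis !(inv_cayleyE _ lr).
rewrite !linearDl !linearDr /= !linearNl !linearNr /= !(lin_isom li).
by rewrite [LHS](AC ((2*2)*(2*2)) ((1*4)*(2*6)*(7*3)*(5*8))) /= !subrr !addr0.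
Qed.

(** * Inversions and antisymmetric matrices *)

(* One pair out of each couple (e, f), (i_E f, i_E e) of entries of an
   antisymmetric matrix; the entries (e, i_E e) vanish for a symmetric form. *)
Definition indep s : pred (E * E) := fun p =>
  [&& lt p.1 p.2, (s p.2 < s p.1)%O &
      lt p.1 (iE p.2) || (p.1 == iE p.2) && (eps p.1 + eps p.2 == 0)].

Lemma eps_iE : (forall e, eps (iE e) = eps e) /\ (exists! e, iE e = e) \/
  (forall e, eps (iE e) = - eps e) /\ forall e, iE e <> e.
Proof.
by case: omega_sym => -[sym fix_]; [left|right]; split=> // e; rewrite /eps iE_inv sym.
Qed.

Lemma eps_neqN e : eps e + eps e != 0.
Proof. by rewrite -mulr2n -mulr_natr mulf_neq0 ?eps_neq0 ?two_neq0. Qed.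

(* For a symmetric form, the inversion (e, i_E e) stands for the entry (e, o),
   o being the fixed point of i_E. *)
Definition inversion_of (p : E * E) : E * E :=
  if iE p.2 == p.2 then (p.1, iE p.1) else p.

Lemma inversion_of_bij s : (forall e, s (iE e) = iA (s e)) ->
  set_bij [set p | indep s p] (isotropic_inversions iE leB s) inversion_of.
Proof.
move=> si; have fixed_lt o e : iE o = o -> lt e o -> lt e (iE e).
  by move=> ofx eo; apply: (ltB_trans eo); rewrite -[X in lt X _]ofx ltB_iE.
split.
- move=> [e f] /and3P[/= ef sfe efi]; rewrite /inversion_of /=.
  have fei : leB e (iE f).
    by case/orP: efi => [/ltBW//|/andP[/eqP-> _]]; exact: leB_refl.
  have eei : lt e (iE e).
    by apply: ltB_leB_trans ef _; rewrite -[X in leB X _]iE_inv leB_iE.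
  case: eqP => [ff|ff]; split=> //=.
  + by rewrite iE_inv => ee; move: eei; rewrite ee ltB_irr.
  + by apply: (lt_trans _ sfe); rewrite si -[X in (_ < s X)%O]ff si iA_lt.
  + by rewrite iE_inv leB_refl.
  + by move=> /esym.
- move=> [e f] [e' f']; rewrite !inE /inversion_of /= => /and3P[/= _ _ J1] /and3P[/= _ _ J2].
  case: eqP => ff; case: eqP => ff' [].
  + move=> -> _; congr (_, _); apply: contrapT => ne.
    case: omega_sym => -[_]; last by move=> /(_ f).
    by move=> [o [_ ou]]; apply: ne; rewrite -(ou f ff) -(ou f' ff').
  + move=> ee' ff''; subst e' f'; move: J2; rewrite iE_inv ltB_irr /= eqxx /=.
    case: eps_iE => -[-> ]; first by rewrite (negPf (eps_neqN e)).
    by move=> /(_ f).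
  + move=> ee' ff''; subst e f; move: J1; rewrite iE_inv ltB_irr /= eqxx /=.
    case: eps_iE => -[-> ]; first by rewrite (negPf (eps_neqN e')).
    by move=> /(_ f').
  + by move=> -> ->.
- move=> [e f] [/= ef ei fi sfe efi].
  have keep : indep s (e, f) -> [set inversion_of p | p in [set p | indep s p]] (e, f).
    by exists (e, f) => //; rewrite /inversion_of /=; case: eqP => // /esym.
  have [fe|fe] := eqVneq f (iE e); last first.
    apply: keep; rewrite /indep /= ef sfe /= {1}/ltB efi andbT.
    by rewrite (contra_neq _ fe) // => ->; rewrite iE_inv.
  case: eps_iE => -[epsi fix_]; last first.
    apply: keep; rewrite /indep /= ef sfe /= fe iE_inv eqxx epsi addrN eqxx orbT //.
  (* For a symmetric form the inversion (e, iE e) comes from (e, o): o lies strictly between e and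
     iE e, and its value between theirs. *)
  have [o [ofx _]] := fix_; exists (e, o); last by rewrite /inversion_of /= ofx eqxx fe.
  have eo : lt e o.
    rewrite ltBNge; apply/negP => oe; move: ei; rewrite ltBNge => /negP[].
    by apply: (leB_trans _ oe); rewrite -[X in leB _ X]ofx leB_iE.
  have so : (s o < s e)%O.
    rewrite ltNge; apply/negP => eo'; move: sfe; rewrite fe si ltNge => /negP[].
    by apply: (le_trans eo'); rewrite -[X in (s X <= _)%O]ofx si iA_anti.
  by rewrite /indep /= eo so ofx eo.
Qed.

Lemma antisymE x : antisym x <->
  forall e f, coef (x f) e * eps e + coef (x (iE e)) (iE f) * eps f = 0.
Proof.
have om u h : omega u (b h) = coef u (iE h) * eps (iE h).
  rewrite (expand u) omega_suml.
  rewrite (eq_bigr (fun e => coef u e * (if e == iE h then eps (iE h) else 0))).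
    have [hu|hu] := boolP (iE h \in supp u).
      rewrite (big_fsetD1 (iE h)) //= eqxx -(expand u) big_seq big1 ?addr0 // => e.
      by rewrite in_fsetD1 => /andP[/negPf-> _]; rewrite mulr0.
    rewrite -(expand u) big_seq big1 => [|e eu].
      by move: hu; rewrite mem_supp negbK => /eqP->; rewrite mul0r.
    by case: eqP => [ee|]; rewrite ?mulr0 //; move: hu; rewrite -ee eu.
  move=> e _; rewrite omegaZl omega_basis; congr (_ * _).
  case: (e =P iE h) => [->|ne]; first by rewrite iE_inv eqxx.
  by case: eqP => // he; case: ne; rewrite he iE_inv.
split=> [xa e f|xa f h]; first by have := xa f (iE e); rewrite om omega_expandr !iE_inv.
by rewrite om omega_expandr; have := xa (iE h) f; rewrite iE_inv.
Qed.

(* The antisymmetric matrix with independent entries [u]. *)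
Definition entry s (u : E * E -> K) e f : K :=
  if indep s (e, f) then u (e, f)
  else if indep s (iE f, iE e) then - (u (iE f, iE e) * eps f / eps e) else 0.

Definition matrix_of s u f : V := xget 0 [set w | forall e, coef w e = entry s u e f].

Lemma indep_both s e f : indep s (e, f) -> indep s (iE f, iE e) -> e = iE f.
Proof.
move=> /and3P[/= _ _ J1] /and3P[/= _ _ J2].
case/orP: J1 => [J1|/andP[/eqP]//].
case/orP: J2 => [|/andP[/eqP]]; rewrite iE_inv // => J2.
by have := ltB_trans J1 J2; rewrite ltB_irr.
Qed.

Lemma entry_indep s u e f : indep s (e, f) -> entry s u e f = u (e, f).
Proof. by rewrite /entry => ->. Qed.

Lemma eq_matrix_of s u v : (forall p, indep s p -> u p = v p) ->
  matrix_of s u = matrix_of s v.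
Proof.
move=> uv; rewrite /matrix_of (_ : entry s u = entry s v) //.
by apply/funext => e; apply/funext => f; rewrite /entry; do 2?case: ifP => [/uv->|_].
Qed.

Section MatrixOf.
Variables (n : nat) (s : E -> A).
Hypothesis sw : wtype (En n) s.

Let siE : forall e, s (iE e) = iA (s e) := let: And3 si _ _ := sw in si.

Lemma inversion_iE e f : lt (iE f) (iE e) && (s (iE e) < s (iE f))%O = lt e f && (s f < s e)%O.
Proof. by rewrite ltB_iE !siE iA_lt. Qed.

Variable u : E * E -> K.
Hypothesis un : forall p, indep s p -> u p != 0 -> p.1 \in En n /\ p.2 \in En n.

Lemma entry_neq0 e f : entry s u e f != 0 ->
  [/\ f \in En n, e \in En n, lt e f & (s f < s e)%O].
Proof.
rewrite /entry; case: ifP => [J /(un J)[] //|_].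
  by case/and3P: J => /= -> ->.
case: ifP => [J|]; last by rewrite eqxx.
rewrite oppr_eq0 !mulf_eq0 => /norP[/norP[/(un J)[/= fI eI] _] _].
case/and3P: J => /= J1 J2 _; move: (inversion_iE e f); rewrite J1 J2 => /esym/andP[-> ->].
by split=> //; rewrite -En_iE.
Qed.

Lemma coef_matrix_of f e : coef (matrix_of s u f) e = entry s u e f.
Proof.
suff : [set w | forall e, coef w e = entry s u e f] (matrix_of s u f) by apply.
apply: (xgetPex 0); exists (\sum_(e <- En n) entry s u e f *: b e) => /= j.
rewrite coef_mk; case: ifP => // jn; apply/esym/eqP; apply: contraFT jn.
by move=> /entry_neq0[].
Qed.

Lemma matrix_of_nilp : nilp n s (matrix_of s u).
Proof. by move=> f e; rewrite coef_matrix_of => /entry_neq0. Qed.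

Lemma matrix_of_antisym : antisym (matrix_of s u).
Proof.
have half e f : indep s (e, f) ->
    entry s u e f * eps e + entry s u (iE f) (iE e) * eps f = 0.
  (* An independent pair whose mirror image is independent too is its own mirror image; then eps e +
     eps f = 0, and the entry is unconstrained. *)
  move=> J; rewrite entry_indep // /entry; case: ifP => [J'|_].
    have ef := indep_both J J'; rewrite ef iE_inv -mulrDr.
    have : eps e + eps f = 0.
      by case/and3P: J => _ _ /= /orP[|/andP[_ /eqP//]]; rewrite ef ltB_irr.
    by rewrite ef => ->; rewrite mulr0.
  have eiE : forall g, eps g / eps (iE g) * eps (iE g) = eps g.
    by move=> g; rewrite mulfVK ?eps_neq0.
  rewrite !iE_inv J mulNr -!mulrA.
  suff -> : eps (iE e) * ((eps (iE f))^-1 * eps f) = eps e by rewrite addrN.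
  case: eps_iE => -[epsi _]; rewrite !epsi; first by rewrite mulVf ?mulr1 ?eps_neq0.
  by rewrite invrN !mulNr mulrN opprK mulVf ?mulr1 ?eps_neq0.
apply/antisymE => e f; rewrite !coef_matrix_of.
case J : (indep s (e, f)); first exact: half.
case J' : (indep s (iE f, iE e)); last first.
  by rewrite /entry J J' !iE_inv J mul0r add0r mul0r.
have := half _ _ J'; rewrite !iE_inv addrC.
case: eps_iE => -[epsi _]; rewrite !epsi // !mulrN -opprD => /eqP.
by rewrite oppr_eq0 => /eqP.
Qed.
End MatrixOf.

Lemma matrix_of_coef n s x : wtype (En n) s -> nilp n s x -> antisym x ->
  matrix_of s (fun p => coef (x p.2) p.1) = x.
Proof.
move=> sw xn xa; have siE e : s (iE e) = iA (s e) by case: sw.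
apply/funext => f; apply: coef_inj => e; rewrite (coef_matrix_of sw); last first.
  by move=> p _ /xn[].
rewrite /entry; case: ifP => //= J; have /antisymE/(_ e f)/eqP := xa.
rewrite addr_eq0 => /eqP xef; case: ifP => J'.
  by rewrite -mulNr -xef mulfK ?eps_neq0.
apply/esym/eqP; apply: contraFT J => xef0; have [fI eI ef sfe] := xn _ _ xef0.
rewrite /indep /= ef sfe /=; have [e1|e1] := eqVneq e (iE f).
  apply/orP; right; move/eqP: xef; rewrite -addr_eq0 e1 iE_inv -mulrDr mulf_eq0.
  by rewrite -e1 (negPf xef0).
case/orP: (leB_total e (iE f)) => [le|ge]; first by rewrite /ltB e1 le.
have : indep s (iE f, iE e); last by rewrite J'.
by rewrite /indep /= ltB_iE ef !siE iA_lt sfe iE_inv /ltB eq_sym e1 ge.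
Qed.

(** * Affine coordinates on an orbit *)

Definition chart s l GG := exists n, [/\ wtype (En n) s, reduced (En n) s l, isom l &
  GG = coord_flag l s].

Lemma isom_local_G n R l : utri (En n) R l -> isom l -> Gom omega b (lin l).
Proof. by move=> lu li; exact: isom_G (utri_local lu) li. Qed.

(** The difference l f - l' f lies in the space F''_{s f} of the flag and vanishes at all places
    with s e <= s f; transversality makes it zero. *)
Lemma chart_uniq s l l' GG : chart s l GG -> chart s l' GG -> l = l'.
Proof.
move=> [n [sw lr li ->]] [m [_ lr' li' ll']].
have siE e : s (iE e) = iA (s e) by case: sw.
have sw' : wtype (En (maxn n m)) s := wtype_widen (leq_maxl _ _) sw.
have {}lr := utri_widen (En_mono (leq_maxl n m)) lr.
have {}lr' := utri_widen (En_mono (leq_maxr n m)) lr'.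
have HH : hi_ l s = hi_ l' s.
  apply: (flag_from_inj (wtype_iflag sw' (utri_local lr) li)
    (wtype_iflag sw' (utri_local lr') li')).
  by rewrite -!coord_flagE //; [exact: isom_local_G lr' li'|exact: isom_local_G lr li].
apply/funext => f; apply/eqP; rewrite -subr_eq0; apply/eqP.
have Hf : coord_space l [set e | s e <= s f]%O = coord_space l' [set e | s e <= s f]%O.
  by have := congr1 (@^~ (s f)) HH.
have [tr0 _] := tri_transv s (s f) lr; apply: tr0.
  apply: (subspaceB (span_subspace _)); first by apply: mem_span; exists f => /=.
  by rewrite -/(coord_space l _) Hf; apply: mem_span; exists f => /=.
move=> e /= sef; rewrite coefB.
have one k : reduced (En (maxn n m)) s k -> coef (k f) e = (e == f)%:R.
  move=> kr; have [->|ef] := eqVneq e f; first by rewrite (kr f).1.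
  by apply/eqP; apply: contraTT sef => /((kr f).2 _ ef)[_ _ _]; rewrite -ltNge.
by rewrite !one // subrr.
Qed.

Lemma orbit_chart n s GG x : weyl_orbit iE sigma0 s -> orbit B (coord_flag b s) GG ->
  @coords _ _ Xind n GG x -> exists H l, [/\ iflag (En n) H, wtype (En n) s,
  reduced (En n) s l /\ isom l, H = hi_ l s /\ GG = coord_flag l s & forall a,
   basis_of (H a `&` fspan b (En n))
     (fun j : 'I_(count (below sigma0 a) (En n)) => frame_row n x a true (val j))].
Proof.
move=> so GO /coords_iflag[H [Hi GE Hb]]; rewrite GE in GO.
have [l [sw lr li HE]] := orbit_iflag Hi so GO.
exists H, l; split=> //; split=> //; rewrite GE HE coord_flagE //.
  exact: isom_local_G lr li.
by case: sw.
Qed.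

Definition lof s GG : E -> V := xget b [set l | chart s l GG].

Lemma lofP s GG l : chart s l GG -> lof s GG = l.
Proof.
move=> lc; apply: (chart_uniq (s := s) (GG := GG)) => //.
by apply: (xgetPex b (P := [set l | chart s l GG])); exists l.
Qed.

Lemma chart_cayley n s u : wtype (En n) s ->
  (forall p, indep s p -> u p != 0 -> p.1 \in En n /\ p.2 \in En n) ->
  chart s (cayley (matrix_of s u)) (coord_flag (cayley (matrix_of s u)) s).
Proof.
move=> sw un; have xn := matrix_of_nilp sw un.
exists n; split=> //; first exact: cayley_reduced xn.
exact: cayley_isom xn (matrix_of_antisym sw un).
Qed.

Lemma chart_orbit s l GG : chart s l GG -> orbit B (coord_flag b s) GG.
Proof.
move=> [n [sw lr li ->]]; exists (lin l); first exact: utri_borel lr li.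
exact: act_lin_coord_flag.
Qed.

Section AffineCell.
Variable s : E -> A.
Hypothesis so : weyl_orbit iE sigma0 s.
Local Notation O := (orbit B (coord_flag b s)).
Local Notation Oind := (ind_sub Xind O).

Lemma piece_lof n GG x : @coords _ _ Oind n GG x ->
  [/\ wtype (En n) s, reduced (En n) s (lof s GG), isom (lof s GG) & GG = coord_flag (lof s GG) s].
Proof.
move=> [GO Gx]; have [H [l [_ sw [lr li] [_ GE] _]]] := orbit_chart so GO Gx.
by rewrite (lofP (l := l)) //; exists n.
Qed.

(** Within its space of the flag, l f is determined by its coordinates on the columns [T]: 1 at f
    and 0 elsewhere. It is obtained from any frame by the row of f in the inverse of the minor on
    [T], which is invertible on the whole orbit. *)
Lemma regfun_lof n e f : regfun Oind n (fun GG => coef (lof s GG f) e).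
Proof.
have [ef|ef] := boolP ((e \in En n) && (f \in En n)); last first.
  apply: eq_regfun (regfun_cst _ n (e == f)%:R) => GG [x /piece_lof[_ lr _ _]].
  have [->|ef'] := eqVneq e f; first by rewrite (lr f).1.
  apply/esym/eqP; apply: contraNT ef => /((lr f).2 _ ef')[fI eI _ _].
  by rewrite eI.
have {ef} [eI fI] := andP ef.
set T := sel [set e | s e <= s f]%O n.
have fT : (index f T < size T)%N by rewrite index_mem mem_sel fI andbT; apply/asboolP => /=.
pose j := Ordinal fT.
have key GG x : @coords _ _ Oind n GG x -> minor_mx (s f) T x \in unitmx /\
    coef (lof s GG f) e = \sum_(i < size T) invmx (minor_mx (s f) T x) j i * x (s f, true, (val i, e)).
  move=> GGx; have [GO Gx] := GGx; have [H [l [Hi sw [lr li] [HE GE] Hb]]] := orbit_chart so GO Gx.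
  have {GE} -> : lof s GG = l by apply: lofP; exists n.
  have Hs : std (En n) (below sigma0 (s f)) (H (s f)) by case: Hi.
  have trH : transv (H (s f)) [set e | s e <= s f]%O by rewrite HE; exact: tri_transv lr.
  have [_ szT Mu] := (transv_frame _ Hs (Hb (s f))).1 trH; split=> //.
  have {}Hb := Hb (s f); rewrite -szT -/T in Hb.
  have sH : subspace (H (s f) `&` fspan b (En n)).
    by apply: subspaceI; [case: Hs|exact: fspan_subspace].
  have [_ sp _] := (basis_ofP _ sH).1 Hb.
  have [|c lc] := sp (l f).
    split; first by rewrite HE; apply: mem_span; exists f => /=.
    by have [_ lI] := utri_local lr; exact: lI.
  have cM : \row_i c i *m minor_mx (s f) T x = delta_mx 0 j.
    apply/rowP => k; rewrite !mxE eqxx /=.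
    set g := tnth (in_tuple T) k.
    have gT : g \in T by exact: mem_tnth.
    have := gT; rewrite mem_sel => /andP[/asboolP /= sgf gI].
    have -> : (k == j)%:R = coef (l f) g :> K.
      have [gf|gf] := eqVneq g f.
        rewrite gf (lr f).1 (_ : k == j) // -val_eqE /= -gf /g (tnth_nth f) /=.
        by rewrite index_uniq ?sel_uniq ?eqxx.
      rewrite (_ : coef (l f) g = 0); last first.
        by apply/eqP; apply: contraTT sgf => /((lr f).2 _ gf)[_ _ _]; rewrite -ltNge.
      rewrite (_ : (k == j) = false) //; apply: contraNF gf => /eqP kj.
      by rewrite /g kj (tnth_nth f) /= nth_index // -index_mem.
    rewrite lc coef_sum; apply: eq_bigr => i _; rewrite !mxE coefZ.
    by rewrite coef_frame_row.
  have cE i : c i = invmx (minor_mx (s f) T x) j i.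
    have : \row_i c i = delta_mx 0 j *m invmx (minor_mx (s f) T x) by rewrite -cM mulmxK.
    by move=> /rowP/(_ i); rewrite mxE -rowE mxE.
  rewrite lc coef_sum; apply: eq_bigr => i _; rewrite coefZ cE.
  by rewrite coef_frame_row.
exists (fun x => \sum_(i < size T) invmx (minor_mx (s f) T x) j i * x (s f, true, (val i, e))).
  apply: ratfun_sum => i; apply: ratfunM; last exact: ratfun_var.
  apply: ratfun_invmx => [i' j'|x [GG _ /key[]//]]; exact: ratfun_var.
by move=> GG x /key[].
Qed.

Lemma regfun_inv_cayley n e f : regfun Oind n (fun GG => coef (inv_cayley (lof s GG) f) e).
Proof.
elim/(@ltB_ind (En n)): f => f IH.
pose y GG g := coef (lof s GG f) g - (g == f)%:R.
(* The sum is restricted to g < f, the other terms being zero, so that the induction hypothesis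
   covers every summand. *)
apply: (@eq_regfun _ _ _ n (fun GG => 2%:R^-1 * (y GG e +
    \sum_(g <- En n | (g \in En n) && lt g f) (-1) * (y GG g * coef (inv_cayley (lof s GG) g) e)))).
  move=> GG [x /piece_lof[_ lr _ _]]; rewrite (inv_cayley_rec f lr) coefZ coefB.
  congr (_ * (_ + _)); first by rewrite coefB coef_basis.
  have yE g : coef (lof s GG f - b f) g = y GG g by rewrite coefB coef_basis.
  have yP g : y GG g != 0 -> [/\ f \in En n, g \in En n & lt g f].
    rewrite /y; have [->|gf] := eqVneq g f; first by rewrite (lr f).1 subrr eqxx.
    by rewrite subr0 => /((lr f).2 _ gf)[].
  rewrite (@lin_in _ _ (En n)); last by move=> g; rewrite yE => /yP[].
  rewrite coef_sum -sumrN big_mkcond /= big_seq [RHS]big_seq; apply: eq_bigr => g gI.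
  rewrite gI /= coefZ yE; case: ifP => [_|ngf]; first by rewrite mulN1r.
  have [->|/yP[_ _]] := eqVneq (y GG g) 0; first by rewrite mul0r oppr0.
  by rewrite ngf.
have yr g : regfun Oind n (fun GG => y GG g).
  by apply: regfunD; [exact: regfun_lof|exact: regfun_cst].
apply: regfunM; [exact: regfun_cst|apply: regfunD => //].
apply: regfun_sum => g /andP[gI gf]; apply: regfunM; first exact: regfun_cst.
by apply: regfunM; [exact: yr|exact: IH].
Qed.

End AffineCell.

Lemma regfun_cayley (T : Type) (Y : indvar K T) n N s (x : T -> E -> V) e f :
  (forall t, piece Y n t -> nilp N s (x t)) ->
  (forall g h, regfun Y n (fun t => coef (x t h) g)) ->
  regfun Y n (fun t => coef (cayley (x t) f) e).
Proof.
move=> xn xr; elim/(@ltB_ind (En N)): f => f IH.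
apply: (@eq_regfun _ _ _ n (fun t => (e == f)%:R + coef (x t f) e +
    \sum_(g <- En N | (g \in En N) && lt g f) coef (x t f) g * coef (cayley (x t) g) e)).
  move=> t /xn {}xn; have xP g : coef (x t f) g != 0 -> g \in En N by move=> /xn[].
  rewrite -[cayley (x t) f]lin_basis (cayleyE _ xn) lin_basis !coefD coef_basis.
  rewrite (lin_in _ xP) coef_sum; congr (_ + _).
  rewrite big_mkcond /= big_seq [RHS]big_seq; apply: eq_bigr => g gI.
  rewrite gI /= coefZ; case: ifP => // ngf.
  have [->|/xn[_ _]] := eqVneq (coef (x t f) g) 0; first by rewrite mul0r.
  by rewrite ngf.
apply: regfunD; first by apply: regfunD; [exact: regfun_cst|exact: xr].
by apply: regfun_sum => g /andP[gI gf]; apply: regfunM; [exact: xr|exact: IH].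
Qed.

Lemma regfun_entry (T : Type) (Y : indvar K T) n s (u : T -> E * E -> K) e f :
  (forall p, indep s p -> regfun Y n (u^~ p)) ->
  regfun Y n (fun t => entry s (u t) e f).
Proof.
move=> ur; rewrite /entry; case J : (indep s (e, f)); first exact: ur.
case J' : (indep s (iE f, iE e)); last exact: regfun_cst.
apply: (@eq_regfun _ _ _ n (fun t => (- (eps f / eps e)) * u t (iE f, iE e))).
  by move=> t _; rewrite mulNr mulrC mulrA.
by apply: regfunM; [exact: regfun_cst|exact: ur].
Qed.

Theorem orbit_affine (e0 : E) s : weyl_orbit iE sigma0 s ->
  ind_isomorphic (ind_sub Xind (orbit B (coord_flag b s)))
    (affine_space K (ninv iE leB s)).
Proof.
move=> so; set O := orbit B _; set N := ninv iE leB s.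
have /weyl_orbitP[k0 sw0] := so.
have siE : forall e, s (iE e) = iA (s e) by case: sw0.
pose inN i := if N is Some m then (i < m)%N else true.
have [idx [idxN idxI idxS]] : exists f, set_bij [set p | indep s p] [set i | inN i] f.
  have [f fb] := set_bij_size (isotropic_inversions iE leB s).
  by exists (f \o inversion_of); exact: set_bij_comp (inversion_of_bij siE) fb.
(* The place e0 only serves as a default for indices beyond the dimension. *)
have /choice[pos posP] : forall i, exists p, inN i -> indep s p /\ idx p = i.
  move=> i.
  have [iN|iN] := boolP (inN i); last by exists (e0, e0).
  by have [p pJ pi] := idxS i iN; exists p.
have idxK p : indep s p -> pos (idx p) = p.
  move=> pJ; have [iJ ii] := posP _ (idxN _ pJ).
  by apply: idxI; rewrite ?inE.
pose phi GG i := if inN i then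
  coef (inv_cayley (lof s GG) (pos i).2) (pos i).1 else 0.
pose u (v : nat -> K) p := v (idx p).
pose psi v := coord_flag (cayley (matrix_of s (u v))) s.
have swide n m : (n <= m)%N -> wtype (En n) s -> wtype (En m) s by exact: wtype_widen.
(* Points of the n-th affine space have at most n nonzero coordinates, at fixed indices, so their
   matrices are all supported in one E_m. *)
have piece_u n : exists m, wtype (En m) s /\ forall v, piece (affine_space K N) n v ->
    forall p, indep s p -> u v p != 0 -> p.1 \in En m /\ p.2 \in En m.
  have [m mP] := En_cover_seq ([seq (pos i).1 | i <- iota 0 n] ++ [seq (pos i).2 | i <- iota 0 n]).
  exists (maxn k0 m); split; first exact: swide (leq_maxl _ _) sw0.
  move=> v [_ [_ vP]] p pJ up; have mm := fsubsetP (En_mono (leq_maxr k0 m)).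
  have : (idx p < n)%N.
    by apply: contraNT up => ni; rewrite /u vP // negb_and ni.
  move=> pn; split; apply/mm/mP; rewrite mem_cat; apply/orP; [left|right]; apply/mapP;
    by exists (idx p); rewrite ?mem_iota ?idxK.
exists phi, psi; split.
- apply: regular_ind_morphism => n.
  (* On the n-th piece the inverse Cayley transform is supported in E_n, so only indices of pairs in
     E_n can carry nonzero coordinates. *)
  exists (\max_(p <- [seq (e, f) | e <- En n, f <- En n]) idx p).+1, phi; split.
    move=> GG [x Gx]; have [_ lr _ _] := piece_lof so Gx; split=> // i.
    rewrite -/(inN i) /phi; case: ifP => iN //; rewrite andbT => im.
    apply/eqP; apply: contraNT im => /(inv_cayley_nilp lr)[fI eI _ _].
    have [_ ii] := posP _ iN; rewrite ltnS -{1}ii.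
    apply: leq_bigmax_seq => //; apply/allpairsP.
    by exists (pos i); split=> //; case: (pos i).
  move=> i; rewrite /phi; case: (inN i); last exact: regfun_cst.
  exact: regfun_inv_cayley.
- apply: regular_ind_morphism => n; have [m [sw um]] := piece_u n.
  exists m, (fun v => flag_coords m (cayley (matrix_of s (u v))) s); split.
    move=> v /um uv; have vc := chart_cayley sw uv.
    have xn := matrix_of_nilp sw uv.
    split; first exact: chart_orbit vc.
    apply: coords_flag => //; first exact: utri_local (cayley_reduced xn).
    exact: cayley_isom xn (matrix_of_antisym sw uv).
  move=> y; apply: (@regfun_cayley _ _ n m s).
    by move=> v /um uv; exact: matrix_of_nilp.
  move=> g h; apply: (@eq_regfun _ _ _ n (fun v => entry s (u v) g h)).
    by move=> v /um uv; rewrite (coef_matrix_of sw).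
  apply: regfun_entry => p _; exists (fun x => x (idx p)); first exact: ratfun_var.
  by move=> v x [->].
- move=> GG [n _ [x Gx]]; have [sw lr li GE] := piece_lof so Gx.
  rewrite /psi (_ : matrix_of s _ = inv_cayley (lof s GG)) ?(inv_cayleyK lr) -?GE //.
  rewrite -[RHS](matrix_of_coef sw (inv_cayley_nilp lr) (inv_cayley_antisym lr li)).
  apply: eq_matrix_of => p pJ; rewrite /u /phi (idxN _ pJ : inN _) idxK //.
move=> v [n _ vn]; have [m [sw um]] := piece_u n; have uv := um _ vn.
apply/funext => i; rewrite /phi; case: ifP => iN; last first.
  by have [_ [_ ->]] := vn; rewrite // -/(inN i) iN andbF.
rewrite (lofP (chart_cayley sw uv)) (cayleyK (matrix_of_nilp sw uv)) (coef_matrix_of sw uv).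
have [iJ ii] := posP _ iN; rewrite entry_indep -?surjective_pairing //.
by rewrite /u ii.
Qed.

Lemma Fl_orbits : X = \bigcup_(s in weyl_orbit iE sigma0) orbit B (coord_flag b s).
Proof.
apply/seteqP; split=> [GG /Fl_iflag[n [H [Hf ->]]]|GG [s so /(orbit_Fl so)]//].
by have [s [_ so Os]] := iflag_orbit Hf; exists s.
Qed.

Lemma orbit_rel_position GG phi : X GG -> commensurable_via phi FF GG ->
  let hi a := phi (flag_hi b sigma0 a) in
  (exists2 s, relative_position leB b hi s & weyl_orbit iE sigma0 s) /\
  (forall s, weyl_orbit iE sigma0 s ->
     orbit B (coord_flag b s) GG <-> relative_position leB b hi s).
Proof.
move=> XGG /(commensurable_iflag XGG)[n [Hf GE]] hi.
have key s : weyl_orbit iE sigma0 s ->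
    orbit B (coord_flag b s) GG <-> relative_position leB b hi s.
  by move=> /weyl_orbitP[k sw]; rewrite GE; exact: orbitP Hf sw.
split=> //; have [s [_ so]] := iflag_orbit Hf; rewrite -GE => Os.
by exists s => //; apply/key.
Qed.

End IsotropicFlags.

Theorem theorem2
  (K : closedFieldType) (charK : [pchar K] =i pred0)
  (V : lmodType K) (omega : {biscalar V})
  (omega_nondeg : forall u, (forall v, omega u v = 0) -> u = 0)
  (* the isotropic basis E, given by an injection b of E into V *)
  (E : countType) (Einf : infinite_set [set: E])
  (b : E -> V) (b_basis : basis_of setT b)
  (iE : E -> E) (iE_inv : involutive iE)
  (b_isotropic : forall e f, f <> iE e -> omega (b e) (b f) = 0)
  (omega_sym :
     ((forall u v, omega u v = omega v u) /\ exists! e, iE e = e) \/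
     ((forall u v, omega u v = - omega v u) /\ forall e, iE e <> e))
  (En : nat -> {fset E})
  (En_stable : forall n e, e \in En n -> iE e \in En n)
  (En_incr : forall n e, e \in En n -> e \in En n.+1)
  (En_exhaust : forall e, exists n, e \in En n)
  (En_fixed : forall n e, iE e = e -> e \in En n)
  (d : Order.disp_t) (A : orderType d)
  (iA : A -> A) (iA_inv : involutive iA)
  (iA_anti : forall a c, (iA a <= iA c)%O = (c <= a)%O)
  (sigma0 : E -> A) (sigma0_surj : forall a, exists e, sigma0 e = a)
  (sigma0_iso : forall e, sigma0 (iE e) = iA (sigma0 e))
  (B : set (V -> V)) (B_borel : splitting_borel omega b En B)
  (* the total order on E such that B is the stabilizer of F_0 *)
  (leB : rel E) (leB_anti : antisymmetric leB) (leB_trans : transitive leB)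
  (leB_total : total leB)
  (leB_iE : forall e f, leB (iE e) (iE f) = leB f e)
  (leB_B : B = stab omega b (borel_flag leB b)) :
  let F (sigma : E -> A) := coord_flag b sigma in
  let FF := F sigma0 in
  let G := Gom omega b in
  let P := stab omega b FF in
  let X := Fl b omega FF in
  let Xind := Fl_ind omega b iA sigma0 En in
  let W := weyl iE in
  let WP := weyl_stab iE sigma0 in
  let Wsigma0 := weyl_orbit iE sigma0 in
  let O (sigma : E -> A) := orbit B (F sigma) in
  (* (a) *)
  [/\ [/\ [set act g FF | g in G] = X /\
          (forall g h, G g -> G h ->
             (act g FF = act h FF <-> lcoset P g = lcoset P h)),
          X = \bigcup_(sigma in Wsigma0) O sigma /\ trivIset Wsigma0 O,
          X = \bigcup_(w in W) O (sigma0 \o winv w),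
          (forall w w', W w -> W w' -> lcoset WP w = lcoset WP w' ->
             O (sigma0 \o winv w) = O (sigma0 \o winv w')) &
          (forall w w', W w -> W w' ->
             O (sigma0 \o winv w) `&` O (sigma0 \o winv w') !=set0 ->
             lcoset WP w = lcoset WP w')],
  (* (b) *)
      (forall GG phi, X GG -> commensurable_via phi FF GG ->
         let hi a := phi (flag_hi b sigma0 a) in
         (exists2 s, relative_position leB b hi s & Wsigma0 s) /\
         (forall sigma, Wsigma0 sigma ->
            (O sigma GG <-> relative_position leB b hi sigma))),
  (* (c) *)
      (forall sigma, Wsigma0 sigma ->
         ind_locally_closed Xind (O sigma) /\
         ind_isomorphic (ind_sub Xind (O sigma))
                        (affine_space K (ninv iE leB sigma))) &
  (* (d) *)
      (forall sigma tau, Wsigma0 sigma -> Wsigma0 tau ->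
         (O sigma `<=` ind_closure Xind (O tau) <-> le_om iE leB sigma tau))].
Proof.
move=> F FF G P X Xind W WP Wsigma0 O; subst B.
have orb := Fl_orbits b_basis omega_nondeg iE_inv b_isotropic omega_sym En_stable
  En_incr En_exhaust leB_anti leB_trans leB_total leB_iE iA_inv iA_anti
  sigma0_surj sigma0_iso.
have orb_eq s t GG := @orbit_eq _ _ _ _ b_basis _ omega_nondeg _ iE_inv b_isotropic
  omega_sym _ En_stable En_incr En_exhaust _ leB_anti leB_trans leB_total leB_iE
  _ _ _ _ iA_inv iA_anti sigma0_surj sigma0_iso s t GG.
split.
- split.
  + split; first exact: (Fl_G_orbit b_basis omega_nondeg iE_inv b_isotropic
      omega_sym En_stable En_incr En_exhaust leB_anti leB_trans
      leB_total leB_iE iA_inv iA_anti sigma0_surj sigma0_iso).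
    move=> g h Gg Gh; exact: (lcoset_stab b_basis omega_nondeg iE_inv
      b_isotropic En_stable En_incr En_exhaust leB_anti leB_trans
      leB_total leB_iE iA_inv iA_anti sigma0_iso Gg Gh).
  + by split=> [//|s t sO tO [GG [Os Ot]]]; exact: orb_eq Os Ot.
  + by rewrite /X orb bigcup_image.
  + by move=> w w' Ww Ww' /(lcoset_weyl sigma0 Ww Ww')->.
  + move=> w w' Ww Ww' [GG [Ow Ow']]; apply/(lcoset_weyl sigma0 Ww Ww').
    by apply: orb_eq Ow Ow'; [exists w|exists w'].
- move=> GG phi XGG cvia; exact: (orbit_rel_position b_basis omega_nondeg iE_inv
      b_isotropic En_stable En_incr En_exhaust
    leB_anti leB_trans leB_total leB_iE iA_inv iA_anti sigma0_iso XGG cvia).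
- move=> s so; split.
    exact: (orbit_locally_closed b_basis omega_nondeg iE_inv b_isotropic
      omega_sym En_stable En_incr En_exhaust leB_anti leB_trans
      leB_total leB_iE iA_inv iA_anti sigma0_surj sigma0_iso so).
  have [e0 _] := infinite_setN0 Einf.
  exact: (orbit_affine b_basis charK omega_nondeg iE_inv b_isotropic
      omega_sym En_stable En_incr En_exhaust leB_anti leB_trans
    leB_total leB_iE iA_inv iA_anti sigma0_iso e0 so).
- move=> s t; exact: (closure_le_om b_basis charK omega_nondeg iE_inv b_isotropic
    omega_sym En_stable En_incr En_exhaust En_fixed leB_anti
    leB_trans leB_total leB_iE iA_inv iA_anti sigma0_surj sigma0_iso).
Qed.
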